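(* Let $(\lambda^{(N)})$ be a sequence of partitions and $(m^{(N)})$ a sequence of positive integers with $\ell(\lambda^{(N)})\le m^{(N)}$; write $\lambda,m$ and $n=|\lambda|$. If $n/m\to0$, then for each fixed $d\ge2$, $\kappa_d^{\lambda;m}\sim\frac{B_d}{d}\,n\,m^d$. Furthermore: (i) if $n$ converges to a finite value $M$, then $\mathcal X_{\lambda;m}[\mathrm{rank}]^*$ converges in distribution to $\mathcal{IH}_M^*$; (ii) if $n\to\infty$, then $\mathcal X_{\lambda;m}[\mathrm{rank}]$ is asymptotically normal.
   Context: $\mathrm{SSYT}_{\le m}(\lambda)$ is the set of semistandard tableaux of shape $\lambda$ with entries in $\{1,\dots,m\}$ (rows weakly increasing, columns strictly increasing). $\mathrm{rank}(T)=\sum_i(i-1)\alpha_i$, $\alpha_i$ the number of entries equal to $i$. $\mathcal X_{\lambda;m}[\mathrm{rank}]$ is $\mathrm{rank}(T)$ for $T$ uniform in $\mathrm{SSYT}_{\le m}(\lambda)$, and $\kappa_d^{\lambda;m}$ its $d$-th cumulant. $B_d$ is the $d$-th Bernoulli number. $\mathcal{IH}_M$ is the sum of $M$ independent $\mathcal U[0,1]$ random variables. $\mathcal X^*=(\mathcal X-\mu)/\sigma$; asymptotically normal means the standardizations converge in distribution to $\mathcal N(0,1)$. Limits are as $N\to\infty$. *)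

(* Defs.v *)
From HB Require Import structures.
From mathcomp Require Import all_boot all_order all_algebra finmap.
From mathcomp Require Import all_classical all_reals all_analysis.
From mathcomp Require Import measurable_realfun.

Set Implicit Arguments.
Unset Strict Implicit.
Unset Printing Implicit Defensive.

Import Order.TTheory GRing.Theory Num.Theory.
Import numFieldNormedType.Exports.

Local Open Scope classical_set_scope.
Local Open Scope ring_scope.

(* [:: B_0; ...; B_(n-1)], by \sum_(k <= j) 'C(j+1, k) B_k = [j = 0]. *)
Fixpoint bernoulli_seq (n : nat) : seq rat :=
  if n is j.+1 then
    let s := bernoulli_seq j in
    rcons s (((j == 0)%N%:R - \sum_(k < j) 'C(j.+1, k)%:R * s`_k) / j.+1%:R)
  else [::].

Definition bernoulli (d : nat) : rat := (bernoulli_seq d.+1)`_d.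

Lemma size_bernoulli_seq n : size (bernoulli_seq n) = n.
Proof. by elim: n => //= n IH; rewrite size_rcons IH. Qed.

Lemma nth_bernoulli_seq n k : (k < n)%N -> (bernoulli_seq n)`_k = bernoulli k.
Proof.
elim: n => // n IH; rewrite ltnS leq_eqVlt => /orP[/eqP -> //|kn].
by rewrite /= nth_rcons size_bernoulli_seq kn IH.
Qed.

Lemma bernoulli_rec n :
  \sum_(k < n.+1) 'C(n.+1, k)%:R * bernoulli k = (n == 0)%N%:R.
Proof.
rewrite big_ord_recr/= binSn.
rewrite [X in _ + _ * X]/bernoulli/= nth_rcons size_bernoulli_seq ltnn eqxx.
rewrite mulrC divfK ?pnatr_eq0//.
under [X in _ + (_ - X)]eq_bigr do rewrite nth_bernoulli_seq//.
by rewrite addrC subrK.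
Qed.

Definition is_partition (lam : seq nat) : bool :=
  sorted geq lam && (0%N \notin lam).

(* Rows and columns are numbered from 0. *)
Definition cell (lam : seq nat) := {i : 'I_(size lam) & 'I_(nth 0%N lam i)}.
Definition row_of lam (c : cell lam) : nat := tag c.
Definition col_of lam (c : cell lam) : nat := tagged c.

(* The discrete sigma-algebra makes fillings a sample space; the pointed
   structure is only there because measurable types require one. *)
Definition filling (lam : seq nat) := {ffun cell lam -> nat}.
HB.instance Definition _ lam := Choice.on (filling lam).
HB.instance Definition _ lam :=
  isPointed.Build (filling lam) [ffun=> 0%N].
HB.instance Definition _ lam := @isMeasurable.Build default_measure_display
  (filling lam) discrete_measurable discrete_measurable0
  discrete_measurableC discrete_measurableU.

Definition ssyt (lam : seq nat) (m : nat) : set (filling lam) :=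
  [set T | [/\ forall c, (1 <= T c <= m)%N,
               forall c c', row_of c = row_of c' ->
                 (col_of c < col_of c')%N -> (T c <= T c')%N &
               forall c c', col_of c = col_of c' ->
                 (row_of c < row_of c')%N -> (T c < T c')%N]].

Arguments ssyt : clear implicits.

Lemma measurable_ssyt lam m : measurable (ssyt lam m).
Proof. by []. Qed.

Lemma ssyt_neq0 lam m : (size lam <= m)%N -> ssyt lam m !=set0.
Proof.
move=> lm; exists [ffun c => (row_of c).+1]; split=> [c|c c' rr _|c c' _ rr].
- by rewrite ffunE/=; apply: leq_trans lm; exact: ltn_ord.
- by rewrite !ffunE rr.
- by rewrite !ffunE ltnS.
Qed.

Lemma finite_ssyt lam m : finite_set (ssyt lam m).
Proof.
apply: (@sub_finite_set _ _ (range
  (fun f : {ffun cell lam -> 'I_m.+1} =>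
     [ffun c => f c : nat] : filling lam))) => [T [Tm _ _]|].
  exists [ffun c => inord (T c)] => //.
  apply/ffunP => c; rewrite !ffunE inordK// ltnS.
  by have /andP[] := Tm c.
by apply: finite_image; exact: finite_finset.
Qed.

Definition alpha lam (T : filling lam) (i : nat) : nat :=
  #|[pred c | T c == i]|.

Section rank.
Context (R : realType) (lam : seq nat) (m : nat).

Definition rank (T : filling lam) : R :=
  (\sum_(1 <= i < m.+1) i.-1 * alpha T i)%N%:R.

Let measurable_rank : measurable_fun [set: filling lam] rank.
Proof. by []. Qed.

HB.instance Definition _ :=
  isMeasurableFun.Build _ _ (filling lam) R rank measurable_rank.

End rank.

(* U |-> #|U n A| / #|A|.  The second argument of [mnormalize] is the value
   taken when A is empty or infinite. *)
Section uniform_on.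
Context d (T : measurableType d) (R : realType) (A : set T) (mA : measurable A).

Definition uniform_on : set T -> \bar R :=
  mnormalize (mrestr (@counting T R) mA) (dirac point : probability T R).

HB.instance Definition _ := Probability.on uniform_on.

Lemma uniform_onE U : finite_set A -> A !=set0 ->
  uniform_on U = ((#|` fset_set (U `&` A)|)%:R / (#|` fset_set A|)%:R)%:E.
Proof.
move=> finA A0; have A_gt0 : (0 < #|` fset_set A|)%N.
  rewrite cardfs_gt0; apply/negP => /eqP/(congr1 (fun X => [set` X])).
  by rewrite fset_setK//= => A_eq0; move: A0; rewrite A_eq0 set_fset0 => -[].
have finUA : finite_set (U `&` A) by exact: finite_setIr.
rewrite /uniform_on /mnormalize/= /mrestr setTI /counting !asboolT//=.
by rewrite orbF eqe pnatr_eq0 eqn0Ngt A_gt0/= asboolT.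
Qed.

End uniform_on.

Definition uniform_ssyt (R : realType) (lam : seq nat) (m : nat) :
    probability (filling lam) R :=
  uniform_on R (measurable_ssyt lam m).

(* k! times the k-th Taylor coefficient at 0 of log E[exp(tX)]. *)
Definition cumulant d (T : measurableType d) (R : realType)
    (P : probability T R) (X : {RV P >-> R}) (k : nat) : R :=
  derive1n k (fun t : R => ln (fine ('M_P X t))) 0.

Section standardize.
Context d (T : measurableType d) (R : realType) (P : probability T R).
Variable X : {RV P >-> R}.

(* If the variance is 0, this is the zero variable, since x / 0 = 0. *)
Definition standardize_fun (w : T) : R :=
  (X w - fine 'E_P[X]) / Num.sqrt (fine 'V_P[X]).

Let measurable_standardize : measurable_fun [set: T] standardize_fun.
Proof. by apply: measurable_funM => //; exact: measurable_funB. Qed.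

HB.instance Definition _ :=
  isMeasurableFun.Build _ _ T R standardize_fun measurable_standardize.

Definition standardize : {RV P >-> R} := standardize_fun : {mfun T >-> R}.

End standardize.

Definition law d (T : measurableType d) (R : realType) (P : probability T R)
    (X : {RV P >-> R}) : probability R R :=
  distribution P X.

Definition cvg_in_distribution (R : realType)
    (mu : nat -> probability R R)
    (nu : probability R R) : Prop :=
  forall x : R, {for x, continuous (fun y : R => nu `]-oo, y]%classic)} ->
    mu N `]-oo, x]%classic @[N --> \oo] --> nu `]-oo, x]%classic.

(* The library's distributions on the real line are measures on
   [measurableTypeR R], whereas random variables take their values in [R]; both
   carry the Borel sigma-algebra. *)
Section standard_normal.
Context (R : realType).

Definition real_id : measurableTypeR R -> R := idfun.

Let measurable_real_id : measurable_fun setT real_id.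
Proof. exact: measurable_id. Qed.

HB.instance Definition _ :=
  isMeasurableFun.Build _ _ _ R real_id measurable_real_id.

Definition standard_normal : probability R R :=
  distribution (normal_prob (0 : R) 1) real_id.

End standard_normal.

Section irwin_hall.
Context (R : realType).
Local Notation T := (measurableTypeR R).

Definition cons_tuple n (x : T * n.-tuple T) : n.+1.-tuple T :=
  [the n.+1.-tuple T of x.1 :: x.2].

Let measurable_cons_tuple n :
  measurable_fun [set: T * n.-tuple T] (@cons_tuple n).
Proof. exact: measurable_cons. Qed.

HB.instance Definition _ n :=
  isMeasurableFun.Build _ _ _ _ (@cons_tuple n) (@measurable_cons_tuple n).

(* The n-fold product of U[0,1]: under it, the n coordinates are independent
   and uniform on [0,1]. *)
Fixpoint uniform_tuple (n : nat) : probability (n.-tuple T) R :=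
  if n is k.+1 then
    distribution (uniform_prob (@ltr01 R) \x uniform_tuple k)%E (@cons_tuple k)
  else dirac ([tuple] : 0.-tuple T).

Definition irwin_hall_sum n (t : n.-tuple T) : R := \sum_(i < n) tnth t i.

Let measurable_irwin_hall_sum n :
  measurable_fun [set: n.-tuple T] (@irwin_hall_sum n).
Proof. by apply: measurable_sum => i; exact: measurable_tnth. Qed.

HB.instance Definition _ n :=
  isMeasurableFun.Build _ _ _ R (@irwin_hall_sum n)
    (@measurable_irwin_hall_sum n).

Definition irwin_hall n : {RV (uniform_tuple n) >-> R} :=
  @irwin_hall_sum n : {mfun n.-tuple T >-> R}.

End irwin_hall.

Definition rank_ssyt (R : realType) (lam : seq nat) (m : nat) :
    {RV (uniform_ssyt R lam m) >-> R} :=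
  @rank R lam m : {mfun filling lam >-> R}.

(* Main.v *)
(* Write S(y) = sinh(y)/y and [a]_t = 1 + e^t + ... + e^((a-1)t).

   Branching over the entries equal to m turns the sum of q^rank over tableaux
   into a multiple of a Vandermonde determinant, so that, up to the factors C and
   e^(ct), E[e^(tX)] is the product over the cells of [m + content]_t / [hook]_t.
   The d-th derivative of log [a]_t at 0 is B_d/d (a^d - 1) for d >= 2, whence
   kappa_d = B_d/d * sum ((m + content)^d - hook^d).  Each of the n shifted
   contents is within n of m and each hook is at most n, which gives the
   asymptotics of kappa_d, in particular sigma^2 ~ n m^2/12.

   By the same product, the standardized variable has the moment generating
   function given by the product over the cells of
   S((m + content) tau/2) / S(hook tau/2) with tau = t/sigma.  As S is increasing
   in y^2 and 1 + y^2/6 <= S(y) <= e^(y^2/6), it is squeezed between quantities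
   tending to S(t sqrt(3/M))^M, that of the standardized IH_M, when n = M
   eventually, and to e^(t^2/2) when n tends to infinity.

   Pointwise convergence of moment generating functions implies convergence in
   distribution (Curtiss): convergence of integrals passes from e^(tx) to
   x^k e^(tx) by difference quotients, to cosines and sines by power series, and
   to polynomials in sin(bx), which approximate the indicators of half-lines. *)

Require Import Defs.
From mathcomp Require Import all_boot all_order all_algebra finmap.
From mathcomp Require Import all_classical all_reals all_analysis.
From mathcomp Require Import measurable_realfun.
From mathcomp Require Import zify ring lra.

Set Implicit Arguments.
Unset Strict Implicit.
Unset Printing Implicit Defensive.

Import Order.TTheory GRing.Theory Num.Theory.
Import numFieldNormedType.Exports.

Local Open Scope classical_set_scope.
Local Open Scope ring_scope.

(** * Determinants of truncated geometric sums *)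

(** Hook lengths do not enter through arms and legs: with l_i = lam_i + m - 1 - i, they are the
    numbers in [1, l_i] that are not of the form l_i - l_j with j > i. The gaps and the hooks of row
    i thus fill [1, l_i], and this turns a quotient of two Vandermonde determinants into the product
    over contents and hooks, one row at a time. Branching determines the generating function only up
    to a factor depending on m and q; the empty shape, which has a single tableau, fixes it. Since
    branching divides by q^j - 1, the product formula is first obtained for t nonzero and then
    extended to t = 0 by continuity. The factor e^(ct) that it leaves unknown is removed by
    centering, as the same c occurs in the first cumulant. In the limit theorem the obstacle is
    periodicity: a polynomial in sin(bx) imitates the indicator of a half-line only on a bounded
    interval. Outside of it the error is charged to e^(|x| - A), whose integrals are small for large
    A, uniformly in large N, because the exponential moments converge. *)

Section determinants.
Context (F : fieldType).
Implicit Types (q : F) (m : nat).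

(** Multilinearity in the rows, read off from the Leibniz formula: for a fixed permutation, the
    product over the rows distributes over the independent choices [f i]. *)
Lemma sum_family_det m (J : finType) (Q : 'I_m -> pred J) (G : 'I_m -> J -> 'I_m -> F) :
  \sum_(f in family Q) \det (\matrix_(i < m, j < m) G i (f i) j)
  = \det (\matrix_(i < m, j < m) \sum_(k | Q i k) G i k j).
Proof.
rewrite /determinant exchange_big/=; apply: eq_bigr => s _.
rewrite -mulr_sumr; congr (_ * _).
under [RHS]eq_bigr do rewrite mxE.
rewrite bigA_distr_big_dep; apply: eq_bigr => f _.
by apply: eq_bigr => i _; rewrite mxE.
Qed.

Lemma det_row_scale m (d : 'I_m -> F) (A : 'I_m -> 'I_m -> F) :
  \det (\matrix_(i < m, j < m) (d i * A i j)) =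
  (\prod_i d i) * \det (\matrix_(i < m, j < m) A i j).
Proof.
have -> : \matrix_(i < m, j < m) (d i * A i j) =
    diag_mx (\row_i d i) *m \matrix_(i < m, j < m) A i j.
  by apply/matrixP => i j; rewrite mul_diag_mx !mxE.
by rewrite det_mulmx det_diag; under eq_bigr do rewrite mxE.
Qed.

Lemma det_col_scale m (d : 'I_m -> F) (A : 'I_m -> 'I_m -> F) :
  \det (\matrix_(i < m, j < m) (A i j * d j)) =
  \det (\matrix_(i < m, j < m) A i j) * \prod_j d j.
Proof.
have -> : \matrix_(i < m, j < m) (A i j * d j) =
    \matrix_(i < m, j < m) A i j *m diag_mx (\row_i d i).
  by apply/matrixP => i j; rewrite mul_mx_diag !mxE.
by rewrite det_mulmx det_diag; under eq_bigr do rewrite mxE.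
Qed.

(** Subtracting from each row the next one clears the first column except for its last entry; the
    sign is that of the corresponding cofactor. *)
Lemma det_row_diff m (W : nat -> nat -> F) : (forall i, W i 0%N = 1) ->
  \det (\matrix_(i < m.+1, j < m.+1) W i j) =
  (-1) ^+ m * \det (\matrix_(i < m, j < m) (W i j.+1 - W i.+1 j.+1)).
Proof.
move=> W0.
pose L : 'M[F]_m.+1 := \matrix_(i, j) ((j == i)%:R - (j == i.+1 :> nat)%:R).
have detL : \det L = 1.
  rewrite -det_tr det_trig.
    by apply: big1 => i _; rewrite !mxE eqxx ltn_eqF ?ltnSn// subr0.
  apply/is_trig_mxP => i j ij; rewrite !mxE.
  have /negbTE -> : i != j by apply: contraTneq ij => ->; rewrite ltnn.
  by rewrite (_ : (_ == _ :> nat) = false) ?subr0//; lia.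
pose A : 'M[F]_m.+1 := \matrix_(i < m.+1, j < m.+1) W i j.
have LA i j : (L *m A) i j = W i j - (if (i < m)%N then W i.+1 j else 0).
  rewrite !mxE; under eq_bigr do rewrite !mxE mulrBl.
  rewrite sumrB; congr (_ - _).
    rewrite (bigD1 i)//= eqxx mul1r big1 ?addr0// => k ki.
    by rewrite (negbTE ki) mul0r.
  case: ifPn => im.
    rewrite (bigD1 (Ordinal (im : (i.+1 < m.+1)%N)))//= eqxx mul1r big1 ?addr0// => k ki.
    rewrite (_ : (_ == _ :> nat) = false) ?mul0r//.
    by apply: contraNF ki => /eqP ki; apply/eqP/val_inj.
  apply: big1 => k _; rewrite (_ : (_ == _ :> nat) = false) ?mul0r//.
  by have := ltn_ord k; lia.
rewrite -/A -[LHS]mul1r -[X in X * _]detL -det_mulmx (expand_det_col _ ord0).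
rewrite (bigD1 ord_max)//= big1 ?addr0 => [|i im].
  rewrite LA /= ltnn W0 subr0 mul1r /cofactor addn0. congr (_ * \det _).
  apply/matrixP => i j; rewrite [LHS]mxE [LHS]mxE LA !mxE lift_max ltn_ord.
  by rewrite lift0.
have {}im : (i < m)%N.
  have := ltn_ord i; rewrite ltnS leq_eqVlt => /orP[/eqP im'|//].
  by case/negP: im; apply/eqP/val_inj.
by rewrite LA im/= !W0 subrr mul0r.
Qed.

Lemma sum_ord_range_expr (K a b c : nat) (x : F) : (a <= b < K)%N ->
  (\sum_(k < K | (a <= k <= b)%N) x ^+ (k + c)) * (x - 1)
  = x ^+ (b.+1 + c) - x ^+ (a + c).
Proof.
move=> /andP[ab bK].
rewrite mulr_suml -(big_mkord (fun k => a <= k <= b)%N (fun k => x ^+ (k + c) * (x - 1))).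
have -> : x ^+ (b.+1 + c) - x ^+ (a + c) = \sum_(a <= k < b.+1) x ^+ (k + c) * (x - 1).
  under eq_bigr do rewrite mulrBr mulr1 -exprSr -addSn.
  by rewrite (telescope_sumr (fun k => x ^+ (k + c)))// leqW.
rewrite (big_nat_widen _ _ _ _ _ bK) (big_nat_widenl _ _ _ _ _ (leq0n a)).
by apply: eq_bigl => k; rewrite ltnS andbC.
Qed.

(** The strictly decreasing exponents of the bialternant formula, with rows counted from 0. *)
Definition shifted_part (lam : seq nat) m i := (nth 0 lam i + (m.-1 - i))%N.

(** The numerator of the bialternant formula for the Schur polynomial of [lam] at the point (1, q,
    ..., q^(m-1)). *)
Definition weyl_det q m (lam : seq nat) : F :=
  \det (\matrix_(i < m, j < m) q ^+ (shifted_part lam m i * j)).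

(** The shapes that can remain after removing the largest entry m + 1: [lam] minus a horizontal
    strip. The bound [K] only serves to make the set of candidates finite. *)
Definition interlacing m K (lam : seq nat) : pred {ffun 'I_m -> 'I_K} :=
  family (fun i : 'I_m => [pred k : 'I_K | nth 0 lam i.+1 <= k <= nth 0 lam i]%N).

(** The result always has length m and may end in zeros, so it need not satisfy [is_partition]. The
    inductions on m therefore assume only that the parts decrease weakly. *)
Definition ffun_seq m K (mu : {ffun 'I_m -> 'I_K}) : seq nat :=
  [seq val (mu i) | i <- enum 'I_m].

Lemma size_ffun_seq m K (mu : {ffun 'I_m -> 'I_K}) : size (ffun_seq mu) = m.
Proof. by rewrite size_map size_enum_ord. Qed.

Lemma nth_ffun_seq m K (mu : {ffun 'I_m -> 'I_K}) (i : 'I_m) :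
  nth 0%N (ffun_seq mu) i = mu i.
Proof.
by rewrite (nth_map i) ?size_enum_ord// nth_ord_enum.
Qed.

(* Summing row [i] over the interlacing range telescopes to the difference of two
   consecutive rows of the larger determinant. *)
Lemma weyl_det_branching q m : q != 0 -> (forall j, q ^+ j.+1 != 1) ->
  exists C : F, forall K lam,
    (forall i, nth 0 lam i.+1 <= nth 0 lam i)%N -> (nth 0 lam 0 < K)%N ->
    \sum_(mu in @interlacing m K lam) q ^+ (\sum_i mu i) * weyl_det q m (ffun_seq mu)
    = C * weyl_det q m.+1 lam.
Proof.
move=> q0 q1.
(* The power of q, distributed over the rows together with q^|mu|, raises the column exponents from
   j to j + 1; the product clears the denominators of the geometric sums column by column; the sign
   is that of [det_row_diff]. *)
exists ((q ^+ (\sum_(i < m) (m.-1 - i)))^-1 * (\prod_(j < m) (q ^+ j.+1 - 1))^-1 * (-1) ^+ m).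
move=> K lam lamD lamK.
have lam0 i : (nth 0 lam i < K)%N.
  by elim: i => // i IH; apply: leq_ltn_trans IH; exact: lamD.
have d0 : q ^+ (\sum_(i < m) (m.-1 - i)) != 0 by rewrite expf_neq0.
have p0 : \prod_(j < m) (q ^+ j.+1 - 1) != 0.
  by apply/prodf_neq0 => j _; rewrite subr_eq0.
rewrite -!mulrA; apply: (canRL (mulKf d0)); apply: (canRL (mulKf p0)).
rewrite [X in _ * X]mulr_sumr.
pose G (i : 'I_m) (k : 'I_K) (j : 'I_m) := (q ^+ j.+1) ^+ (k + (m.-1 - i)).
transitivity (\prod_(j < m) (q ^+ j.+1 - 1) *
    \sum_(mu in @interlacing m K lam) \det (\matrix_(i < m, j < m) G i (mu i) j)).
  congr (_ * _); apply: eq_bigr => mu _.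
  rewrite mulrA -exprD -big_split/= expr_sum -det_row_scale; congr (\det _).
  apply/matrixP => i j; rewrite !mxE /G /shifted_part nth_ffun_seq -exprD -exprM.
  by congr (q ^+ _); lia.
rewrite sum_family_det mulrC -det_col_scale /weyl_det.
rewrite (@det_row_diff m (fun i j => q ^+ (shifted_part lam m.+1 i * j))); last first.
  by move=> i; rewrite muln0 expr0.
rewrite mulrA -exprMn mulrNN mulr1 expr1n mul1r; congr (\det _).
apply/matrixP => i j; rewrite !mxE.
rewrite sum_ord_range_expr; last by rewrite lamD lam0.
rewrite -!exprM /shifted_part; have := ltn_ord i => im.
by rewrite ![(j.+1 * _)%N]mulnC; congr (q ^+ (_ * _) - q ^+ (_ * _)); lia.
Qed.

End determinants.

(** * Branching and the Weyl product for semistandard tableaux *)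

Section tableaux.
Implicit Types (lam : seq nat) (m : nat).

Definition mk_filling lam (f : nat -> nat -> nat) : filling lam :=
  [ffun c => f (row_of c) (col_of c)].

(** A filling as a function of two naturals, with value 0 outside of the diagram: fillings of
    different shapes, whose cell types differ, can then be compared directly. *)
Definition entry lam (T : filling lam) (i j : nat) : nat :=
  if insub i is Some i' then
    if insub j is Some j' then
      T (existT (fun i : 'I_(size lam) => 'I_(nth 0%N lam i)) i' j') else 0%N
  else 0%N.

Lemma entryE lam (T : filling lam) c : entry T (row_of c) (col_of c) = T c.
Proof. by case: c => i j; rewrite /entry /row_of /col_of /= !valK. Qed.

Lemma mk_fillingK lam (T : filling lam) : mk_filling lam (entry T) = T.
Proof. by apply/ffunP => c; rewrite ffunE entryE. Qed.

Lemma cellP lam i j : (j < nth 0 lam i)%N ->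
  exists c : cell lam, row_of c = i /\ col_of c = j.
Proof.
move=> jl; have il : (i < size lam)%N.
  by rewrite ltnNge; apply/negP => /(nth_default 0%N) h; rewrite h in jl.
by exists (existT (fun i : 'I_(size lam) => 'I_(nth 0%N lam i))
  (Ordinal il) (Ordinal (jl : (j < nth 0 lam (Ordinal il))%N))).
Qed.

Lemma col_lt lam (c : cell lam) : (col_of c < nth 0 lam (row_of c))%N.
Proof. by case: c => i j; exact: ltn_ord. Qed.

Lemma entry_mk lam f i j : (j < nth 0 lam i)%N -> entry (mk_filling lam f) i j = f i j.
Proof. by move=> /cellP[c [<- <-]]; rewrite entryE ffunE. Qed.

Lemma ssyt_mkP lam m f : ssyt lam m (mk_filling lam f) <->
  [/\ forall i j, (j < nth 0 lam i)%N -> (1 <= f i j <= m)%N,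
      forall i j j', (j' < nth 0 lam i)%N -> (j < j')%N -> (f i j <= f i j')%N &
      forall i i' j, (j < nth 0 lam i)%N -> (j < nth 0 lam i')%N -> (i < i')%N ->
        (f i j < f i' j)%N].
Proof.
split=> [[b r c]|[b r c]]; split.
- by move=> i j /cellP[x [<- <-]]; have := b x; rewrite ffunE.
- move=> i j j' hj' jj'; have hj := ltn_trans jj' hj'.
  have [x [x1 x2]] := cellP hj; have [y [y1 y2]] := cellP hj'.
  by have := r x y; rewrite !ffunE x1 x2 y1 y2; apply.
- move=> i i' j hj hj' ii'.
  have [x [x1 x2]] := cellP hj; have [y [y1 y2]] := cellP hj'.
  by have := c x y; rewrite !ffunE x1 x2 y1 y2; apply.
- by move=> x; rewrite ffunE; apply/b/col_lt.
- by move=> x y xy lxy; rewrite !ffunE xy; apply: r => //; exact: col_lt.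
- move=> x y xy lxy; rewrite !ffunE xy; apply: c => //; last exact: col_lt.
  by rewrite -xy col_lt.
Qed.

Lemma sum_cell (V : nmodType) lam M (G : nat -> nat -> V) : (size lam <= M)%N ->
  \sum_(c : cell lam) G (row_of c) (col_of c) =
  \sum_(i < M) \sum_(j < nth 0%N lam i) G i j.
Proof.
move=> lM; transitivity (\sum_(i < size lam) \sum_(j < nth 0%N lam i) G i j).
  rewrite (sig_big_dep xpredT (fun i => xpredT)
    (fun (i : 'I_(size lam)) (j : 'I_(nth 0%N lam i)) => G i j)).
  by apply: eq_bigr => -[].
rewrite (big_ord_widen M (fun i => \sum_(j < nth 0%N lam i) G i j) lM) big_mkcond/=.
apply: eq_bigr => i _; case: ltnP => // /(nth_default 0%N) ->.
by rewrite big_ord0.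
Qed.

(** Counting m - T c instead of T c - 1 suits the branching: when m becomes m + 1, a new entry m + 1
    weighs 0 and every other cell gains 1, which gives the factor q^|mu|. *)
Definition coweight m lam (T : filling lam) : nat := \sum_c (m - T c)%N.

Lemma coweight_mk m lam f M : (size lam <= M)%N ->
  coweight m (mk_filling lam f) = (\sum_(i < M) \sum_(j < nth 0 lam i) (m - f i j))%N.
Proof.
move=> lM; rewrite -(sum_cell (fun i j => m - f i j)%N lM).
by apply: eq_bigr => c _; rewrite ffunE.
Qed.

Definition low_shape m lam (T : filling lam) (i : nat) : nat :=
  #|[pred j : 'I_(nth 0 lam i) | (entry T i j <= m)%N]|.

Lemma card_ord_lt n k : (k <= n)%N -> #|[pred j : 'I_n | (j < k)%N]| = k.
Proof.
move=> kn; rewrite -sum1_card.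
by rewrite -(big_ord_widen n (fun=> 1%N) kn) sum_nat_const card_ord muln1.
Qed.

Definition extend_filling m (s lam : seq nat) (T : filling s) : filling lam :=
  mk_filling lam (fun i j => if (j < nth 0 s i)%N then entry T i j else m.+1).

(** A downward closed subset of [0, n) is an initial segment, hence determined by its
    cardinality. *)
Lemma card_downset n (P : pred nat) :
  (forall j j', (j < j' < n)%N -> P j' -> P j) ->
  forall j, (j < n)%N -> (j < #|[pred j : 'I_n | P j]|)%N = P j.
Proof.
move=> dP j jn; case: (boolP (P j)) => Pj.
  rewrite -[X in (X <= _)%N](card_ord_lt jn); apply/subset_leq_card/fintype.subsetP => k.
  rewrite !inE ltnS leq_eqVlt => /orP[/eqP ->//|kj].
  by apply: dP Pj; rewrite kj.
apply/negbTE; rewrite -leqNgt -[X in (_ <= X)%N](card_ord_lt (ltnW jn)).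
apply/subset_leq_card/fintype.subsetP => k; rewrite !inE => Pk.
rewrite ltnNge leq_eqVlt; apply/negP => /orP[/eqP jk|jk].
  by rewrite jk Pk in Pj.
by move/negP: Pj; apply; apply: dP Pk; rewrite jk/=.
Qed.

Lemma low_shape_entry m' m lam (T : filling lam) i j : ssyt lam m' T ->
  (j < nth 0 lam i)%N -> (j < low_shape m T i)%N = (entry T i j <= m)%N.
Proof.
rewrite -{1}(mk_fillingK T) => /ssyt_mkP[_ r _] jl.
apply: (@card_downset _ (fun j => entry T i j <= m)%N) => // k k' /andP[kk' k'l].
by apply: leq_trans; exact: r.
Qed.

Lemma low_shape_le m lam (T : filling lam) i : (low_shape m T i <= nth 0 lam i)%N.
Proof. by rewrite /low_shape (leq_trans (max_card _))// card_ord. Qed.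

(** The entry above a cell of row i + 1 is smaller than an entry at most m + 1. *)
Lemma low_shape_ge m lam (T : filling lam) i : ssyt lam m.+1 T ->
  (nth 0 lam i.+1 <= nth 0 lam i)%N -> (nth 0 lam i.+1 <= low_shape m T i)%N.
Proof.
rewrite -{1}(mk_fillingK T) => /ssyt_mkP[b _ c] ll.
rewrite -[X in (X <= _)%N](card_ord_lt ll); apply/subset_leq_card/fintype.subsetP => k.
rewrite !inE => kl.
have /andP[_ h] := b i.+1 k kl.
by rewrite -ltnS; apply: leq_trans h; apply: c.
Qed.

Lemma entry_ge_row m lam (T : filling lam) i j :
  (forall i, nth 0 lam i.+1 <= nth 0 lam i)%N ->
  ssyt lam m T -> (j < nth 0 lam i)%N -> (i < entry T i j)%N.
Proof.
move=> lamD; rewrite -{1}(mk_fillingK T) => /ssyt_mkP[b _ c].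
elim: i => [|i IH] jl; first by have /andP[] := b _ _ jl.
have jl' := leq_trans jl (lamD i).
by apply: leq_ltn_trans (IH jl') _; exact: c.
Qed.

(** By strictness of the columns, row i (counted from 0) holds only entries above i. So the first m
    rows record the whole low shape. *)
Lemma low_shape_ge_row m lam (T : filling lam) i :
  (forall i, nth 0 lam i.+1 <= nth 0 lam i)%N ->
  ssyt lam m.+1 T -> (m <= i)%N -> low_shape m T i = 0%N.
Proof.
move=> lamD sT mi; apply/eqP; rewrite -leqn0 leqNgt; apply/negP => h.
have jl := leq_trans h (low_shape_le m T i).
move: h; rewrite (low_shape_entry _ sT)//; apply/negP; rewrite -ltnNge.
by apply: leq_ltn_trans mi _; exact: entry_ge_row sT _.
Qed.

Section branching.
Variables (m K : nat) (lam : seq nat) (mu : {ffun 'I_m -> 'I_K}).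
Hypothesis lamD : forall i, (nth 0 lam i.+1 <= nth 0 lam i)%N.
Hypothesis sz : (size lam <= m.+1)%N.
Hypothesis mu_lam : interlacing lam mu.
Let s := ffun_seq mu.

Let s_big i : (m <= i)%N -> nth 0%N s i = 0%N.
Proof. by move=> mi; rewrite nth_default// size_ffun_seq. Qed.

Let s_le i : (nth 0 s i <= nth 0 lam i)%N.
Proof.
case: (ltnP i m) => [im|mi]; last by rewrite s_big.
by rewrite (nth_ffun_seq mu (Ordinal im)); have /familyP/(_ (Ordinal im)) := mu_lam; case/andP.
Qed.

Let s_ge i : (nth 0 lam i.+1 <= nth 0 s i)%N.
Proof.
case: (ltnP i m) => [im|mi].
  by rewrite (nth_ffun_seq mu (Ordinal im)); have /familyP/(_ (Ordinal im)) := mu_lam; case/andP.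
by rewrite nth_default// (leq_trans sz).
Qed.

Lemma extend_ssyt T : ssyt s m T -> ssyt lam m.+1 (extend_filling m lam T).
Proof.
rewrite -{1}(mk_fillingK T) => /ssyt_mkP[b r c]; apply/ssyt_mkP; split.
- move=> i j jl; case: ifPn => js; last by rewrite leqnn.
  by have /andP[-> /leqW] := b _ _ js.
- move=> i j j' jl jj'; case: ifPn => js; case: ifPn => js' //.
  + exact: r.
  + by have /andP[_ /leqW] := b _ _ js.
  + by move: js; rewrite (ltn_trans jj' js').
- move=> i i' j jl jl' ii'.
  (* By interlacing, a cell of [lam] with another one below it lies in [s]; so two added entries m +
     1 never share a column. *)
  have js : (j < nth 0 s i)%N.
    apply: leq_trans (s_ge i); apply: leq_trans jl' _.
    have := ii'; rewrite -(subnKC ii'); elim: (i' - i.+1)%N => [|d IH]; rewrite ?addn0// addnS => _.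
    by apply: leq_trans (lamD _) _; apply: IH; rewrite ltn_addr.
  rewrite js; case: ifPn => js'; first exact: c.
  by have /andP[_ ?] := b _ _ js; rewrite ltnS.
Qed.

Lemma entry_extend (T : filling s) i j : (j < nth 0 s i)%N ->
  entry (extend_filling m lam T) i j = entry T i j.
Proof. by move=> js; rewrite entry_mk ?js// (leq_trans js). Qed.

Lemma extend_inj : injective (@extend_filling m s lam).
Proof.
move=> T T' TT'; rewrite -(mk_fillingK T) -(mk_fillingK T').
apply/ffunP => c; rewrite !ffunE.
by rewrite -!entry_extend ?col_lt// TT'.
Qed.

Lemma low_shape_extend T i : ssyt s m T ->
  low_shape m (extend_filling m lam T) i = nth 0%N s i.
Proof.
rewrite -{1}(mk_fillingK T) => /ssyt_mkP[b r c]; rewrite /low_shape.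
rewrite -[RHS](card_ord_lt (s_le i)); apply: eq_card => j; rewrite !inE.
rewrite entry_mk//; case: ifPn => js; last by rewrite ltnn.
by have /andP[] := b _ _ js.
Qed.

Lemma coweight_extend T : ssyt s m T ->
  coweight m.+1 (extend_filling m lam T) = (\sum_i mu i + coweight m T)%N.
Proof.
rewrite -{1 3}(mk_fillingK T) => /ssyt_mkP[b r c].
rewrite (coweight_mk _ _ sz).
rewrite (@coweight_mk m s _ m.+1) ?size_ffun_seq//.
have -> : (\sum_i mu i = \sum_(i < m.+1) nth 0 s i)%N.
  rewrite big_ord_recr/= s_big// addn0; apply: eq_bigr => i _.
  by rewrite nth_ffun_seq.
rewrite -big_split/=; apply: eq_bigr => i _.
rewrite -[X in (X + _)%N](card_ord (nth 0%N s i)) -sum1_card -big_split/=.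
rewrite (big_ord_widen _ (fun j => 1 + (m - entry T i j))%N (s_le i)) [RHS]big_mkcond/=.
apply: eq_bigr => j _; case: ifPn => js; last by rewrite subnn.
by rewrite add1n subSn//; have /andP[] := b _ _ js.
Qed.

Lemma extend_surj T : ssyt lam m.+1 T -> (forall i, low_shape m T i = nth 0%N s i) ->
  exists2 T', ssyt s m T' & extend_filling m lam T' = T.
Proof.
move=> sT sh; have sT' := sT; move: sT'.
rewrite -{1}(mk_fillingK T) => /ssyt_mkP[b r c].
exists (mk_filling s (entry T)).
  apply/ssyt_mkP; split.
  - move=> i j js; have jl := leq_trans js (s_le i).
    by have /andP[-> _] := b _ _ jl; rewrite -(low_shape_entry _ sT jl) sh.
  - by move=> i j j' js; apply: r; exact: leq_trans js (s_le i).
  - move=> i i' j js js'; apply: c; first exact: leq_trans js (s_le i).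
    exact: leq_trans js' (s_le i').
rewrite -[RHS]mk_fillingK; apply/ffunP => x; rewrite !ffunE.
case: ifPn => js; first by rewrite entry_mk.
have := low_shape_entry m sT (col_lt x); rewrite sh (negbTE js) => /esym/negbT.
by rewrite -ltnNge => h; apply/eqP; rewrite eqn_leq h; have /andP[_ ->] := b _ _ (col_lt x).
Qed.

End branching.

End tableaux.

(** * The generating function of tableaux as a determinant *)

Section generating_function.
Context (F : fieldType).
Implicit Types (q : F).

Definition ssyt_gf m (lam : seq nat) q : F := \sum_(T \in ssyt lam m) q ^+ coweight m T.

(** The tableaux are grouped by the shape [mu] of their entries at most m. Within a group,
    forgetting the entries m + 1 is a bijection onto the tableaux of shape [mu], with inverse
    [extend_filling]. *)
Lemma ssyt_gf_branching m K lam q :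
  (forall i, nth 0 lam i.+1 <= nth 0 lam i)%N -> (size lam <= m.+1)%N ->
  (nth 0 lam 0 < K)%N ->
  ssyt_gf m.+1 lam q =
  \sum_(mu in @interlacing m K lam) q ^+ (\sum_i mu i) * ssyt_gf m (ffun_seq mu) q.
Proof.
case: K => // K lamD sz lamK.
have lam0 i : (nth 0 lam i < K.+1)%N.
  by elim: i => // i IH; apply: leq_ltn_trans IH; exact: lamD.
have fin := finite_ssyt lam m.+1.
rewrite /ssyt_gf fsbig_finite//=.
pose p (T : filling lam) : {ffun 'I_m -> 'I_K.+1} := [ffun i : 'I_m => inord (low_shape m T i)].
have pE T (i : 'I_m) : p T i = low_shape m T i :> nat.
  by rewrite ffunE inordK//; apply: leq_ltn_trans (lam0 i); exact: low_shape_le.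
rewrite big_seq_cond (partition_big p (mem (@interlacing m K.+1 lam)))/=; last first.
  move=> T; rewrite andbT in_fset_set// inE => sT.
  apply/familyP => i; rewrite !inE pE low_shape_le andbT.
  exact: low_shape_ge.
apply: eq_bigr => mu mulam.
transitivity (\sum_(T \in ssyt (ffun_seq mu) m)
    q ^+ coweight m.+1 (extend_filling m lam T)); last first.
  rewrite fsbig_distrr; last exact: finite_ssyt.
  apply: eq_fsbigr => T; rewrite inE => sT /=.
  by rewrite (coweight_extend sz mulam sT) exprD.
rewrite -big_filter fsbig_seq ?filter_uniq//.
apply: reindex_fsbig; split.
- move=> T sT /=; rewrite mem_filter in_fset_set// andbT.
  have sT' := extend_ssyt lamD sz mulam sT; rewrite mem_set//= andbT.
  apply/eqP/ffunP => i; apply/ord_inj; rewrite pE.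
  by rewrite low_shape_extend// nth_ffun_seq.
- by move=> T T' _ _; exact: extend_inj.
- move=> T /=; rewrite mem_filter in_fset_set// => /andP[/andP[_ /eqP pT]].
  rewrite inE => sT; have [|T' sT' <-] := extend_surj mulam sT; last by exists T'.
  move=> i; case: (ltnP i m) => im.
    by rewrite (nth_ffun_seq mu (Ordinal im)) -pT pE.
  by rewrite (low_shape_ge_row lamD sT)// nth_default// size_ffun_seq.
Qed.

Lemma ssyt_gf_nil m q : ssyt_gf m [::] q = 1.
Proof.
have c0 (c : cell [::]) : False by case: c => -[].
pose T0 := mk_filling [::] (fun _ _ => 0%N).
rewrite /ssyt_gf; have -> : ssyt [::] m = [set T0].
  apply/seteqP; split => [T _|T _] /=; first by apply/ffunP => c; case: (c0 c).
  by split => [c|c|c]; case: (c0 c).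
by rewrite fsbig_set1 /coweight big1 ?expr0// => c; case: (c0 c).
Qed.

(** The constant is chosen before [lam], so it can be computed later from the empty shape. *)
Lemma ssyt_gf_weyl q : q != 0 -> (forall j, q ^+ j.+1 != 1) ->
  forall m, exists C : F, forall lam, (forall i, nth 0 lam i.+1 <= nth 0 lam i)%N ->
  (size lam <= m)%N -> ssyt_gf m lam q = C * weyl_det q m lam.
Proof.
move=> q0 q1; elim=> [|m [C IH]].
  exists 1 => lam _; rewrite leqn0 => /nilP ->.
  by rewrite ssyt_gf_nil /weyl_det det_mx00 mulr1.
have [C' CE] := weyl_det_branching m q0 q1.
exists (C * C') => lam lamD sz.
rewrite (ssyt_gf_branching q lamD sz (ltnSn _)) -mulrA -(CE (nth 0%N lam 0).+1)// mulr_sumr.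
apply: eq_bigr => mu mulam; rewrite IH ?size_ffun_seq//; first by rewrite mulrCA.
move=> i; case: (ltnP i.+1 m) => im; last by rewrite nth_default// size_ffun_seq.
have im' := ltnW im.
rewrite (nth_ffun_seq mu (Ordinal im)) (nth_ffun_seq mu (Ordinal im')).
have /familyP/(_ (Ordinal im))/andP[_ h1] := mulam.
have /familyP/(_ (Ordinal im'))/andP[h2 _] := mulam.
exact: leq_trans h1 h2.
Qed.

End generating_function.

(** * Contents and hook lengths *)

Section hooks.
Variables (lam : seq nat) (m : nat).
Hypothesis lamP : is_partition lam.
Hypothesis sz : (size lam <= m)%N.
Local Notation l := (shifted_part lam m).

Lemma partition_nth_le i : (nth 0 lam i.+1 <= nth 0 lam i)%N.
Proof.
have /andP[s _] := lamP; case: (ltnP i.+1 (size lam)) => il; last by rewrite nth_default.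
by apply: (sortedP 0%N s).
Qed.

Lemma partition_nth_anti i j : (i <= j)%N -> (nth 0 lam j <= nth 0 lam i)%N.
Proof.
move=> /subnKC <-; elim: (j - i)%N => [|d IH]; first by rewrite addn0.
by rewrite addnS (leq_trans (partition_nth_le _)).
Qed.

Lemma shifted_part_gt i j : (i < j < m)%N -> (l j < l i)%N.
Proof.
by move=> /andP[ij jm]; have := partition_nth_anti (ltnW ij); rewrite /shifted_part; lia.
Qed.

Lemma size_le_sumn : (size lam <= sumn lam)%N.
Proof.
have /andP[_] := lamP; elim: (lam) => //= x s IH; rewrite inE negb_or => /andP[x0 /IH].
by case: x x0 => // x _; lia.
Qed.

(** A row and the first column share at most one cell. All bounds on contents and hooks come from
    this inequality. *)
Lemma nth_size_le_sumn i : (nth 0 lam i + size lam <= (sumn lam).+1)%N.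
Proof.
have := size_le_sumn; have /andP[_] := lamP.
elim: (lam) i => [|x s IH] [|i]//=; rewrite inE negb_or => /andP[x0 s0] _.
  suff : (size s <= sumn s)%N by lia.
  elim: s s0 {IH} => //= y s IH; rewrite inE negb_or => /andP[y0 /IH].
  by case: y y0 => // y _; lia.
have ss : (size s <= sumn s)%N.
  elim: s s0 {IH} => //= y s IH; rewrite inE negb_or => /andP[y0 /IH].
  by case: y y0 => // y _; lia.
by have := IH i s0 ss; case: x x0 => //; lia.
Qed.

Definition row_gaps i : seq nat := [seq (l i - l j)%N | j <- iota i.+1 (m.-1 - i)].

(* The complement of the gaps [l i - l j], [i < j], in [1, l i]: these are the
   hook lengths of row [i]. *)
Definition row_hooks i : seq nat := [seq k <- iota 1 (l i) | k \notin row_gaps i].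

(** Since [l] is strictly decreasing, the gaps of row i are distinct and lie in [1, l i]. *)
Lemma perm_row_hooks i : (i < m)%N -> perm_eq (iota 1 (l i)) (row_gaps i ++ row_hooks i).
Proof.
move=> im; apply: uniq_perm; first exact: iota_uniq.
  rewrite cat_uniq filter_uniq ?iota_uniq// andbT; apply/andP; split.
    rewrite map_inj_in_uniq ?iota_uniq// => j j'.
    rewrite !mem_iota => hj hj' jj'.
    have li : (l j < l i)%N by apply: shifted_part_gt; lia.
    have li' : (l j' < l i)%N by apply: shifted_part_gt; lia.
    case: (ltngtP j j') => // jj.
    - by have : (l j' < l j)%N by [apply: shifted_part_gt; lia]; lia.
    - by have : (l j < l j')%N by [apply: shifted_part_gt; lia]; lia.
  by apply/hasPn => k; rewrite mem_filter => /andP[].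
move=> k; rewrite mem_cat mem_filter.
case: (boolP (k \in row_gaps i)) => //= /mapP[j]; rewrite !mem_iota => hj ->.
have li : (l j < l i)%N by apply: shifted_part_gt; lia.
by lia.
Qed.

Lemma size_row_hooks i : (i < m)%N -> size (row_hooks i) = nth 0%N lam i.
Proof.
move=> im; have := perm_size (perm_row_hooks im).
rewrite size_cat size_map !size_iota /shifted_part.
set x := size _ => h; apply: (@addnI (m.-1 - i)%N); rewrite -h addnC//.
Qed.

Lemma row_hooks_le i k : (i < m)%N -> k \in row_hooks i -> (1 <= k <= sumn lam)%N.
Proof.
move=> im; rewrite mem_filter mem_iota => /andP[kD /andP[k1 kl]].
rewrite k1 leqNgt /=; apply/negP => kn; case/negP: kD.
have h1 := nth_size_le_sumn i; have h2 := size_le_sumn.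
have lami : (nth 0 lam i <= sumn lam)%N.
  case: (ltnP i (size lam)) => il; last by rewrite nth_default.
  by move: h1; case: (size lam) il => //; lia.
(* Row j = k - lam_i + i is empty because k exceeds |lam|, so l i - l j = lam_i + j - i = k would be
   a gap. *)
apply/mapP; exists (k - nth 0 lam i + i)%N.
  by rewrite mem_iota; move: kl; rewrite /shifted_part; lia.
rewrite /shifted_part (@nth_default _ _ _ (k - nth 0 lam i + i)%N); last by lia.
by move: kl; rewrite /shifted_part; lia.
Qed.

(* The content [j - i] of the cell [(i, j)], shifted by [m]. *)
Definition contents : seq nat := flatten [seq iota (m - i) (nth 0%N lam i) | i <- iota 0 m].
Definition hooks : seq nat := flatten [seq row_hooks i | i <- iota 0 m].

Let big_iota0 (V : nmodType) (G : nat -> V) : \sum_(i <- iota 0 m) G i = \sum_(i < m) G i.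
Proof. by rewrite -(big_mkord xpredT) /index_iota subn0. Qed.

Let sum_nth : (\sum_(i <- iota 0 m) nth 0 lam i = sumn lam)%N.
Proof.
rewrite (big_iota0 (nth 0%N lam)) sumnE (big_nth 0%N) big_mkord.
rewrite [RHS](big_ord_widen m (fun i => nth 0%N lam i) sz) [RHS]big_mkcond/=.
by apply: eq_bigr => i _; case: ltnP => // /(nth_default 0%N).
Qed.

Lemma size_contents : size contents = sumn lam.
Proof.
rewrite size_flatten -sum_nth sumnE /shape -map_comp big_map; apply: eq_bigr => i _.
by rewrite /= size_iota.
Qed.

Lemma size_hooks : size hooks = sumn lam.
Proof.
rewrite size_flatten -sum_nth sumnE /shape -map_comp big_map big_seq [RHS]big_seq.
by apply: eq_bigr => i; rewrite mem_iota => im /=; rewrite size_row_hooks.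
Qed.

Lemma contents_bounds x : x \in contents ->
  [/\ (0 < x)%N, (m <= x + sumn lam)%N & (x <= m + sumn lam)%N].
Proof.
move=> /flatten_mapP[i]; rewrite !mem_iota => im xi.
have h1 := nth_size_le_sumn i; have h2 := size_le_sumn.
have il : (i < size lam)%N.
  by rewrite ltnNge; apply/negP => /(nth_default 0%N) h; move: xi; rewrite h; lia.
by split; lia.
Qed.

Lemma hooks_bounds x : x \in hooks -> (1 <= x <= sumn lam)%N.
Proof. by move=> /flatten_mapP[i]; rewrite !mem_iota => im /row_hooks_le; apply. Qed.

(** For each i both sides multiply f over 1, ..., l i. On the left this interval is split into gaps
    and hooks; on the right into the differences j - i, which run up to m - 1 - i, and the contents
    of row i, which start at m - i. *)
Lemma prod_shifted_gaps (F : fieldType) (f : nat -> F) :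
  (\prod_(i < m) \prod_(j < m | (i < j)%N) f (l i - l j)%N) * \prod_(h <- hooks) f h =
  (\prod_(i < m) \prod_(j < m | (i < j)%N) f (j - i)%N) * \prod_(a <- contents) f a.
Proof.
have iota0 (G : nat -> F) : \prod_(i <- iota 0 m) G i = \prod_(i < m) G i.
  by rewrite -(big_mkord xpredT) /index_iota subn0.
have gt_ord (i : 'I_m) (G : nat -> F) :
    \prod_(j < m | (i < j)%N) G j = \prod_(j <- iota i.+1 (m.-1 - i)) G j.
  have -> : (m.-1 - i = m - i.+1)%N by lia.
  rewrite -(big_mkord (fun j => i < j)%N).
  by rewrite -/(index_iota i.+1 m) (big_nat_widenl _ _ _ _ _ (leq0n i.+1)).
rewrite !big_flatten !big_map !iota0 -!big_split/=; apply: eq_bigr => i _.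
rewrite (gt_ord i (fun j => f (l i - l j)%N)) (gt_ord i (fun j => f (j - i)%N)).
rewrite -(big_map (fun j => l i - l j)%N xpredT) -big_cat.
rewrite -(perm_big _ (perm_row_hooks (ltn_ord i)))/=.
have -> : \prod_(j <- iota i.+1 (m.-1 - i)) f (j - i)%N = \prod_(k <- iota 1 (m.-1 - i)) f k.
  rewrite -(addn1 i) iotaDl big_map; apply: eq_bigr => k _; congr f; lia.
rewrite -big_cat/=; have -> : (m - i = 1 + (m.-1 - i))%N by have := ltn_ord i; lia.
by rewrite -iotaD addnC.
Qed.

End hooks.

(** * The product over contents and hooks *)

Section principal_specialization.
Context (R : realType).
Implicit Types (t : R).

Definition geo (x : nat) t : R := \sum_(k < x) expR (k%:R * t).

Lemma geoE x t : geo x t * (expR t - 1) = expR (x%:R * t) - 1.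
Proof.
rewrite /geo mulr_suml.
under eq_bigr do rewrite mulrBr mulr1 -expRD -{2}[t]mul1r -mulrDl natr1.
rewrite -(big_mkord xpredT (fun k => expR (k.+1%:R * t) - expR (k%:R * t))).
by rewrite (telescope_sumr (fun k => expR (k%:R * t)))// mul0r expR0.
Qed.

Lemma geo_gt0 x t : (0 < x)%N -> 0 < geo x t.
Proof.
case: x => // x _; rewrite /geo big_ord_recl ltr_pwDl ?expR_gt0//.
by rewrite sumr_ge0// => i _; exact: expR_ge0.
Qed.

(** Cell by cell, (T c - 1) + (m - T c) = m - 1. Hence e^(t rank) is, up to a constant factor, the
    coweight monomial at q = e^(-t). *)
Lemma rank_coweight lam m (T : filling lam) : ssyt lam m T ->
  rank R m T + (coweight m T)%:R = (sumn lam)%:R * m.-1%:R.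
Proof.
move=> [b _ _].
have card : #|{: cell lam}| = sumn lam.
  have := sum_cell (fun _ _ => 1%N) (leqnn (size lam)); rewrite sum1_card => ->.
  rewrite sumnE (big_nth 0%N) big_mkord; apply: eq_bigr => i _.
  by rewrite sum_nat_const card_ord muln1.
suff rE : rank R m T = (\sum_(c : cell lam) (T c).-1)%N%:R.
  rewrite rE -natrD -natrM /coweight -big_split/= -card mulnC; congr (_%:R).
  rewrite (eq_bigr (fun=> m.-1)) ?sum_nat_const 1?mulnC// => c _.
  by have := b c; lia.
rewrite /rank; congr (_%:R).
under eq_bigr do rewrite /alpha -sum1_card big_distrr/=.
rewrite (exchange_big_dep xpredT)//=; apply: eq_bigr => c _.
under eq_bigl do rewrite inE eq_sym.
by rewrite big_nat1_eq ltnS b muln1.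
Qed.

(** A Vandermonde determinant in the q^(l i) with q = e^(-t). Each difference q^(l j) - q^(l i)
    equals e^(-(l i) t) (e^t - 1) [l i - l j]_t, and the powers of e^t - 1 do not depend on
    [lam]. *)
Lemma weyl_detE m lam : is_partition lam -> (size lam <= m)%N ->
  exists c : R, forall t,
  weyl_det (expR (- t)) m lam = expR (c * t) *
  \prod_(i < m) \prod_(j < m | (i < j)%N) (expR t - 1) *
  \prod_(i < m) \prod_(j < m | (i < j)%N) geo (shifted_part lam m i - shifted_part lam m j) t.
Proof.
move=> lamP sz.
exists (\sum_(i < m) \sum_(j < m | (i < j)%N) - (shifted_part lam m i)%:R) => t.
have -> : weyl_det (expR (- t)) m lam = \det (Vandermonde m
    (\row_(i < m) expR (- t) ^+ shifted_part lam m i)).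
  rewrite /weyl_det -det_tr; congr (\det _); apply/matrixP => i j.
  by rewrite !mxE exprM.
rewrite det_Vandermonde mulr_suml expR_sum -!big_split/=; apply: eq_bigr => i _.
rewrite mulr_suml expR_sum -!big_split/=; apply: eq_bigr => j ij; rewrite !mxE.
have lji : (shifted_part lam m j < shifted_part lam m i)%N.
  by apply: shifted_part_gt => //; rewrite ij/=.
rewrite -mulrA [_ * geo _ _]mulrC geoE mulrBr mulr1 -expRD -!expRM_natl.
by congr (expR _ - expR _); rewrite ?natrB ?(ltnW lji)//; ring.
Qed.

(** For t nonzero no positive power of e^(-t) equals 1, as the branching of the determinants
    requires. *)
Lemma sum_expR_rank m lam : is_partition lam -> (size lam <= m)%N ->
  exists c : R, forall t, t != 0 ->
  (\sum_(T \in ssyt lam m) expR (t * rank R m T)) * \prod_(h <- hooks lam m) geo h t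
  = expR (c * t) * \prod_(a <- contents lam m) geo a t.
Proof.
move=> lamP sz; have [c cE] := weyl_detE lamP sz.
have nilP : is_partition [::] by [].
have [d dE] := weyl_detE nilP (leq0n m).
exists ((sumn lam)%:R * m.-1%:R + c - d) => t t0.
have q0 : expR (- t) != 0 by rewrite gt_eqF// expR_gt0.
have q1 j : expR (- t) ^+ j.+1 != 1.
  rewrite -expRM_natl -[1]expR0 (inj_eq (@expR_inj _)) mulrN oppr_eq0 mulf_neq0//.
have [C CE] := ssyt_gf_weyl q0 q1 m.
(* The empty shape has generating function 1; this determines C. *)
have := CE [::] (fun i => _) (leq0n m); rewrite ssyt_gf_nil => /(_ ltac:(by case)) CN.
have {}CE := CE lam (partition_nth_le lamP) sz.
have -> : \sum_(T \in ssyt lam m) expR (t * rank R m T) =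
    expR ((sumn lam)%:R * m.-1%:R * t) * ssyt_gf m lam (expR (- t)).
  rewrite /ssyt_gf fsbig_distrr; last exact: finite_ssyt.
  apply: eq_fsbigr => T; rewrite inE => sT /=.
  by rewrite -expRM_natl -expRD -(rank_coweight sT); congr expR; ring.
have := prod_shifted_gaps lamP sz (geo ^~ t).
have -> : \prod_(i < m) \prod_(j < m | (i < j)%N) geo (j - i) t =
    \prod_(i < m) \prod_(j < m | (i < j)%N)
      geo (shifted_part [::] m i - shifted_part [::] m j) t.
  apply: eq_bigr => i _; apply: eq_bigr => j ij; congr geo.
  by rewrite /shifted_part !nth_nil; have := ltn_ord j; lia.
move: CE CN; rewrite cE dE => -> CN XH.
set P := \prod_(i < m) \prod_(j < m | _) (expR t - 1) in CN *.
(* The factor 1 is replaced by the formula for the empty shape, whose gaps are the j - i: it brings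
   in C, the powers of e^t - 1 and the remaining product of [prod_shifted_gaps]. *)
rewrite -[RHS]mulr1 [X in _ = _ * X]CN mulrDl mulrDl mulNr !expRD expRN.
rewrite -!mulrA XH; field; exact: lt0r_neq0 (expR_gt0 _).
Qed.

End principal_specialization.

(** * Bernoulli numbers as logarithmic derivatives *)

Section smooth.
Context (R : realType).
Implicit Types (f g : R -> R) (n : nat).

(** The derivative is any witness f' rather than [derive1 f], so that closure under sums, products
    and inverses follows by induction on the order with explicit formulas. *)
Fixpoint times_derivable n f : Prop :=
  if n is k.+1 then
    exists2 f' : R -> R, (forall x : R, is_derive x (1 : R) f (f' x)) & times_derivable k f'
  else True.

Definition smooth f := forall n, times_derivable n f.

Lemma times_derivableW n f : times_derivable n.+1 f -> times_derivable n f.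
Proof. by elim: n f => // n IH f [f' ff' /IH]; exists f'. Qed.

Lemma times_derivableD n f g : times_derivable n f -> times_derivable n g ->
  times_derivable n (fun x => f x + g x).
Proof.
elim: n f g => // n IH f g [f' ff' sf'] [g' gg' sg'].
exists (fun x => f' x + g' x) => [x|]; last exact: IH.
by have := ff' x; have := gg' x => ? ?; exact: is_deriveD.
Qed.

Lemma times_derivableM n f g : times_derivable n f -> times_derivable n g ->
  times_derivable n (fun x => f x * g x).
Proof.
elim: n f g => // n IH f g sf sg.
have [f' ff' sf'] := sf; have [g' gg' sg'] := sg.
exists (fun x => f x * g' x + g x * f' x) => [x|].
  by have := ff' x; have := gg' x => ? ?; exact: is_deriveM.
by apply: times_derivableD; apply: IH => //; exact: times_derivableW.
Qed.

Lemma is_derive_derive1 f f' : (forall x : R, is_derive x (1 : R) f (f' x)) -> derive1 f = f'.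
Proof. by move=> ff'; apply/funext => x; rewrite derive1E; have [_ ->] := ff' x. Qed.

Lemma smooth_is_derive f : smooth f -> forall x : R, is_derive x (1 : R) f (derive1 f x).
Proof. by move=> /(_ 1%N)[f' ff' _] x; rewrite (is_derive_derive1 ff'). Qed.

Lemma smooth_derive1 f : smooth f -> smooth (derive1 f).
Proof. by move=> sf n; have [f' ff' sf'] := sf n.+1; rewrite (is_derive_derive1 ff'). Qed.

Lemma smooth_intro f f' : (forall x : R, is_derive x (1 : R) f (f' x)) -> smooth f' -> smooth f.
Proof. by move=> ff' sf' [//|n]; exists f'. Qed.

Lemma smooth_continuous f : smooth f -> continuous f.
Proof.
move=> /smooth_is_derive ff' x; apply: differentiable_continuous.
by apply/derivable1_diffP; case: (ff' x).
Qed.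

Lemma smooth_cst (c : R) : smooth (fun=> c).
Proof.
by move=> n; elim: n c => // n IH c; exists (fun=> 0) => // x; exact: is_derive_cst.
Qed.

Lemma smooth_id : smooth id.
Proof.
have h (x : R) : is_derive x (1 : R) (@id R) 1 by exact: is_derive_id.
exact: smooth_intro h (smooth_cst 1).
Qed.

Lemma smoothD f g : smooth f -> smooth g -> smooth (fun x => f x + g x).
Proof. by move=> sf sg n; exact: times_derivableD. Qed.

Lemma smoothM f g : smooth f -> smooth g -> smooth (fun x => f x * g x).
Proof. by move=> sf sg n; exact: times_derivableM. Qed.

Lemma smoothN f : smooth f -> smooth (fun x => - f x).
Proof.
move=> sf; have -> : (fun x => - f x) = (fun x => -1 * f x) by apply/funext => x; rewrite mulN1r.
exact/smoothM/sf/smooth_cst.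
Qed.

Lemma smoothB f g : smooth f -> smooth g -> smooth (fun x => f x - g x).
Proof. by move=> sf /smoothN; exact: smoothD. Qed.

Lemma smoothV f : (forall x, f x != 0) -> smooth f -> smooth (fun x => (f x)^-1).
Proof.
move=> f0 sf n; elim: n => // n IH.
have [f' ff' sf'] := sf n.+1.
(* The derivative of 1/f is again a product containing 1/f, to which the induction hypothesis of
   lower order applies. *)
exists (fun x => (-1 * f' x) * ((f x)^-1 * (f x)^-1)) => [x|].
  have h := is_deriveV (f0 x) (ff' x); apply: (is_derive_eq h).
  by rewrite -exprVn expr2 mulN1r mulNr [in RHS]mulrC scaleNr.
apply: times_derivableM; last exact: times_derivableM.
by apply: times_derivableM => //; exact: smooth_cst.
Qed.

Lemma smooth_sum (I : Type) (r : seq I) (f : I -> R -> R) :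
  (forall i, smooth (f i)) -> smooth (fun x => \sum_(i <- r) f i x).
Proof.
move=> sf; elim: r => [|i r IH].
  by under eq_fun do rewrite big_nil; exact: smooth_cst.
by under eq_fun do rewrite big_cons; exact: smoothD.
Qed.

Lemma smooth_prod (I : Type) (r : seq I) (f : I -> R -> R) :
  (forall i, smooth (f i)) -> smooth (fun x => \prod_(i <- r) f i x).
Proof.
move=> sf; elim: r => [|i r IH].
  by under eq_fun do rewrite big_nil; exact: smooth_cst.
by under eq_fun do rewrite big_cons; exact: smoothM.
Qed.

Lemma is_derive_expR_scale (c x : R) :
  is_derive x (1 : R) (fun t => expR (c * t)) (c * expR (c * x)).
Proof.
have h : is_derive (c * x) (1 : R) expR (expR (c * x)) by exact: is_derive_expR.
have k : is_derive x (1 : R) (fun t => c * t) c.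
  apply: (is_derive_eq (is_deriveM (is_derive_cst c x 1) (is_derive_id x 1))).
  by rewrite /GRing.scale/= mulr0 addr0 mulr1.
exact: (is_derive_eq (is_derive1_comp h k) (mulrC _ _)).
Qed.

Lemma smooth_expR (c : R) : smooth (fun t => expR (c * t)).
Proof.
move=> n; elim: n => // n IH; exists (fun x => c * expR (c * x)).
  exact: is_derive_expR_scale.
by apply: times_derivableM => //; exact: smooth_cst.
Qed.

Lemma is_derive_ln f (f' x : R) : 0 < f x -> is_derive x (1 : R) f f' ->
  is_derive x (1 : R) (fun t => ln (f t)) (f' / f x).
Proof.
move=> fx ff'; have h : is_derive (f x) (1 : R) (@ln R) (f x)^-1 by exact: is_derive1_ln.
exact: (is_derive_eq (is_derive1_comp h ff') (mulrC _ _)).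
Qed.

Lemma derive1_ln f : (forall x, 0 < f x) -> smooth f ->
  derive1 (fun x => ln (f x)) = (fun x => derive1 f x / f x).
Proof.
by move=> f0 /smooth_is_derive sf; apply: is_derive_derive1 => x; exact: is_derive_ln.
Qed.

Lemma smooth_ln f : (forall x, 0 < f x) -> smooth f -> smooth (fun x => ln (f x)).
Proof.
move=> f0 sf.
apply: (smooth_intro (fun x => is_derive_ln (f0 x) (smooth_is_derive sf x))).
apply: smoothM; first exact: smooth_derive1.
by apply: smoothV => // x; rewrite gt_eqF.
Qed.

Lemma derive1_smoothD f g : smooth f -> smooth g ->
  derive1 (fun x => f x + g x) = (fun x => derive1 f x + derive1 g x).
Proof.
move=> /smooth_is_derive sf /smooth_is_derive sg.
exact: (is_derive_derive1 (fun x => is_deriveD (sf x) (sg x))).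
Qed.

Lemma derive1_smoothM f g : smooth f -> smooth g ->
  derive1 (fun x => f x * g x) = (fun x => derive1 f x * g x + f x * derive1 g x).
Proof.
move=> /smooth_is_derive sf /smooth_is_derive sg.
rewrite (is_derive_derive1 (fun x => is_deriveM (sf x) (sg x))).
by apply/funext => x; rewrite /GRing.scale/= addrC [g x * _]mulrC.
Qed.

Lemma derive1n_smoothD n f g : smooth f -> smooth g ->
  derive1n n (fun x => f x + g x) = (fun x => derive1n n f x + derive1n n g x).
Proof.
elim: n f g => // n IH f g sf sg.
by rewrite !derive1Sn derive1_smoothD// IH//; exact: smooth_derive1.
Qed.

Lemma derive1n_smoothZ n (c : R) f : smooth f ->
  derive1n n (fun x => c * f x) = (fun x => c * derive1n n f x).
Proof.
elim: n f => // n IH f sf; rewrite !derive1Sn derive1_smoothM//; last exact: smooth_cst.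
rewrite -IH; last exact: smooth_derive1.
congr (derive1n n _); apply/funext => x; rewrite (_ : derive1 (fun=> c) = fun=> 0) ?mul0r ?add0r//.
by apply: is_derive_derive1 => y; exact: is_derive_cst.
Qed.

Lemma derive1n_cst n (c : R) : derive1n n.+1 (fun _ : R => c) = fun=> 0.
Proof.
have d (e : R) : derive1 (fun _ : R => e) = fun=> 0.
  by apply: is_derive_derive1 => y; exact: is_derive_cst.
by rewrite derive1Sn d; elim: n => // n IH; rewrite derive1Sn d.
Qed.

Lemma derive1n_sum n (I : Type) (r : seq I) (f : I -> R -> R) :
  (forall i, smooth (f i)) ->
  derive1n n (fun x => \sum_(i <- r) f i x) = (fun x => \sum_(i <- r) derive1n n (f i) x).
Proof.
move=> sf; elim: r => [|i r IH].
  under eq_fun do rewrite big_nil; under [RHS]eq_fun do rewrite big_nil.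
  by case: n => // n; exact: derive1n_cst.
under eq_fun do rewrite big_cons; under [RHS]eq_fun do rewrite big_cons.
by rewrite derive1n_smoothD// ?IH//; exact: smooth_sum.
Qed.

Lemma derive1n_expR n (c : R) :
  derive1n n (fun t => expR (c * t)) = (fun t => c ^+ n * expR (c * t)).
Proof.
elim: n => [|n IH]; first by apply/funext => t; rewrite derive1n0 mul1r.
rewrite derive1nS IH -derive1n1 derive1n_smoothZ; last exact: smooth_expR.
apply/funext => t; rewrite derive1n1 (is_derive_derive1 (is_derive_expR_scale c)).
by rewrite exprSr mulrA.
Qed.

End smooth.

(** * Polynomials modulo X^N *)

Section poly_mod_Xn.
Context (F : numFieldType).
Implicit Types (p q r : {poly F}) (N : nat).

Definition eq_modX N p q := forall i, (i < N)%N -> p`_i = q`_i.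

Lemma eq_modX_trans N p q r : eq_modX N p q -> eq_modX N q r -> eq_modX N p r.
Proof. by move=> pq qr i iN; rewrite pq// qr. Qed.

Lemma eq_modXM N p p' q q' : eq_modX N p p' -> eq_modX N q q' ->
  eq_modX N (p * q) (p' * q').
Proof.
move=> pp qq i iN; rewrite !coefM; apply: eq_bigr => j _.
by have := ltn_ord j => ?; rewrite pp ?qq//; lia.
Qed.

Lemma eq_modXD N p p' q q' : eq_modX N p p' -> eq_modX N q q' ->
  eq_modX N (p + q) (p' + q').
Proof. by move=> pp qq i iN; rewrite !coefD pp// qq. Qed.

(** Coefficient i of p r is p_i r_0 plus terms that involve only lower coefficients of p; strong
    induction then cancels r_0. *)
Lemma eq_modX_mulI N p q r : r`_0 != 0 -> eq_modX N (p * r) (q * r) -> eq_modX N p q.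
Proof.
move=> r0 pq; elim/ltn_ind => i IH iN.
have := pq i iN; rewrite !coefM !big_ord_recr/= subnn.
rewrite (eq_bigr (fun j : 'I_i => q`_j * r`_(i - j))); last first.
  by move=> j _; have := ltn_ord j => ji; rewrite IH//; lia.
by move=> /addrI /(mulIf r0).
Qed.

Lemma eq_modX_mulX N p q : eq_modX N.+1 ('X * p) ('X * q) -> eq_modX N p q.
Proof. by move=> pq i iN; have := pq i.+1 iN; rewrite !coefXM. Qed.

Lemma eq_modX_deriv N p q : p`_0 = q`_0 -> eq_modX N p^`() q^`() -> eq_modX N.+1 p q.
Proof.
move=> pq0 pq [//|i] iN; have := pq i iN; rewrite !coef_deriv.
rewrite -[p`__ *+ _]mulr_natr -[q`__ *+ _]mulr_natr.
by apply: mulIf; rewrite pnatr_eq0.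
Qed.

End poly_mod_Xn.

(** * Taylor polynomials at 0 *)

Section taylor.
Context (R : realType).
Implicit Types (f g : R -> R) (N : nat).

Definition taylor N f : {poly R} := \poly_(i < N) (derive1n i f 0 / i`!%:R).

Lemma coef_taylor N f i : (i < N)%N -> (taylor N f)`_i = derive1n i f 0 / i`!%:R.
Proof. by move=> iN; rewrite coef_poly iN. Qed.

Lemma deriv_taylor N f : (taylor N.+1 f)^`() = taylor N (derive1 f).
Proof.
apply/polyP => i; rewrite coef_deriv !coef_poly ltnS; case: ifP => iN; last by rewrite mul0rn.
by rewrite derive1Sn -[LHS]mulr_natr factS natrM invfM mulrA mulrAC divfK// pnatr_eq0.
Qed.

Lemma taylorD N f g : smooth f -> smooth g ->
  taylor N (fun x => f x + g x) = taylor N f + taylor N g.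
Proof.
move=> sf sg; apply/polyP => i; rewrite coefD !coef_poly; case: ifP; last by rewrite addr0.
by rewrite derive1n_smoothD// mulrDl.
Qed.

Lemma taylorZ N (c : R) f : smooth f -> taylor N (fun x => c * f x) = c *: taylor N f.
Proof.
move=> sf; apply/polyP => i; rewrite coefZ !coef_poly; case: ifP; last by rewrite mulr0.
by rewrite derive1n_smoothZ// mulrA.
Qed.

(** Induction on N by differentiating both sides: the product rules for polynomials and for
    functions match, and no binomial sums occur. *)
Lemma taylorM N f g : smooth f -> smooth g ->
  eq_modX N (taylor N f * taylor N g) (taylor N (fun x => f x * g x)).
Proof.
elim: N f g => // N IH f g sf sg; apply: eq_modX_deriv.
  by rewrite coef0M !coef_taylor// fact0 !divr1.
rewrite derivM !deriv_taylor derive1_smoothM// taylorD; last 2 first.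
- by apply: smoothM => //; exact: smooth_derive1.
- by apply: smoothM => //; exact: smooth_derive1.
have sf' := smooth_derive1 sf; have sg' := smooth_derive1 sg.
have W h : eq_modX N (taylor N.+1 h) (taylor N h).
  by move=> i iN; rewrite !coef_taylor// ltnW.
apply: eq_modXD.
- by apply: eq_modX_trans (IH _ _ sf' sg); apply: eq_modXM.
- by apply: eq_modX_trans (IH _ _ sf sg'); apply: eq_modXM.
Qed.

Lemma coef_taylor_expR N (c : R) i : (i < N)%N ->
  (taylor N (fun t => expR (c * t)))`_i = c ^+ i / i`!%:R.
Proof. by move=> iN; rewrite coef_taylor// derive1n_expR mulr0 expR0 mulr1. Qed.

End taylor.

(** * Derivatives of log [a]_t at 0 *)

Section cumulants_of_geo.
Context (R : realType).

Definition bernR i : R := ratr (bernoulli i).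

Lemma bernR_rec n : \sum_(k < n.+1) 'C(n.+1, k)%:R * bernR k = (n == 0)%N%:R.
Proof.
rewrite -[RHS](ratr_nat R) -bernoulli_rec rmorph_sum; apply: eq_bigr => k _.
by rewrite rmorphM/= ratr_nat.
Qed.

(** The truncation of B(cX), where B(z) = z / (e^z - 1). *)
Definition bern_poly N (c : R) : {poly R} := \poly_(i < N) (bernR i * c ^+ i / i`!%:R).

Definition expm1 (c : R) : R -> R := fun t => expR (c * t) - 1.

Lemma smooth_expm1 c : smooth (expm1 c).
Proof. by apply: smoothB; [exact: smooth_expR|exact: smooth_cst]. Qed.

Lemma coef_taylor_expm1 N (c : R) i : (i < N)%N ->
  (taylor N (expm1 c))`_i = if i == 0%N then 0 else c ^+ i / i`!%:R.
Proof.
move=> iN; rewrite /expm1 taylorD; [|exact: smooth_expR|exact: smooth_cst].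
rewrite coefD coef_taylor_expR// coef_taylor//.
case: i iN => [_|i _]; first by rewrite derive1n0 expr0 fact0 !divr1 subrr.
by rewrite derive1n_cst mul0r addr0.
Qed.

(* The defining identity B(ct) (e^(ct) - 1) = ct of the Bernoulli numbers. *)
Lemma bern_polyM N (c : R) :
  eq_modX N (bern_poly N c * taylor N (expm1 c)) (c *: 'X).
Proof.
move=> i iN; rewrite coefM coefZ coefX big_ord_recr/= subnn coef_taylor_expm1; last by lia.
rewrite eqxx mulr0 addr0.
transitivity (c ^+ i / i`!%:R * \sum_(j < i) 'C(i, j)%:R * bernR j).
  rewrite mulr_sumr; apply: eq_bigr => j _; have ji := ltn_ord j.
  rewrite coef_poly (ltn_trans ji iN) coef_taylor_expm1; last by lia.
  rewrite (_ : (i - j == 0)%N = false); last by lia.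
  have -> : c ^+ i = c ^+ j * c ^+ (i - j) by rewrite -exprD subnKC// ltnW.
  rewrite -(bin_fact (ltnW ji)) !natrM.
  field; rewrite !pnatr_eq0 -!lt0n !fact_gt0 bin_gt0 (ltnW ji)//.
case: i iN => [|i] iN; first by rewrite big_ord0 !mulr0.
by rewrite bernR_rec; case: i iN => [|i] iN; rewrite ?fact0 ?expr1 ?divr1// !mulr0.
Qed.

Lemma smooth_geo x : smooth (geo (R := R) x).
Proof. by apply: smooth_sum => i; exact: smooth_expR. Qed.

(* (log geo)' = a e^(at) / (e^(at) - 1) - e^t / (e^t - 1) has removable
   singularities at 0: its Taylor coefficients are identified after
   multiplication by both denominators. *)
Lemma derive1n_ln_geo a j : (0 < a)%N ->
  derive1n j.+1 (fun t => ln (geo a t)) 0 =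
  (if j == 0%N then a%:R - 1 else 0) + bernR j.+1 * (a%:R ^+ j.+1 - 1) / j.+1%:R :> R.
Proof.
move=> a0; rewrite derive1Sn derive1_ln; [|by move=> x; exact: geo_gt0|exact: smooth_geo].
set g := fun x : R => _.
have sgeo := smooth_geo a.
have sg : smooth g.
  apply: smoothM; first exact: smooth_derive1.
  by apply: smoothV => // x; rewrite gt_eqF// geo_gt0.
pose u := expm1 1; pose v := expm1 a%:R.
have su : smooth u by exact: smooth_expm1.
have sv : smooth v by exact: smooth_expm1.
have uE : (fun t => geo a t * u t) = v by apply/funext => t; rewrite /u /v /expm1 mul1r geoE.
have du c : derive1 (expm1 c) = (fun t => c * (expm1 c t + 1)).
  rewrite /expm1 derive1_smoothD; [|exact: smooth_expR|exact: smooth_cst].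
  apply/funext => t; rewrite -derive1n1 derive1n_expR -[derive1 (fun=> _)]derive1n1 derive1n_cst.
  by rewrite addr0 subrK expr1.
(* This is g = (a - 1) + a/v - 1/u cleared of denominators, so that it also holds at t = 0. *)
have key : (fun t => (g t - (a%:R - 1)) * (v t * u t)) = (fun t => a%:R * u t - v t).
  have := congr1 (@derive1 R R) uE; rewrite derive1_smoothM// !du => E.
  apply/funext => t; have := congr1 (@^~ t) E; rewrite /= -!/(v t) -!/(u t) => Et.
  have gE : derive1 (geo (R := R) a) t = g t * geo a t by rewrite /g divfK// gt_eqF// geo_gt0.
  have vE : geo a t * u t = v t by rewrite -uE.
  rewrite -/u -/v in Et.
  rewrite gE -mulrA vE mul1r in Et.
  have {}Et : g t * v t = a%:R * (v t + 1) - geo a t * (u t + 1) by rewrite -Et addrK.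
  have -> : (g t - (a%:R - 1)) * (v t * u t) = (g t * v t) * u t - (a%:R - 1) * v t * u t by ring.
  rewrite Et; have -> : v t = geo a t * u t by [].
  ring.
pose g' (t : R) := g t - (a%:R - 1).
have sg' : smooth g' by apply: smoothB => //; exact: smooth_cst.
(* Three factors X are cancelled below, one in [GE] and one each from U and V; the coefficients up
   to j remain. *)
pose N := j.+4.
(* The expected expansion of g - (a - 1): multiplied by X, it is B(aX) - B(X), whose constant terms
   cancel. *)
pose G : {poly R} := \poly_(i < N) (bernR i.+1 * (a%:R ^+ i.+1 - 1) / i.+1`!%:R).
pose U := taylor N u; pose V := taylor N v.
have g'E : eq_modX N (taylor N g' * (V * U)) (a%:R *: U - V).
  apply: (eq_modX_trans (eq_modXM (fun i _ => erefl) (taylorM sv su))).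
  apply: (eq_modX_trans (taylorM sg' (smoothM sv su))).
  rewrite /g' key -scaleN1r -!taylorZ// -taylorD; last 2 first.
  - exact/smoothM/su/smooth_cst.
  - exact/smoothM/sv/smooth_cst.
  by move=> i iN; congr (taylor _ _)`_i; apply/funext => t; rewrite mulN1r.
have XG : eq_modX N ('X * G) (bern_poly N a%:R - bern_poly N 1).
  move=> i iN; rewrite coefXM coefB !coef_poly iN; case: i iN => [|i] iN /=.
    by rewrite !expr0 subrr.
  by rewrite (ltnW iN) expr1n mulrBr mulrBl.
have GE : eq_modX N ('X * (G * (V * U))) ('X * (a%:R *: U - V)).
  rewrite mulrA.
  apply: (eq_modX_trans (eq_modXM XG (fun i _ => erefl))).
  rewrite mulrBl [X in _ - X]mulrCA mulrA mulrBr -scalerAr.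
  apply: eq_modXD.
    have := eq_modXM (bern_polyM (N := N) a%:R) (fun i (_ : (i < N)%N) => erefl (U`_i)).
    by rewrite -scalerAl mulrA.
  have := eq_modXM (bern_polyM (N := N) 1) (fun i (_ : (i < N)%N) => erefl (V`_i)).
  rewrite scale1r => h i iN; rewrite !coefN; congr (- _).
  by rewrite -h// -mulrA mulrC.
(* U and V vanish at 0 and cannot be cancelled modulo a power of X; after removing one X from each,
   the constant terms 1 and a are nonzero. *)
have factX c : exists2 W : {poly R}, taylor N (expm1 c) = 'X * W & W`_0 = c.
  exists (\poly_(i < N) (taylor N (expm1 c))`_i.+1).
    apply/polyP => i; rewrite coefXM; case: i => [|i] /=; first by rewrite coef_taylor_expm1.
    rewrite [RHS]coef_poly; case: ltnP => // iN.
    by rewrite nth_default// (leq_trans (size_poly _ _))// leqW.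
  by rewrite coef_poly/= coef_taylor_expm1//= expr1 divr1.
have [U1 UE U10] := factX 1; have [V1 VE V10] := factX a%:R.
rewrite -/u -/U in UE; rewrite -/v -/V in VE.
have g'G : eq_modX j.+1 (taylor N g') G.
  apply: (@eq_modX_mulI _ _ _ _ (V1 * U1)).
    by rewrite coef0M U10 V10 mulr1 pnatr_eq0 -lt0n.
  apply: eq_modX_mulX; apply: eq_modX_mulX.
  have e p : 'X * ('X * (p * (V1 * U1))) = p * (V * U) by rewrite VE UE; ring.
  rewrite !e => i iN.
  rewrite g'E; last by rewrite /N; lia.
  by have := eq_modX_mulX (N := j.+3) GE; rewrite /eq_modX => ->.
have := g'G j (ltnSn j); rewrite coef_taylor; last by rewrite /N; lia.
rewrite coef_poly (_ : (j < N)%N = true); last by rewrite /N; lia.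
have -> : derive1n j g' 0 = derive1n j g 0 - (if j == 0%N then a%:R - 1 else 0).
  rewrite /g' derive1n_smoothD//; last exact: smooth_cst.
  by case: (j) => [|k]; rewrite ?derive1n0// derive1n_cst oppr0.
rewrite factS natrM invfM !mulrA => /(mulIf _) h.
have {}h : derive1n j g 0 - (if j == 0%N then a%:R - 1 else 0) =
    bernR j.+1 * (a%:R ^+ j.+1 - 1) / j.+1%:R.
  by apply: h; rewrite invr_eq0 pnatr_eq0 -lt0n fact_gt0.
by rewrite -h addrC subrK.
Qed.

End cumulants_of_geo.

(** * The function sinh y / y *)

Section sinhc.
Context (R : realType).
Implicit Types (x y : R).

Definition sinhc y : R :=
  if y == 0 then 1 else (expR y - expR (- y)) / (2 * y).

Lemma sinhc0 : sinhc 0 = 1.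
Proof. by rewrite /sinhc eqxx. Qed.

Definition sinhc_coeff y k : R := y ^+ (2 * k) / (2 * k).+1`!%:R.

Definition sinhc_sum y n : R := \sum_(k < n) sinhc_coeff y k.

Lemma sinhc_coeff_ge0 y k : 0 <= sinhc_coeff y k.
Proof. by rewrite divr_ge0// exprM exprn_ge0// sqr_ge0. Qed.

Lemma sinhc_coeff0 y : sinhc_coeff y 0 = 1.
Proof. by rewrite /sinhc_coeff muln0 expr0 divr1. Qed.

Lemma exp_coeff_odd_even y k :
  exp_coeff y (2 * k)%N - exp_coeff (- y) (2 * k)%N +
  (exp_coeff y (2 * k).+1 - exp_coeff (- y) (2 * k).+1) = sinhc_coeff y k * (2 * y).
Proof.
have e : (- y) ^+ (2 * k) = y ^+ (2 * k) by rewrite !exprM sqrrN.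
by rewrite /exp_coeff /= /sinhc_coeff !exprS e; ring.
Qed.

Lemma series_exp_coeff_cvg y : series (exp_coeff y) @ \oo --> expR y.
Proof. exact: is_cvg_series_exp_coeff. Qed.
Arguments series_exp_coeff_cvg : clear implicits.

(** In the series of e^y - e^(-y), the terms 2k and 2k + 1 are grouped: the even ones cancel and the
    odd ones double. At y = 0 only the constant term is left. *)
Lemma sinhc_sum_cvg y : sinhc_sum y @ \oo --> sinhc y.
Proof.
rewrite /sinhc; case: eqVneq => [->|y0].
  rewrite -cvg_shiftS /=.
  apply: cvg_near_cst; near=> n; rewrite /sinhc_sum big_ord_recl sinhc_coeff0.
  rewrite big1 ?addr0// => i _; rewrite /sinhc_coeff expr0n muln_eq0/=.
  by rewrite mul0r.
have H : (fun n => (series (exp_coeff y) (2 * n)%N - series (exp_coeff (- y)) (2 * n)%N) / (2 * y))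
    = sinhc_sum y.
  apply/funext => n; rewrite /series /=/sinhc_sum.
  apply: (canLR (mulfK _)); first by rewrite mulf_neq0// pnatr_eq0.
  rewrite -sumrB mulr_suml.
  elim: n => [|n IH]; first by rewrite muln0 big_geq// big_ord0.
  rewrite mulnS addnC addn2 big_ord_recr big_nat_recr// big_nat_recr// IH.
  by rewrite -exp_coeff_odd_even [RHS]addrA.
rewrite -H; apply: cvgM; last exact: cvg_cst.
have sub : (fun n => (2 * n)%N) @ \oo --> \oo.
  by apply/cvgnyPge => A; near=> n; rewrite (@leq_trans n)//; [near: n; exact: nbhs_infty_ge|lia].
apply: cvgB.
- exact: (cvg_comp _ _ sub (series_exp_coeff_cvg y)).
- exact: (cvg_comp _ _ sub (series_exp_coeff_cvg (- y))).
Unshelve. all: by end_near. Qed.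

Arguments sinhc_sum_cvg : clear implicits.

Lemma sinhc_sum_le x y n : x ^+ 2 <= y ^+ 2 -> sinhc_sum x n <= sinhc_sum y n.
Proof.
move=> xy; apply: ler_sum => k _; rewrite /sinhc_coeff ler_pM2r ?invr_gt0 ?ltr0n ?fact_gt0//.
by rewrite !exprM lerXn2r// nnegrE sqr_ge0.
Qed.

Lemma sinhc_le x y : x ^+ 2 <= y ^+ 2 -> sinhc x <= sinhc y.
Proof.
move=> xy; apply: (ler_cvg_to (sinhc_sum_cvg x) (sinhc_sum_cvg y)).
by near=> n; exact: sinhc_sum_le.
Unshelve. all: by end_near. Qed.

Lemma sinhc_ge y : 1 + y ^+ 2 / 6 <= sinhc y.
Proof.
apply: (cvgr_to_ge (sinhc_sum_cvg y)); near=> n.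
have n2 : (2 <= n)%N by near: n; exact: nbhs_infty_ge.
rewrite -(subnKC n2) add2n.
rewrite /sinhc_sum big_ord_recl big_ord_recl sinhc_coeff0.
rewrite addrA lerDl sumr_ge0// => i _; exact: sinhc_coeff_ge0.
Unshelve. all: by end_near. Qed.

Lemma sinhc_ge1 y : 1 <= sinhc y.
Proof. by apply: le_trans (sinhc_ge y); rewrite lerDl divr_ge0// sqr_ge0. Qed.

Lemma sinhc_gt0 y : 0 < sinhc y.
Proof. exact: lt_le_trans (sinhc_ge1 y). Qed.

(** The induction step is (2k + 2)(2k + 3) >= 6 (k + 1). This compares the series of sinh y / y and
    of e^(y^2/6) term by term. *)
Lemma fact_odd_ge k : (6 ^ k * k`! <= (2 * k).+1`!)%N.
Proof.
elim: k => // k IH; rewrite (_ : (2 * k.+1).+1 = (2 * k).+3)%N; last by lia.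
rewrite !factS expnS; have := fact_gt0 (2 * k); move: IH; rewrite factS.
set a := (6 ^ k)%N; set b := k`!; set c := (2 * k)`!; nia.
Qed.

Lemma sinhc_le_expR y : sinhc y <= expR (y ^+ 2 / 6).
Proof.
apply: (cvgr_to_le (sinhc_sum_cvg y)); near=> n.
apply: (@le_trans _ _ (series (exp_coeff (y ^+ 2 / 6)) n)); last first.
  apply: nondecreasing_cvgn_le; last exact: is_cvg_series_exp_coeff.
  apply: nondecreasing_series => i _ _; apply: exp_coeff_ge0.
  by rewrite divr_ge0// sqr_ge0.
rewrite /series/= big_mkord; apply: ler_sum => k _.
rewrite exp_coeffE/= expr_div_n -exprM mulrC -mulrA -invfM -natrX -natrM.
rewrite /sinhc_coeff ler_wpM2l//; first by rewrite exprM exprn_ge0// sqr_ge0.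
rewrite lef_pV2 ?posrE ?ltr0n ?muln_gt0 ?expn_gt0 ?fact_gt0//.
by rewrite ler_nat fact_odd_ge.
Unshelve. all: by end_near. Qed.

Lemma sinhc_continuous y : y != 0 -> {for y, continuous sinhc}.
Proof.
move=> y0.
pose f x : R := (expR x - expR (- x)) / (2 * x).
have cf : f @ y --> f y.
  apply: cvgM.
    apply: cvgB; first exact: continuous_expR.
    by apply: continuous_comp; [exact: opp_continuous|exact: continuous_expR].
  apply: cvgV; first by rewrite mulf_neq0// pnatr_eq0.
  by apply: cvgM; [exact: cvg_cst|exact: cvg_id].
have E : \forall x \near y, f x = sinhc x.
  near=> x; have x0 : x != 0.
    by near: x; exact: (@cvgr_neq0 _ R^o _ (nbhs y) _ id y cvg_id y0).
  by rewrite /sinhc (negbTE x0).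
have sE : sinhc y = f y by rewrite /sinhc (negbTE y0).
suff : sinhc @ y --> f y by rewrite -sE.
by apply: cvg_trans cf; apply: near_eq_cvg.
Unshelve. all: by end_near. Qed.

End sinhc.

(** * Cumulants of the rank *)

(** The measure is 1/|A| times a sum of Dirac masses along an enumeration of A, against which
    integrals are finite sums. *)
Lemma ge0_integral_uniform_on d (T : measurableType d) (R : realType) (A : set T)
    (mA : measurable A) (f : T -> R) : finite_set A -> A !=set0 ->
  measurable_fun [set: T] f -> (forall x, 0 <= f x) ->
  (\int[uniform_on R mA]_x (f x)%:E =
   ((\sum_(x <- fset_set A) f x) / (#|` fset_set A|)%:R)%:E)%E.
Proof.
move=> finA A0 mf f0.
set n := #|` fset_set A|; set s := (fset_set A : seq T).
have n1_ge0 : 0 <= (n%:R : R)^-1 by rewrite invr_ge0.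
pose D := msum (fun i => dirac (nth point s i) : {measure set T -> \bar R}) n.
have fE : measurable_fun [set: T] (EFin \o f) by exact/measurable_EFinP.
have sumE (g : T -> R) : (\sum_(i < n) g (nth point s i) = \sum_(x <- s) g x).
  by rewrite [RHS](big_nth point) big_mkord.
rewrite (@eq_measure_integral _ _ _ setT (mscale (NngNum n1_ge0) D)); last first.
  move=> U mU _; transitivity (uniform_on R mA U) => //.
  rewrite uniform_onE// -/n; transitivity ((n%:R^-1)%:E * D U)%E => //.
  rewrite /D /msum.
  under eq_bigr do rewrite /= diracE.
  rewrite sumEFin (sumE (fun x => (x \in U)%:R)) -EFinM mulrC; congr (_ * _)%:E.
  rewrite -natr_sum; congr (_%:R).
  have finUA : finite_set (U `&` A) by exact: finite_setIr.
  have us : uniq s by exact: fset_uniq.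
  transitivity (count (fun x => x \in U) s).
    rewrite -size_filter; apply: perm_size; apply: uniq_perm; rewrite ?filter_uniq//.
    by move=> x; rewrite mem_filter !in_fset_set// in_setI.
  by rewrite -sum1_count big_mkcond/=; apply: eq_bigr => x _; case: (x \in U).
rewrite ge0_integral_mscale//; last by move=> x _; rewrite lee_fin.
rewrite ge0_integral_measure_sum//; last by move=> x _; rewrite lee_fin.
under eq_bigr do rewrite integral_dirac// diracE in_setT mul1e.
by rewrite sumEFin sumE -EFinM mulrC.
Qed.

Lemma measurable_expR_scale (R : realType) (t : R) :
  measurable_fun [set: R] (fun x => (expR (t * x))%:E).
Proof. by apply/measurable_EFinP/measurableT_comp => //; exact: measurable_funM. Qed.

Section finite_expectation.
Context (R : realType) (lam : seq nat) (m : nat).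
Hypothesis sz : (size lam <= m)%N.
Local Notation P := (uniform_ssyt R lam m).
Local Notation X := (rank_ssyt R lam m).
Local Notation A := (fset_set (ssyt lam m)).

Lemma ge0_integral_ssyt (f : filling lam -> R) : (forall x, 0 <= f x) ->
  (\int[P]_x (f x)%:E = ((\sum_(x <- A) f x) / (#|` A|)%:R)%:E)%E.
Proof.
move=> f0; apply: ge0_integral_uniform_on => //; first exact: finite_ssyt.
exact: ssyt_neq0.
Qed.

Lemma card_ssyt_gt0 : (0 < #|` A|)%N.
Proof.
have fin := finite_ssyt lam m; have [T sT] := ssyt_neq0 sz.
by rewrite cardfs_gt0; apply/fset0Pn; exists T; rewrite in_fset_set// inE.
Qed.

Lemma mgf_ssyt t : fine ('M_P X t) = (\sum_(x <- A) expR (t * rank R m x)) / (#|` A|)%:R.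
Proof.
rewrite /mmt_gen_fun unlock ge0_integral_ssyt/=; last by move=> x; exact: expR_ge0.
by congr (_ / _); apply: eq_bigr => x _; rewrite mulrC.
Qed.

Lemma expectation_ssyt : fine ('E_P[X])%E = (\sum_(x <- A) rank R m x) / (#|` A|)%:R.
Proof. by rewrite unlock ge0_integral_ssyt. Qed.

Lemma variance_ssyt : fine ('V_P[X])%E =
  (\sum_(x <- A) (rank R m x - fine ('E_P[X])%E) ^+ 2) / (#|` A|)%:R.
Proof.
rewrite /variance covariance.unlock {1}unlock.
have := @ge0_integral_ssyt (fun x => (rank R m x - fine ('E_P[X])%E) ^+ 2) (fun x => sqr_ge0 _).
by move=> ->.
Qed.

Lemma mgf_standardize t :
  (\int[law (standardize X)]_x (expR (t * x))%:E =
  ((\sum_(x <- A) expR (t * ((rank R m x - fine ('E_P[X])) / Num.sqrt (fine 'V_P[X]))))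
    / (#|` A|)%:R)%:E)%E.
Proof.
rewrite ge0_integral_distribution//=; last exact: measurable_expR_scale.
  by rewrite ge0_integral_ssyt// => x; exact: expR_ge0.
Qed.

Let cardR : (#|` A|%:R : R) != 0.
Proof. by rewrite pnatr_eq0 -lt0n card_ssyt_gt0. Qed.

Definition ssyt_mgf (t : R) : R := (\sum_(x <- A) expR (t * rank R m x)) / (#|` A|)%:R.

Lemma ssyt_mgf0 : ssyt_mgf 0 = 1.
Proof.
rewrite /ssyt_mgf (eq_bigr (fun=> 1)) => [|x _]; last by rewrite mul0r expR0.
by rewrite big_const_seq count_predT iter_addr addr0 divff.
Qed.

Lemma ssyt_mgf_gt0 t : 0 < ssyt_mgf t.
Proof.
rewrite divr_gt0 ?ltr0n ?card_ssyt_gt0//.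
have := card_ssyt_gt0; case: (A : seq _) => //= x r _.
rewrite big_cons ltr_pwDl ?expR_gt0// sumr_ge0// => i _; exact: expR_ge0.
Qed.

Lemma cumulant_ssyt d : cumulant X d = derive1n d (fun t => ln (ssyt_mgf t)) 0.
Proof. by rewrite /cumulant; congr (derive1n d _ 0); apply/funext => t; rewrite mgf_ssyt. Qed.

Lemma ssyt_mgfE : ssyt_mgf = (fun t => (#|` A|)%:R^-1 * \sum_(x <- A) expR (rank R m x * t)).
Proof.
apply/funext => t; rewrite /ssyt_mgf mulrC; congr (_ * _).
by apply: eq_bigr => x _; rewrite mulrC.
Qed.

Lemma smooth_ssyt_mgf : smooth ssyt_mgf.
Proof.
rewrite ssyt_mgfE; apply: smoothM; first exact: smooth_cst.
by apply: smooth_sum => x; exact: smooth_expR.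
Qed.

Lemma derive1n_ssyt_mgf n :
  derive1n n ssyt_mgf 0 = (\sum_(x <- A) rank R m x ^+ n) / (#|` A|)%:R.
Proof.
have s x : smooth (fun t => expR (rank R m x * t) : R) by exact: smooth_expR.
rewrite ssyt_mgfE derive1n_smoothZ; last exact: smooth_sum.
rewrite derive1n_sum// mulrC; congr (_ / _); apply: eq_bigr => x _.
by rewrite derive1n_expR mulr0 expR0 mulr1.
Qed.

Lemma expectation_cumulant : fine ('E_P[X])%E = cumulant X 1.
Proof.
rewrite expectation_ssyt cumulant_ssyt derive1n1 derive1_ln; last exact: smooth_ssyt_mgf.
  by rewrite ssyt_mgf0 divr1 -derive1n1 derive1n_ssyt_mgf.
exact: ssyt_mgf_gt0.
Qed.

(** As M(0) = 1, the second derivative of log M at 0 is M''(0) - M'(0)^2. The standard deviation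
    used in [standardize] thus becomes accessible through the product formula. *)
Lemma variance_cumulant : fine ('V_P[X])%E = cumulant X 2.
Proof.
have sM := smooth_ssyt_mgf; have M0 := ssyt_mgf_gt0.
rewrite cumulant_ssyt derive1Sn derive1_ln// derive1n1 derive1_smoothM//; last 2 first.
- exact: smooth_derive1.
- by apply: smoothV => // x; rewrite gt_eqF.
have dV : derive1 (fun t => (ssyt_mgf t)^-1) 0 = - derive1 ssyt_mgf 0.
  have h := is_deriveV (lt0r_neq0 (M0 0)) (smooth_is_derive sM 0).
  by rewrite derive1E (@derive_val _ _ _ _ _ _ _ h) ssyt_mgf0 expr1n invr1 scaleN1r.
have -> : derive1 (derive1 ssyt_mgf) 0 = derive1n 2 ssyt_mgf 0 by rewrite derive1Sn derive1n1.
rewrite dV ssyt_mgf0 divr1 -derive1n1 !derive1n_ssyt_mgf.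
rewrite variance_ssyt expectation_ssyt.
rewrite [in RHS](eq_bigr (fun x => rank R m x) (fun x _ => expr1 (rank R m x))).
set S1 := \sum_(x <- A) rank R m x; set S2 := \sum_(x <- A) rank R m x ^+ 2.
pose c := S1 / (#|` A|)%:R.
rewrite (eq_bigr (fun x => rank R m x ^+ 2 + (- 2 * c * rank R m x + c ^+ 2))); last first.
  by move=> x _; rewrite -/c; ring.
rewrite !big_split/= -mulr_sumr big_const_seq count_predT iter_addr addr0 -mulr_natr.
rewrite -/S1 -/S2 /c; field; exact: cardR.
Qed.

End finite_expectation.

Lemma continuous_eq_at0 (R : realType) (f g : R -> R) :
  continuous f -> continuous g -> (forall t, t != 0 -> f t = g t) -> f 0 = g 0.
Proof.
move=> cf cg fg.
have f0 : f x @[x --> 0^'] --> f 0 by apply/continuous_withinNx; exact: cf.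
have g0 : g x @[x --> 0^'] --> g 0 by apply/continuous_withinNx; exact: cg.
apply: (cvg_unique _ f0); first exact: norm_hausdorff.
apply: cvg_trans g0; apply: near_eq_cvg; near=> x; rewrite fg//.
by near: x; exact: nbhs_dnbhs_neq.
Unshelve. all: by end_near. Qed.

Lemma ln_prod_seq (R : realType) (I : Type) (s : seq I) (f : I -> R) :
  (forall i, 0 < f i) -> ln (\prod_(i <- s) f i) = \sum_(i <- s) ln (f i).
Proof.
move=> f0; elim: s => [|i s IH]; first by rewrite !big_nil ln1.
by rewrite !big_cons lnM ?IH// posrE// prodr_gt0.
Qed.

Lemma bernR0 (R : realType) : bernR R 0 = 1.
Proof. by have := bernR_rec R 0; rewrite big_ord_recl big_ord0 bin0 mul1r addr0. Qed.

Lemma bernR1 (R : realType) : bernR R 1 = - (1 / 2).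
Proof.
have := bernR_rec R 1; rewrite !big_ord_recl big_ord0 /bump/= bernR0 => h.
have -> : bernR R 1 = (('C(2, 0)%:R * 1 + ('C(2, 1)%:R * bernR R 1 + 0)) - 1) / 2.
  by rewrite bin0 bin1; field.
by rewrite h; lra.
Qed.

Lemma bernR2 (R : realType) : bernR R 2 = 1 / 6.
Proof.
have := bernR_rec R 2; rewrite !big_ord_recl big_ord0 /bump/= bernR0 bernR1 => h.
have e : 'C(3, 0)%:R * 1 + ('C(3, 1)%:R * - (1 / 2) + ('C(3, 2)%:R * bernR R 2 + 0)) =
    3 * bernR R 2 - 1 / 2.
  by rewrite bin0 bin1 (_ : 'C(3, 2) = 3%N)//; field.
rewrite e in h; lra.
Qed.

(** * Cumulants and centered moment generating function of the rank *)

Section log_mgf.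
Context (R : realType) (lam : seq nat) (m : nat).
Hypothesis lamP : is_partition lam.
Hypothesis sz : (size lam <= m)%N.
Local Notation a := (contents lam m).
Local Notation h := (hooks lam m).
Local Notation M := (@ssyt_mgf R lam m).
Local Notation X := (rank_ssyt R lam m).

Let a_gt0 x : x \in a -> (0 < x)%N.
Proof. by case/(contents_bounds lamP). Qed.

Let h_gt0 x : x \in h -> (0 < x)%N.
Proof. by move=> /(hooks_bounds lamP)/andP[]. Qed.

(** The value t = 0, excluded from [sum_expR_rank], follows by continuity of both sides. *)
Lemma ssyt_mgf_geo : exists c : R, exists C : R, 0 < C /\ forall t,
  M t * \prod_(x <- h) geo x t = C * expR (c * t) * \prod_(x <- a) geo x t.
Proof.
have [c cE] := sum_expR_rank R lamP sz; exists c.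
exists (#|` fset_set (ssyt lam m)|%:R)^-1.
split; first by rewrite invr_gt0 ltr0n card_ssyt_gt0.
have E t : t != 0 -> M t * \prod_(x <- h) geo x t =
    (#|` fset_set (ssyt lam m)|%:R)^-1 * expR (c * t) * \prod_(x <- a) geo x t.
  move=> t0; rewrite -mulrA -cE// fsbig_finite/= ?/ssyt_mgf; last exact: finite_ssyt.
  by ring.
move=> t; have [->|/E//] := eqVneq t 0.
apply: (continuous_eq_at0 _ _ E); apply: smooth_continuous.
- by apply: smoothM; [exact: smooth_ssyt_mgf|apply: smooth_prod => i; exact: smooth_geo].
- apply: smoothM; last by apply: smooth_prod => i; exact: smooth_geo.
  by apply: smoothM; [exact: smooth_cst|exact: smooth_expR].
Qed.

(* [geo 0 = 0] has no logarithm. *)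
Definition geoS x (t : R) : R := geo x.-1.+1 t.

Let geoS_prod (s : seq nat) t : (forall x, x \in s -> (0 < x)%N) ->
  \prod_(x <- s) geo x t = \prod_(x <- s) geoS x t.
Proof.
move=> s0; rewrite big_seq [RHS]big_seq; apply: eq_bigr => x /s0 x0.
by rewrite /geoS prednK.
Qed.

(** The product formula and the cumulants are stated together because they share c: [centered_mgf]
    cancels e^(ct) against the mean. *)
Lemma ln_ssyt_mgf : exists c : R, exists C : R, 0 < C /\
  (forall t, M t * \prod_(x <- h) geo x t = C * expR (c * t) * \prod_(x <- a) geo x t) /\
  forall d, cumulant X d.+1 = (if d == 0%N then c else 0) +
    (\sum_(x <- a) derive1n d.+1 (fun t => ln (geo x t)) 0 -
     \sum_(x <- h) derive1n d.+1 (fun t => ln (geo x t)) 0).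
Proof.
have [c [C [C0 E]]] := ssyt_mgf_geo; exists c, C; split => //; split => // d.
have g0 x t : 0 < geoS x t by exact: geo_gt0.
have sg x : smooth (geoS x) by exact: smooth_geo.
have sl x : smooth (fun t => ln (geoS x t)) by exact: smooth_ln.
have lnE : (fun t => ln (M t)) = (fun t => (ln C + c * t) +
    (\sum_(x <- a) ln (geoS x t) + -1 * \sum_(x <- h) ln (geoS x t))).
  apply/funext => t; have := E t; rewrite !geoS_prod// => Et.
  have := congr1 (@ln R) Et.
  have pos (s : seq nat) : 0 < \prod_(x <- s) geoS x t by apply: prodr_gt0 => i _.
  have Mt := @ssyt_mgf_gt0 R _ _ sz t; have et := expR_gt0 (c * t).
  rewrite lnM ?posrE// lnM ?posrE ?mulr_gt0// lnM ?posrE//.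
  rewrite !ln_prod_seq// expRK => Es.
  by rewrite -[LHS](addrK (\sum_(x <- h) ln (geoS x t))) Es; ring.
have swap (s : seq nat) : (forall x, x \in s -> (0 < x)%N) ->
    \sum_(x <- s) derive1n d.+1 (fun t => ln (geo x t)) 0 =
    \sum_(x <- s) derive1n d.+1 (fun t => ln (geoS x t)) 0 :> R.
  move=> s0; rewrite big_seq [RHS]big_seq; apply: eq_bigr => x /s0 x0.
  by rewrite /geoS prednK.
rewrite cumulant_ssyt// lnE swap// swap//.
rewrite derive1n_smoothD; last 2 first.
- apply: smoothD; first exact: smooth_cst.
  by apply: smoothM; [exact: smooth_cst|exact: smooth_id].
- by apply: smoothD; [exact: smooth_sum|apply: smoothM; [exact: smooth_cst|exact: smooth_sum]].
congr (_ + _).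
  rewrite derive1n_smoothD ?derive1n_cst ?add0r; last 2 first.
  - exact: smooth_cst.
  - by apply: smoothM; [exact: smooth_cst|exact: smooth_id].
  rewrite derive1n_smoothZ; last exact: smooth_id.
  rewrite derive1Sn (_ : derive1 id = fun=> 1); last first.
    by apply/funext => x; rewrite derive1_id.
  by case: (d) => [|k]; rewrite ?derive1n0 ?mulr1// derive1n_cst mulr0.
rewrite derive1n_smoothD; last 2 first.
- exact: smooth_sum.
- by apply: smoothM; [exact: smooth_cst|exact: smooth_sum].
rewrite derive1n_smoothZ; last exact: smooth_sum.
by rewrite !derive1n_sum// mulN1r.
Qed.

(** The terms -1 in a^d - 1 cancel because there are as many contents as hooks. *)
Lemma cumulant_rank d : (2 <= d)%N ->
  cumulant X d = bernR R d / d%:R * (\sum_(x <- a) x%:R ^+ d - \sum_(x <- h) x%:R ^+ d).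
Proof.
case: d => // -[//|d] _; have [c [C [_ [_ ->]]]] := ln_ssyt_mgf.
rewrite add0r.
have E (s : seq nat) : (forall x, x \in s -> (0 < x)%N) ->
    \sum_(x <- s) derive1n d.+2 (fun t => ln (geo x t)) 0 =
    bernR R d.+2 / d.+2%:R * (\sum_(x <- s) x%:R ^+ d.+2 - (size s)%:R) :> R.
  move=> s0; rewrite -[in (size s)%:R]sum1_size natr_sum -sumrB mulr_sumr.
  rewrite big_seq [RHS]big_seq; apply: eq_bigr => x /s0 x0.
  by rewrite derive1n_ln_geo// add0r; ring.
by rewrite !E// size_contents// size_hooks//; ring.
Qed.

(** From e^(xt) - 1 the factor e^(xt/2) is taken out, and e^(t/2) from e^t - 1; what is left are
    hyperbolic sines. *)
Lemma geo_sinhc x t : geo x t * sinhc (t / 2) =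
  x%:R * expR ((x%:R - 1) / 2 * t) * sinhc (x%:R * t / 2) :> R.
Proof.
have [->|t0] := eqVneq t 0.
  rewrite !mulr0 !mul0r expR0 /sinhc eqxx !mulr1 /geo.
  under eq_bigr do rewrite mulr0 expR0.
  by rewrite sumr_const card_ord.
have [->|x0] := eqVneq x 0%N; first by rewrite /geo big_ord0 !mul0r.
have x0' : x%:R != 0 :> R by rewrite pnatr_eq0.
rewrite /sinhc !mulf_eq0 invr_eq0 pnatr_eq0 (negbTE t0) (negbTE x0')/=.
have e1 : expR t - 1 = expR (t / 2) * (expR (t / 2) - expR (- (t / 2))).
  by rewrite mulrBr -!expRD subrr expR0 -splitr.
have e2 : expR (x%:R * t) - 1 =
    expR (x%:R * t / 2) * (expR (x%:R * t / 2) - expR (- (x%:R * t / 2))).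
  by rewrite mulrBr -!expRD subrr expR0 -splitr.
have e3 : expR ((x%:R - 1) / 2 * t) = expR (x%:R * t / 2) / expR (t / 2).
  by rewrite -expRN -expRD; congr expR; lra.
have := geoE x t; rewrite e1 e2 => E.
have p := expR_gt0 (t / 2).
rewrite e3.
have -> : geo x t * ((expR (t / 2) - expR (- (t / 2))) / (2 * (t / 2))) =
   (geo x t * (expR (t / 2) * (expR (t / 2) - expR (- (t / 2))))) / (expR (t / 2) * (2 * (t / 2))).
  by field; rewrite t0 gt_eqF.
rewrite E; field.
by rewrite x0' t0 gt_eqF.
Qed.

(** By [geo_sinhc], the powers of S(t/2) cancel because contents and hooks are equally many, and the
    exponential factors combine to e^(mean t), since each [x]_t contributes (x - 1)/2 to the
    mean. *)
Lemma centered_mgf t :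
  M t * expR (- (fine ('E_(uniform_ssyt R lam m)[X])%E * t)) * \prod_(x <- h) sinhc (x%:R * t / 2)
  = \prod_(x <- a) sinhc (x%:R * t / 2) :> R.
Proof.
have [c [C [C0 [E K]]]] := ln_ssyt_mgf.
have G (s : seq nat) u : size s = sumn lam -> (\prod_(x <- s) geo x u) * sinhc (u / 2) ^+ sumn lam =
    (\prod_(x <- s) x%:R) * expR ((\sum_(x <- s) (x%:R - 1) / 2) * u) *
    \prod_(x <- s) sinhc (x%:R * u / 2) :> R.
  move=> <-; rewrite -(count_predT s) -iter_mulr_1 -big_const_seq -big_split/=.
  rewrite (eq_bigr _ (fun x _ => geo_sinhc x u)) !big_split/=; congr (_ * _ * _).
  by rewrite mulr_suml expR_sum.
have K1 : fine ('E_(uniform_ssyt R lam m)[X])%E =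
    c + (\sum_(x <- a) (x%:R - 1) / 2 - \sum_(x <- h) (x%:R - 1) / 2).
  have Q (s : seq nat) : (forall x, x \in s -> (0 < x)%N) ->
      \sum_(x <- s) derive1n 1 (fun t => ln (geo x t)) 0 = \sum_(x <- s) (x%:R - 1) / 2 :> R.
    move=> s0; rewrite big_seq [RHS]big_seq; apply: eq_bigr => x xs.
    by rewrite derive1n_ln_geo ?s0//= bernR1; field.
  by rewrite expectation_cumulant// K/= !Q.
have Nat0 (s : seq nat) : (forall x, x \in s -> (0 < x)%N) -> \prod_(x <- s) x%:R != 0 :> R.
  by move=> s0; rewrite prodf_seq_neq0; apply/allP => x /s0 x0; rewrite /= pnatr_eq0 -lt0n.
have Sh u : \prod_(x <- h) sinhc (x%:R * u / 2) != 0 :> R.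
  by rewrite prodf_seq_neq0; apply/allP => x _; rewrite gt_eqF// sinhc_gt0.
have S0 u : sinhc (u / 2) ^+ sumn lam != 0 :> R by rewrite expf_neq0// gt_eqF// sinhc_gt0.
have Ga := G a _ (size_contents sz); have Gh := G h _ (size_hooks lamP sz).
have Full u : M u * (\prod_(x <- h) x%:R * expR ((\sum_(x <- h) (x%:R - 1) / 2) * u) *
     \prod_(x <- h) sinhc (x%:R * u / 2)) = C * expR (c * u) *
     (\prod_(x <- a) x%:R * expR ((\sum_(x <- a) (x%:R - 1) / 2) * u) *
     \prod_(x <- a) sinhc (x%:R * u / 2)).
  by rewrite -Ga -Gh !mulrA E.
(* At t = 0 every other factor is 1, which determines C. *)
have Const : \prod_(x <- h) x%:R = C * \prod_(x <- a) x%:R :> R.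
  have := Full 0; rewrite ssyt_mgf0// mul1r !mulr0 expR0 !mulr1.
  have one (s : seq nat) : \prod_(x <- s) sinhc (x%:R * 0 / 2) = 1 :> R.
    by rewrite big1// => x _; rewrite mulr0 mul0r sinhc0.
  by rewrite !one !mulr1.
have := Full t; rewrite Const => F.
have Ca0 : C * \prod_(x <- a) x%:R != 0 by apply: mulf_neq0; [rewrite gt_eqF|exact: Nat0].
apply: (mulfI Ca0); rewrite K1.
set Ah := \sum_(x <- h) _ in F *; set Aa := \sum_(x <- a) _ in F *.
set Sa := \prod_(x <- a) sinhc _ in F *; set Shh := \prod_(x <- h) sinhc _ in F *.
set Pa := \prod_(x <- a) _ in F *.
have eh0 : expR (Ah * t) != 0 by rewrite gt_eqF// expR_gt0.
apply: (mulfI eh0).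
transitivity (M t * (C * Pa * expR (Ah * t) * Shh) * expR (- ((c + (Aa - Ah)) * t))); first by ring.
rewrite F -[RHS]mulr1 -expR0.
have -> : 0 = c * t + Aa * t - Ah * t - (c + (Aa - Ah)) * t by ring.
rewrite !expRD [expR (- (Ah * t))]expRN; field; exact: eh0.
Qed.

End log_mgf.

(** * Curtiss' theorem *)

Section exponential_moments.
Context (R : realType).
Implicit Types (P : probability R R) (f g : R -> R).

Definition has_mgf P := forall t : R, P.-integrable [set: R] (fun x => (expR (t * x))%:E).

Definition exp_bounded f := exists C K : R, forall x, `|f x| <= C * expR (K * `|x|).

Lemma expR_abs_le (K x : R) : expR (K * `|x|) <= expR (K * x) + expR (- K * x).
Proof.
case: (ger0P x) => _; first by rewrite lerDl expR_ge0.
by rewrite mulrN mulNr lerDr expR_ge0.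
Qed.

Lemma measurable_expR_abs (K : R) : measurable_fun [set: R] (fun x => expR (K * `|x|)).
Proof.
by apply: measurableT_comp => //; apply: measurable_funM.
Qed.

Lemma integrable_expR_abs P (K : R) : has_mgf P ->
  P.-integrable [set: R] (EFin \o (fun x => expR (K * `|x|))).
Proof.
move=> hP; apply: (le_integrable measurableT _ _ (integrableD measurableT (hP K) (hP (- K)))).
  by apply/measurable_EFinP; exact: measurable_expR_abs.
move=> x _ /=; rewrite lee_fin [X in X <= _]ger0_norm ?expR_ge0//.
exact: le_trans (expR_abs_le K x) (ler_norm _).
Qed.

Lemma integrable_exp_bounded P f : has_mgf P -> measurable_fun [set: R] f ->
  exp_bounded f -> P.-integrable [set: R] (EFin \o f).
Proof.
move=> hP mf [C [K fC]].
have := integrableZl measurableT C (integrable_expR_abs K hP).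
apply: le_integrable => //; first exact/measurable_EFinP.
by move=> x _ /=; rewrite lee_fin; apply: le_trans (fC x) _; exact: ler_norm.
Qed.

Lemma Rintegral_exp_bound P f g (C K : R) : has_mgf P ->
  measurable_fun [set: R] f -> measurable_fun [set: R] g ->
  exp_bounded f -> exp_bounded g ->
  (forall x, `|f x - g x| <= C * expR (K * `|x|)) ->
  `|(\int[P]_x f x) - \int[P]_x g x| <= C * \int[P]_x expR (K * `|x|).
Proof.
move=> hP mf mg bf bg fg.
have If := integrable_exp_bounded hP mf bf; have Ig := integrable_exp_bounded hP mg bg.
have IE := integrable_expR_abs K hP.
have IB : P.-integrable [set: R] (EFin \o (fun x => f x - g x)).
  by apply: (@eq_integrable _ _ _ P setT measurableT _ _ _ (integrableB measurableT If Ig)).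
have IC : P.-integrable [set: R] (EFin \o (fun x => C * expR (K * `|x|))).
  by apply: (@eq_integrable _ _ _ P setT measurableT _ _ _ (integrableZl measurableT C IE)).
rewrite -RintegralB// -RintegralZl//.
apply: (le_trans (le_normr_Rintegral measurableT IB)).
apply: le_Rintegral => //=.
exact: (integrable_norm IB).
Qed.

End exponential_moments.

Section exp_inequalities.
Context (R : realType).
Implicit Types (x y : R).

(** Only 1 + y <= e^y is used: at -y it gives e^y - 1 <= y e^y, hence e^y - 1 - y <= y (e^y - 1).
    The sign of y decides how this is bounded by y^2 times an exponential. *)
Lemma expR_taylor1 y : `|expR y - 1 - y| <= y ^+ 2 * expR `|y|.
Proof.
have h0 := expR_ge1Dx y; have h1 := expR_ge1Dx (- y).
have p := expR_gt0 y.
have h2 : expR y - 1 <= y * expR y.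
  have : (1 - y) * expR y <= expR (- y) * expR y by rewrite ler_wpM2r// ltW.
  by rewrite -expRD addNr expR0; lra.
rewrite ger0_norm; last by lra.
case: (ger0P y) => y0.
  have : y * (expR y - 1) <= y * (y * expR y) by rewrite ler_wpM2l.
  by lra.
have : expR y - 1 - y <= y ^+ 2.
  have : - y * (- (expR y - 1)) <= - y * - y by rewrite ler_wpM2l//; lra.
  have : expR y - 1 <= y * expR y by [].
  by rewrite expr2; lra.
move=> /le_trans; apply; rewrite ler_peMr ?sqr_ge0//.
by rewrite -expR0 ler_expR; lra.
Qed.

Lemma normrX_le_expR x k : `|x| ^+ k <= k`!%:R * expR `|x|.
Proof.
have := @exp_coeff_ge0 R `|x|; case: k => [|k].
  by rewrite expr0 mul1r -expR0 ler_expR.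
have k0 : 0 < k.+1`!%:R :> R by rewrite ltr0n fact_gt0.
rewrite mulrC -ler_pdivrMr// => _.
by apply: le_trans (expR_ge1Dxn k (normr_ge0 x)); rewrite lerDr.
Qed.

(** For k >= n, |y|^k <= 2^(-n) (2|y|)^k. Doubling the exponent makes the tail small uniformly in y,
    relative to the weight e^(2|y|). *)
Lemma exp_series_tail (c : nat -> R) (l y : R) n : (forall k, `|c k| <= 1) ->
  series (fun k => c k * y ^+ k / k`!%:R) @ \oo --> l ->
  `|series (fun k => c k * y ^+ k / k`!%:R) n - l| <= 2^-1 ^+ n * expR (2 * `|y|).
Proof.
set u := fun k => _; move=> c1 ul.
have bnd N : (n <= N)%N -> `|series u N - series u n| <= 2^-1 ^+ n * expR (2 * `|y|).
  move=> nN; rewrite sub_series_geq//.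
  apply: (@le_trans _ _ (\sum_(n <= k < N) 2^-1 ^+ n * exp_coeff (2 * `|y|) k)).
    apply: le_trans (ler_norm_sum _ _ _) _; rewrite big_nat_cond [leRHS]big_nat_cond.
    apply: ler_sum => k /andP[/andP[nk _] _]; rewrite /u /exp_coeff/= !normrM normfV.
    rewrite [leRHS]mulrA (ger0_norm (ler0n _ _)) ler_wpM2r ?invr_ge0//.
    rewrite exprMn [leRHS]mulrA normrX ler_wpM2r ?exprn_ge0//.
    apply: le_trans (c1 k) _; rewrite -(subnKC nk) exprD mulrA -exprMn mulVf// expr1n mul1r.
    by rewrite exprn_ege1// ler1n.
  rewrite -mulr_sumr ler_wpM2l ?exprn_ge0 ?invr_ge0//.
  apply: (@le_trans _ _ (series (exp_coeff (2 * `|y|)) N)).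
    rewrite /series/= (big_cat_nat (leq0n n) nN)//= lerDr sumr_ge0// => i _.
    by rewrite exp_coeff_ge0// mulr_ge0.
  apply: nondecreasing_cvgn_le; last exact: is_cvg_series_exp_coeff.
  by apply: nondecreasing_series => i _ _; rewrite exp_coeff_ge0// mulr_ge0.
rewrite distrC.
have : `|series u N - series u n| @[N --> \oo] --> `|l - series u n|.
  by apply: cvg_norm; apply: cvgB => //; exact: cvg_cst.
move/cvgr_to_le; apply; near=> N; apply: bnd; near: N; exact: nbhs_infty_ge.
Unshelve. all: by end_near. Qed.

End exp_inequalities.

Section exp_bounded_closure.
Context (R : realType).
Implicit Types (f g : R -> R).

Lemma exp_boundedM f g : exp_bounded f -> exp_bounded g -> exp_bounded (fun x => f x * g x).
Proof.
move=> [C [K fC]] [D [L gD]]; exists (C * D), (K + L) => x.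
by rewrite normrM mulrDl expRD mulrACA ler_pM.
Qed.

Lemma exp_bounded_id : exp_bounded (@id R).
Proof.
exists 1, 1 => x; rewrite !mul1r.
by have := normrX_le_expR x 1; rewrite expr1 mul1r.
Qed.

Lemma exp_bounded_exp (t : R) : exp_bounded (fun x => expR (t * x)).
Proof.
exists 1, `|t| => x; rewrite mul1r ger0_norm ?expR_ge0// ler_expR -normrM.
exact: ler_norm.
Qed.

Lemma exp_bounded_bounded f C : (forall x, `|f x| <= C) -> exp_bounded f.
Proof. by move=> fC; exists C, 0 => x; rewrite mul0r expR0 mulr1. Qed.

Lemma exp_boundedX k (t : R) : exp_bounded (fun x => x ^+ k * expR (t * x)).
Proof.
elim: k => [|k IH].
  by under eq_fun do rewrite expr0 mul1r; exact: exp_bounded_exp.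
under eq_fun do rewrite exprS -mulrA.
exact: exp_boundedM exp_bounded_id IH.
Qed.

End exp_bounded_closure.

(** * Test functions whose integrals converge *)

Section convergence_of_integrals.
Context (R : realType) (mu : nat -> probability R R) (nu : probability R R).
Hypothesis mgf_mu : forall N, has_mgf (mu N).
Hypothesis mgf_nu : has_mgf nu.
Hypothesis mgf_cvg : forall t : R,
  \int[mu N]_x expR (t * x) @[N --> \oo] --> \int[nu]_x expR (t * x).
Implicit Types (f g : R -> R).

(** Measurability and the exponential bound are part of the notion because they give integrability
    under all the measures, which linearity and approximation use. *)
Definition converging f :=
  [/\ measurable_fun [set: R] f, exp_bounded f &
      \int[mu N]_x f x @[N --> \oo] --> \int[nu]_x f x].

Let integrable_expR (P : probability R R) (t : R) : has_mgf P ->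
  P.-integrable [set: R] (EFin \o (fun x => expR (t * x))).
Proof. by move=> /(_ t). Qed.

Lemma Rintegral_expR_abs_le (P : probability R R) (K : R) : has_mgf P ->
  \int[P]_x expR (K * `|x|) <= \int[P]_x expR (K * x) + \int[P]_x expR (- K * x).
Proof.
move=> hP.
rewrite -RintegralD//; [|exact: integrable_expR|exact: integrable_expR].
apply: le_Rintegral => //=; first exact: integrable_expR_abs.
  exact: (integrableD measurableT (hP K) (hP (- K))).
by move=> x _; exact: expR_abs_le.
Qed.

Lemma Rintegral_expR_abs_bound (K : R) : exists2 b : R, 0 < b &
  \int[nu]_x expR (K * `|x|) <= b /\ \forall N \near \oo, \int[mu N]_x expR (K * `|x|) <= b.
Proof.
pose s := \int[nu]_x expR (K * x) + \int[nu]_x expR (- K * x).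
have s0 : 0 <= s by rewrite addr_ge0// Rintegral_ge0// => x _; exact: expR_ge0.
exists (s + 1); first by rewrite ltr_wpDl.
split; first by rewrite (le_trans (Rintegral_expR_abs_le K mgf_nu))// lerDl.
have h : (\int[mu N]_x expR (K * x) + \int[mu N]_x expR (- K * x)) @[N --> \oo] --> s.
  by apply: cvgD; exact: mgf_cvg.
near=> N; apply: (le_trans (Rintegral_expR_abs_le K (mgf_mu N))).
by apply/ltW; near: N; apply: (cvgr_lt s) => //; rewrite ltrDl.
Unshelve. all: by end_near. Qed.

(** The integrals of e^(K|x|) are bounded by one b for [nu] and for all large N, so an approximation
    in this weight changes all the integrals by little. Each of the three differences is given
    e/3. *)
Lemma converging_approx f (K : R) : measurable_fun [set: R] f -> exp_bounded f ->
  (forall e, 0 < e -> exists2 g, converging g &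
     forall x, `|f x - g x| <= e * expR (K * `|x|)) ->
  converging f.
Proof.
move=> mf bf fg; split => //; apply/cvgrPdist_le => e e0.
have [b b0 [nub mub]] := Rintegral_expR_abs_bound K.
have eb : 0 < e / 3 / b by rewrite !divr_gt0.
have [g [mg bg cg] fge] := fg _ eb.
have D P : has_mgf P -> \int[P]_x expR (K * `|x|) <= b ->
    `|\int[P]_x f x - \int[P]_x g x| <= e / 3.
  move=> hP Pb; apply: (le_trans (Rintegral_exp_bound hP mf mg bf bg fge)).
  by apply: le_trans (ler_wpM2l (ltW eb) Pb) _; rewrite divfK ?gt_eqF.
near=> N.
have h1 := D _ mgf_nu nub.
have h2 : `|\int[mu N]_x f x - \int[mu N]_x g x| <= e / 3.
  by apply: D => //; near: N.
have h3 : `|\int[nu]_x g x - \int[mu N]_x g x| <= e / 3.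
  by near: N; move/cvgrPdist_le : cg; apply; rewrite divr_gt0.
have -> : \int[nu]_x f x - \int[mu N]_x f x =
    (\int[nu]_x f x - \int[nu]_x g x) + (\int[nu]_x g x - \int[mu N]_x g x)
    - (\int[mu N]_x f x - \int[mu N]_x g x) by lra.
apply: (le_trans (ler_normB _ _)); apply: le_trans (lerD (ler_normD _ _) (lexx _)) _.
by lra.
Unshelve. all: by end_near. Qed.

Lemma exp_boundedD f g : exp_bounded f -> exp_bounded g -> exp_bounded (fun x => f x + g x).
Proof.
move=> [C [K fC]] [D [L gD]]; exists (C + D), (Num.max K L) => x.
have C0 : 0 <= C by have := le_trans (normr_ge0 _) (fC 0); rewrite pmulr_lge0// expR_gt0.
have D0 : 0 <= D by have := le_trans (normr_ge0 _) (gD 0); rewrite pmulr_lge0// expR_gt0.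
apply: le_trans (ler_normD _ _) _; rewrite mulrDl lerD//.
- by apply: le_trans (fC x) _; rewrite ler_wpM2l// ler_expR ler_wpM2r// le_max lexx.
- by apply: le_trans (gD x) _; rewrite ler_wpM2l// ler_expR ler_wpM2r// le_max lexx orbT.
Qed.

Lemma convergingD f g : converging f -> converging g -> converging (fun x => f x + g x).
Proof.
move=> [mf bf cf] [mg bg cg]; split.
- exact: measurable_funD.
- exact: exp_boundedD.
have E P : has_mgf P -> \int[P]_x (f x + g x) = \int[P]_x f x + \int[P]_x g x.
  by move=> hP; rewrite RintegralD//; exact: integrable_exp_bounded.
rewrite E//; under eq_fun do rewrite E//.
exact: cvgD.
Qed.

Lemma convergingZ (c : R) f : converging f -> converging (fun x => c * f x).
Proof.
move=> [mf bf cf]; split.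
- exact: measurable_funM.
- by apply: exp_boundedM => //; exact: (@exp_bounded_bounded _ (fun=> c) `|c|).
have E P : has_mgf P -> \int[P]_x (c * f x) = c * \int[P]_x f x.
  by move=> hP; rewrite RintegralZl//; exact: integrable_exp_bounded.
rewrite E//; under eq_fun do rewrite E//.
by apply: cvgM => //; exact: cvg_cst.
Qed.

Lemma converging_exp (t : R) : converging (fun x => expR (t * x)).
Proof.
split; last exact: mgf_cvg.
- by apply: measurableT_comp => //; exact: measurable_funM.
- exact: exp_bounded_exp.
Qed.

(* The derivative in [t] is approximated by difference quotients. *)
Lemma converging_monomial_exp k (t : R) : converging (fun x => x ^+ k * expR (t * x)).
Proof.
elim: k t => [|k IH] t.
  by under eq_fun do rewrite expr0 mul1r; exact: converging_exp.
apply: (@converging_approx _ (`|t| + 2)).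
- apply: measurable_funM; first exact: exprn_measurable.
  by apply: measurableT_comp => //; exact: measurable_funM.
- exact: exp_boundedX.
move=> e e0.
(* The error of the quotient is at most h |x|^(k+2) e^(tx + |hx|). Here h <= 1 bounds the exponent
   by (|t| + 1)|x|, and |x|^(k+2) <= (k+2)! e^|x| accounts for the factorial. *)
pose h := Num.min 1 (e / k.+2`!%:R).
have f0 : 0 < k.+2`!%:R :> R by rewrite ltr0n fact_gt0.
have h0 : 0 < h by rewrite lt_min ltr01 divr_gt0.
have h1 : h <= 1 by rewrite ge_min lexx.
have he : h * k.+2`!%:R <= e by rewrite -ler_pdivlMr// ge_min lexx orbT.
exists (fun x => h^-1 * (x ^+ k * expR ((t + h) * x)) + (- h^-1) * (x ^+ k * expR (t * x))).
  by apply: convergingD; apply: convergingZ; exact: IH.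
move=> x.
have -> : x ^+ k.+1 * expR (t * x) -
    (h^-1 * (x ^+ k * expR ((t + h) * x)) + - h^-1 * (x ^+ k * expR (t * x)))
    = - (x ^+ k * expR (t * x) * h^-1 * (expR (h * x) - 1 - h * x)).
  by rewrite [(t + h) * x]mulrDl expRD exprS; field; rewrite gt_eqF.
rewrite normrN !normrM normfV (gtr0_norm h0) (ger0_norm (expR_ge0 _)) normrX.
apply: (@le_trans _ _ (`|x| ^+ k * expR (t * x) * h^-1 * ((h * x) ^+ 2 * expR `|h * x|))).
  apply: ler_wpM2l; last exact: expR_taylor1.
  by rewrite !mulr_ge0 ?exprn_ge0 ?expR_ge0// invr_ge0 ltW.
have -> : `|x| ^+ k * expR (t * x) * h^-1 * ((h * x) ^+ 2 * expR `|h * x|) =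
    h * `|x| ^+ k.+2 * expR (t * x + `|h * x|).
  rewrite expRD exprMn -[x ^+ 2]real_normK ?num_real// !exprS; field; rewrite gt_eqF//.
apply: (@le_trans _ _ (h * (k.+2`!%:R * expR `|x|) * expR ((`|t| + 1) * `|x|))).
  apply: ler_pM; [by rewrite mulr_ge0 ?exprn_ge0 ?(ltW h0)|exact: expR_ge0| |].
    by apply: ler_wpM2l; [exact: ltW|exact: normrX_le_expR].
  rewrite ler_expR mulrDl lerD// -?normrM ?ler_norm// normrM mul1r gtr0_norm//.
  by rewrite ler_piMl.
rewrite mulrA -[X in X <= _]mulrA -expRD.
have -> : `|x| + (`|t| + 1) * `|x| = (`|t| + 2) * `|x| by ring.
by rewrite ler_wpM2r// expR_ge0.
Qed.

Lemma converging_sum n (f : nat -> R -> R) : (forall k, converging (f k)) ->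
  converging (fun x => \sum_(0 <= k < n) f k x).
Proof.
move=> cf; elim: n => [|n IH].
  under eq_fun do rewrite big_geq//.
  have -> : (fun=> 0) = (fun x : R => 0 * expR (0 * x)) by apply/funext => x; rewrite mul0r.
  exact/convergingZ/converging_exp.
by under eq_fun do rewrite big_nat_recr//=; exact: convergingD.
Qed.

(** The partial sums are combinations of monomials, taken as x^k e^(0 x), and approximate f in the
    weight e^(2|s||x|) by [exp_series_tail]. *)
Lemma converging_entire (c : nat -> R) f (s : R) : (forall k, `|c k| <= 1) ->
  measurable_fun [set: R] f -> exp_bounded f ->
  (forall x, series (fun k => c k * (s * x) ^+ k / k`!%:R) @ \oo --> f x) ->
  converging f.
Proof.
move=> c1 mf bf cf; apply: (@converging_approx _ (2 * `|s|)) => // e e0.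
have [n ne] : exists n, 2^-1 ^+ n <= e.
  have := @cvg_geometric R 1 2^-1.
  rewrite normfV gtr0_norm// invf_lt1// ltr1n.
  move=> /(_ isT)/cvgrPdist_le/(_ _ e0)[n _ /(_ n (leqnn n))].
  by rewrite /geometric/= sub0r normrN mul1r ger0_norm ?exprn_ge0 ?invr_ge0//; exists n.
exists (fun x => series (fun k => c k * (s * x) ^+ k / k`!%:R) n).
  have -> : (fun x => series (fun k => c k * (s * x) ^+ k / k`!%:R) n) =
      (fun x => \sum_(0 <= k < n) (c k * s ^+ k / k`!%:R) * (x ^+ k * expR (0 * x))).
    apply/funext => x; rewrite /series/=; apply: eq_bigr => k _.
    by rewrite mul0r expR0 mulr1 exprMn; ring.
  by apply: converging_sum => k; apply: convergingZ; exact: converging_monomial_exp.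
move=> x; rewrite distrC; apply: le_trans (exp_series_tail n c1 (cf x)) _.
by rewrite normrM mulrA ler_wpM2r// expR_ge0.
Qed.

Lemma converging_cos (s : R) : converging (fun x => cos (s * x)).
Proof.
apply: (@converging_entire (fun k => (~~ odd k)%:R * (-1) ^+ k./2) _ s).
- move=> k; rewrite normrM normr_sign mulr1.
  by case: odd; rewrite ?normr0 ?normr1.
- apply: measurableT_comp; last exact: measurable_funM.
  by apply: continuous_measurable_fun; exact: continuous_cos.
- by apply: (@exp_bounded_bounded _ _ 1) => x; exact: cos_max.
- move=> x; have := @is_cvg_series_cos_coeff R (s * x).
  by rewrite [X in X -> _](_ : _ = (series (cos_coeff (s * x)) @ \oo --> cos (s * x))) //
    cosE /pseries -cos_coeffE.
Qed.

Lemma converging_sin (s : R) : converging (fun x => sin (s * x)).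
Proof.
apply: (@converging_entire (fun k => (odd k)%:R * (-1) ^+ k.-1./2) _ s).
- move=> k; rewrite normrM normr_sign mulr1.
  by case: odd; rewrite ?normr0 ?normr1.
- apply: measurableT_comp; last exact: measurable_funM.
  by apply: continuous_measurable_fun; exact: continuous_sin.
- by apply: (@exp_bounded_bounded _ _ 1) => x; exact: sin_max.
- move=> x; have := @is_cvg_series_sin_coeff R (s * x).
  by rewrite [X in X -> _](_ : _ = (series (sin_coeff (s * x)) @ \oo --> sin (s * x))) //
    sinE /pseries -sin_coeffE.
Qed.

(** The linear span of cosines and sines. Unlike [converging], it is visibly stable under
    multiplication by sin(bx), through the product-to-sum formulas; this reaches polynomials in
    sin(bx). *)
Inductive trigonometric : (R -> R) -> Prop :=
| trig_cos s : trigonometric (fun x => cos (s * x))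
| trig_sin s : trigonometric (fun x => sin (s * x))
| trigD f g : trigonometric f -> trigonometric g -> trigonometric (fun x => f x + g x)
| trigZ c f : trigonometric f -> trigonometric (fun x => c * f x).

Lemma converging_trig f : trigonometric f -> converging f.
Proof.
elim=> {f} [s|s|f g _ cf _ cg|c f _ cf].
- exact: converging_cos.
- exact: converging_sin.
- exact: convergingD.
- exact: convergingZ.
Qed.

Lemma trigM_sin f b : trigonometric f -> trigonometric (fun x => f x * sin (b * x)).
Proof.
elim=> {f} [s|s|f g _ tf _ tg|c f _ tf].
- have -> : (fun x => cos (s * x) * sin (b * x)) =
      (fun x => 2^-1 * (sin ((s + b) * x) + -1 * sin ((s - b) * x))).
    by apply/funext => x; rewrite !mulrDl [- b * x]mulNr sinD sinB; field.
  by do ?[apply: trigZ|apply: trigD]; exact: trig_sin.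
- have -> : (fun x => sin (s * x) * sin (b * x)) =
      (fun x => 2^-1 * (cos ((s - b) * x) + -1 * cos ((s + b) * x))).
    by apply/funext => x; rewrite !mulrDl [- b * x]mulNr cosB cosD; field.
  by do ?[apply: trigZ|apply: trigD]; exact: trig_cos.
- by under eq_fun do rewrite mulrDl; exact: trigD.
- by under eq_fun do rewrite -mulrA; exact: trigZ.
Qed.

Lemma converging_poly_sin (p : {poly R}) b : converging (fun x => p.[sin (b * x)]).
Proof.
apply: converging_trig; elim/poly_ind: p => [|p c IH].
  have -> : (fun x => (0 : {poly R}).[sin (b * x)]) = (fun x => 0 * cos (0 * x)).
    by apply/funext => x; rewrite horner0 mul0r.
  exact/trigZ/trig_cos.
have -> : (fun x => (p * 'X + c%:P).[sin (b * x)]) =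
    (fun x => p.[sin (b * x)] * sin (b * x) + c * cos (0 * x)).
  by apply/funext => x; rewrite hornerMXaddC mul0r cos0 mulr1.
by apply: trigD; [exact: trigM_sin|exact/trigZ/trig_cos].
Qed.

End convergence_of_integrals.

(** * Polynomials close to a step on [0, 1] *)

Section step_polynomial.
Context (R : realType).

Lemma bernoulli_ineq (v : R) N : 0 <= v <= 1 -> 1 - N%:R * v <= (1 - v) ^+ N.
Proof.
move=> /andP[v0 v1]; elim: N => [|N IH]; first by rewrite mul0r subr0 expr0.
rewrite exprS; apply: (@le_trans _ _ ((1 - v) * (1 - N%:R * v))).
  by rewrite -natr1; have := mulr_ge0 (mulr_ge0 (ler0n R N) v0) v0; lra.
by rewrite ler_wpM2l// subr_ge0.
Qed.

(** As 1 + Nv <= (1 + v)^N, the product is at most (1 - v^2)^N. *)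
Lemma bernoulli_ineq_inv (v : R) N : 0 <= v <= 1 -> (1 - v) ^+ N * (1 + N%:R * v) <= 1.
Proof.
move=> /andP[v0 v1].
have h : 1 + N%:R * v <= (1 + v) ^+ N.
  elim: N => [|N IH]; first by rewrite mul0r addr0 expr0.
  rewrite exprS; apply: (@le_trans _ _ ((1 + v) * (1 + N%:R * v))).
    by rewrite -natr1; have := mulr_ge0 (mulr_ge0 (ler0n R N) v0) v0; lra.
  by rewrite ler_wpM2l// addr_ge0.
apply: le_trans (ler_wpM2l _ h) _; first by rewrite exprn_ge0// subr_ge0.
rewrite -exprMn exprn_ile1//.
  by apply: mulr_ge0; lra.
by have := mulr_ge0 v0 v0; lra.
Qed.

Lemma expr_small (x e : R) : 0 <= x < 1 -> 0 < e -> \forall n \near \oo, x ^+ n <= e.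
Proof.
move=> /andP[x0 x1] e0; have := @cvg_geometric R 1 x; rewrite ger0_norm// => /(_ x1).
move=> /cvgrPdist_le/(_ _ e0); apply: filterS => n.
by rewrite /geometric/= sub0r normrN mul1r ger0_norm ?exprn_ge0.
Qed.

(* [(1 - u^n)^N] with [N] close to [b^n], [1/c2 < b < 1/c1], tends to 1 for
   [u <= c1] and to 0 for [u >= c2]. *)
Lemma step_poly (c1 c2 e : R) : 0 < c1 -> c1 < c2 -> c2 <= 1 -> 0 < e ->
  exists p : {poly R}, forall u, 0 <= u <= 1 ->
    [/\ 0 <= p.[u] <= 1, u <= c1 -> 1 - e <= p.[u] & c2 <= u -> p.[u] <= e].
Proof.
move=> c10 c12 c21 e0.
have s0 : 0 < c1 + c2 by lra.
pose b := 2 / (c1 + c2).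
have b0 : 0 < b by rewrite divr_gt0.
have b1 : 1 <= b by rewrite ler_pdivlMr//; lra.
have bc1 : b * c1 < 1 by rewrite mulrAC ltr_pdivrMr//; lra.
have bc2 : 1 < b * c2 by rewrite mulrAC ltr_pdivlMr//; lra.
have bc20 : 0 < b * c2 by lra.
near \oo => n.
have n1 : (b * c1) ^+ n <= e / 2.
  near: n; apply: expr_small; last by rewrite divr_gt0.
  by rewrite bc1 andbT mulr_ge0 ?(ltW b0) ?(ltW c10).
have n2 : (b * c2)^-1 ^+ n <= e.
  by near: n; apply: expr_small => //; rewrite invr_ge0 ltW//= invf_lt1.
(* N lies between b^n and 2 b^n. So N u^n is at most 2 (b c1)^n <= e for u <= c1, and at least (b
   c2)^n >= 1/e for u >= c2; the two Bernoulli inequalities conclude. *)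
pose N := (Num.truncn (b ^+ n)).+1.
have bn1 : 1 <= b ^+ n by rewrite exprn_ege1.
have Nlo : b ^+ n <= N%:R by apply/ltW; rewrite truncnS_gt.
have Nhi : N%:R <= 2 * b ^+ n.
  have : (Num.truncn (b ^+ n))%:R <= b ^+ n by rewrite truncn_le// ltW// exprn_gt0.
  by rewrite /N -natr1; lra.
exists ((1 - 'X^n) ^+ N) => u /andP[u0 u1].
rewrite horner_exp hornerD hornerN hornerC hornerXn.
have un : 0 <= u ^+ n <= 1 by rewrite exprn_ge0//= exprn_ile1.
have un1 : 0 <= 1 - u ^+ n <= 1 by lra.
split.
- by move/andP: un1 => [? ?]; rewrite exprn_ge0//= exprn_ile1.
- move=> uc1; apply: le_trans (bernoulli_ineq N un).
  have : N%:R * u ^+ n <= 2 * b ^+ n * c1 ^+ n.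
    apply: ler_pM => //; first by case/andP: un.
    by rewrite lerXn2r// nnegrE// ltW.
  by rewrite -mulrA -exprMn; lra.
- move=> uc2.
  have hN : (b * c2) ^+ n <= N%:R * u ^+ n.
    rewrite exprMn; apply: ler_pM => //; rewrite ?exprn_ge0 ?(ltW b0)//; first by lra.
    by rewrite lerXn2r// nnegrE; lra.
  have p0 : 0 < (b * c2) ^+ n by rewrite exprn_gt0.
  have p1 : 0 < 1 + N%:R * u ^+ n by lra.
  have := bernoulli_ineq_inv N un; rewrite -ler_pdivlMr// => /le_trans; apply.
  apply: le_trans n2; rewrite exprVn div1r lef_pV2 ?posrE//; lra.
Unshelve. all: by end_near. Qed.

End step_polynomial.

(** * From step functions to distribution functions *)

Section mgf_continuity.
Context (R : realType) (mu : nat -> probability R R) (nu : probability R R).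
Hypothesis mgf_mu : forall N, has_mgf (mu N).
Hypothesis mgf_nu : has_mgf nu.
Hypothesis mgf_cvg : forall t : R,
  \int[mu N]_x expR (t * x) @[N --> \oo] --> \int[nu]_x expR (t * x).

(** With bA = pi/2, the map u = (1 + sin(by))/2 increases on [-A, A] and takes values in [0, 1]
    everywhere. A step polynomial in u between u x and u x' is a step in y on [-A, A]; beyond, only
    0 <= G <= 1 is left. *)
Lemma converging_step (x x' A e : R) : - A < x -> x < x' -> x' < A -> 0 < e ->
  exists2 G, converging mu nu G & forall y,
    [/\ 0 <= G y <= 1, - A <= y <= x -> 1 - e <= G y & x' <= y <= A -> G y <= e].
Proof.
move=> Ax xx' x'A e0.
have A0 : 0 < A by lra.
have pi0 := pi_gt0 R.
pose b := pi / 2 / A.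
have b0 : 0 < b by rewrite !divr_gt0.
have bA : b * A = pi / 2 by rewrite /b divfK// gt_eqF.
have itv y : - A <= y <= A -> b * y \in `[- (pi / 2), pi / 2].
  move=> /andP[h1 h2]; rewrite in_itv/= -bA -mulrN.
  by rewrite !ler_wpM2l// ltW.
have mono y z : - A <= y -> y <= z -> z <= A -> sin (b * y) <= sin (b * z).
  move=> Ay; rewrite le_eqVlt => /orP[/eqP ->//|yz] zA.
  by apply/ltW; rewrite ltr_sin ?itv// ?ltr_pM2l//; apply/andP; split; lra.
pose u y := 2^-1 * (1 + sin (b * y)).
have u01 y : 0 <= u y <= 1.
  by have := sin_geN1 (b * y); have := sin_le1 (b * y); rewrite /u; lra.
have ux : 0 < u x.
  have : sin (b * - A) < sin (b * x).
    by rewrite ltr_sin ?itv ?ltr_pM2l//; apply/andP; split; lra.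
  by rewrite mulrN bA sinN sin_pihalf /u; lra.
have uxx' : u x < u x'.
  have : sin (b * x) < sin (b * x').
    by rewrite ltr_sin ?itv ?ltr_pM2l//; apply/andP; split; lra.
  by rewrite /u; lra.
have [p pP] := step_poly ux uxx' (proj2 (andP (u01 x'))) e0.
exists (fun y => (p \Po (2^-1%:P * (1 + 'X))).[sin (b * y)]).
  exact: converging_poly_sin.
move=> y; rewrite horner_comp hornerM hornerD !hornerC hornerX -/(u y).
have [p1 p2 p3] := pP _ (u01 y); split => //.
- by move=> /andP[h1 h2]; apply: p2; rewrite /u ler_wpM2l// lerD2l mono//; lra.
- by move=> /andP[h1 h2]; apply: p3; rewrite /u ler_wpM2l// lerD2l mono//; lra.
Qed.

Let F (P : probability R R) (x : R) : R := fine (P `]-oo, x]%classic).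

Let F_indic (P : probability R R) (x : R) : F P x = \int[P]_y \1_(`]-oo, x]%classic : set R) y.
Proof. by rewrite /F /Rintegral integral_indic//= setIT. Qed.

Lemma cdf_step_le (P : probability R R) (x x' A e : R) (G : R -> R) : has_mgf P -> 0 <= e ->
  measurable_fun [set: R] G -> x <= x' ->
  (forall y, [/\ 0 <= G y <= 1, - A <= y <= x -> 1 - e <= G y & x' <= y <= A -> G y <= e]) ->
  let r := e + expR (- A) * \int[P]_y expR (1 * `|y|) in
  F P x <= \int[P]_y G y + r /\ \int[P]_y G y <= F P x' + r.
Proof.
move=> hP e0 mG xx' GP r.
have IG : P.-integrable [set: R] (EFin \o G).
  apply: (integrable_exp_bounded hP mG); apply: (@exp_bounded_bounded _ _ 1) => y.
  by have [/andP[g0 g1] _ _] := GP y; rewrite ger0_norm.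
have I1 z : P.-integrable [set: R] (EFin \o (\1_(`]-oo, z]%classic : set R) : R -> R)).
  apply: (integrable_exp_bounded hP) => //.
  apply: (@exp_bounded_bounded _ _ 1) => y; rewrite indicE.
  by case: (_ \in _); rewrite ?normr0 ?normr1.
(* E dominates the error of G as a step: it is at least e everywhere and at least 1 when |y| > A. *)
pose E (y : R) := e + expR (- A) * expR (1 * `|y|).
have IE : P.-integrable [set: R] (EFin \o (fun y => expR (- A) * expR (1 * `|y|))).
  apply: (@eq_integrable _ _ _ P setT measurableT _ _ _
    (integrableZl measurableT (expR (- A)) (integrable_expR_abs 1 hP))) => //.
have Ie : P.-integrable [set: R] (EFin \o (fun _ : R => e)).
  apply: (integrable_exp_bounded hP) => //.
  by apply: (@exp_bounded_bounded _ _ e) => y; rewrite ger0_norm.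
have IEE : P.-integrable [set: R] (EFin \o E).
  exact: (@eq_integrable _ _ _ P setT measurableT _ _ _ (integrableD measurableT Ie IE)).
have rE : \int[P]_y E y = r.
  have PT : fine (P [set: R]) = 1 by rewrite probability_setT.
  rewrite /E RintegralD// Rintegral_cst//= PT mulr1 RintegralZl//.
  exact: integrable_expR_abs.
have E0 (y : R) : 0 <= E y by rewrite addr_ge0// mulr_ge0 ?expR_ge0.
have EA (y : R) : A < `|y| -> 1 <= E y.
  move=> yA; apply: (@le_trans _ _ (expR (- A + 1 * `|y|))).
    by rewrite -[leLHS]expR0 ler_expR mul1r; lra.
  by rewrite expRD /E lerDr.
have Ee (y : R) : e <= E y by rewrite lerDl mulr_ge0 ?expR_ge0.
rewrite !F_indic -rE -!RintegralD//; split; apply: le_Rintegral => //=.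
- exact: (@eq_integrable _ _ _ P setT measurableT _ _ _ (integrableD measurableT IG IEE)).
- move=> y _; have [/andP[g0 g1] g2 g3] := GP y; have Ey0 := E0 y; have Eye := Ee y.
  rewrite indicE; case: (boolP (_ \in _)) => [|_]; last by rewrite addr_ge0.
  rewrite inE/= in_itv/= (_ : true%:R = 1)// => yx.
  case: (lerP (- A) y) => yA; first by have := g2 (introT andP (conj yA yx)); lra.
  have yA' : A < `|y| by rewrite -normrN (lt_le_trans _ (ler_norm _))//; lra.
  by have := EA y yA'; lra.
- exact: (@eq_integrable _ _ _ P setT measurableT _ _ _ (integrableD measurableT (I1 x') IEE)).
- move=> y _; have [/andP[g0 g1] g2 g3] := GP y; have Ey0 := E0 y; have Eye := Ee y.
  rewrite indicE; case: (boolP (_ \in _)) => [_|]; first by rewrite (_ : true%:R = 1)//; lra.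
  rewrite notin_setE/= in_itv/= add0r => /negP; rewrite -ltNge => yx.
  case: (lerP y A) => yA; first by have := g3 (introT andP (conj (ltW yx) yA)); lra.
  by have := EA y (lt_le_trans yA (ler_norm y)); lra.
Qed.

End mgf_continuity.

Section mgf_cdf.
Context (R : realType) (mu : nat -> probability R R) (nu : probability R R).
Hypothesis mgf_mu : forall N, has_mgf (mu N).
Hypothesis mgf_nu : has_mgf nu.
Hypothesis mgf_cvg : forall t : R,
  \int[mu N]_x expR (t * x) @[N --> \oo] --> \int[nu]_x expR (t * x).

Let F (P : probability R R) (x : R) : R := fine (P `]-oo, x]%classic).

Let cdf_compare (x x' e : R) : x < x' -> 0 < e -> \forall N \near \oo,
  F (mu N) x <= F nu x' + e /\ F nu x <= F (mu N) x' + e.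
Proof.
move=> xx' e0.
have [b b0 [nub mub]] := Rintegral_expR_abs_bound mgf_mu mgf_nu mgf_cvg 1.
(* A exceeds |x| and |x'|, and e^A >= 1 + A >= 8b/e makes the tail e^(-A) b at most e/8. *)
pose A := `|x| + `|x'| + 1 + 8 * b / e.
have be : 0 < 8 * b / e by rewrite divr_gt0// mulr_gt0.
have Ax : - A < x by have := ler_norm (- x); rewrite normrN /A; have := normr_ge0 x'; lra.
have xA : x' < A by have := ler_norm x'; rewrite /A; have := normr_ge0 x; lra.
have e8 : 0 < e / 8 by rewrite divr_gt0.
have [G cG GP] := converging_step mgf_mu mgf_nu mgf_cvg Ax xx' xA e8.
have [mG _ cvgG] := cG.
have tail (I : R) : I <= b -> e / 8 + expR (- A) * I <= e / 4.
  move=> Ib; have h : expR (- A) * b <= e / 8.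
    rewrite expRN mulrC ler_pdivrMr ?expR_gt0// mulrC -ler_pdivrMr//.
    apply: le_trans (expR_ge1Dx A).
    rewrite invf_div mulrCA mulrA /A; have := normr_ge0 x; have := normr_ge0 x'; lra.
  by have := ler_wpM2l (expR_ge0 (- A)) Ib; lra.
have [n1 n2] := cdf_step_le mgf_nu (ltW e8) mG (ltW xx') GP.
have tn := tail _ nub.
near=> N.
have [m1 m2] := cdf_step_le (mgf_mu N) (ltW e8) mG (ltW xx') GP.
have tm : e / 8 + expR (- A) * \int[mu N]_y expR (1 * `|y|) <= e / 4.
  by apply: tail; near: N.
have : `|\int[nu]_x G x - \int[mu N]_x G x| <= e / 4.
  by near: N; move/cvgrPdist_le : cvgG; apply; rewrite divr_gt0.
rewrite ler_norml => /andP[d1 d2].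
by rewrite /F; split; lra.
Unshelve. all: by end_near. Qed.

(** At a continuity point x, the distribution functions of [mu N] at x are compared with that of
    [nu] at x + d/2 and x - d/2, where it differs little from its value at x. *)
Lemma cvg_in_distribution_mgf : cvg_in_distribution mu nu.
Proof.
move=> x cx.
have fin (P : probability R R) y : P `]-oo, y]%classic = (F P y)%:E.
  by rewrite /F fineK// fin_num_measure.
have cF : F nu y @[y --> x] --> F nu x.
  by apply: fine_cvg; rewrite -fin; exact: cx.
under eq_fun do rewrite fin.
rewrite fin; apply: cvg_EFin; first by near=> N.
apply/cvgrPdist_le => /= e e0.
have e2 : 0 < e / 2 by rewrite divr_gt0.
have /nbhs_ballP[d d0 dF] : \forall y \near x, `|F nu x - F nu y| <= e / 2.
  by move/cvgrPdist_le : cF; apply.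
have d2 : 0 < d / 2 by rewrite divr_gt0.
have h1 : `|F nu x - F nu (x + d / 2)| <= e / 2.
  by apply: dF; rewrite /ball/= opprD addNKr normrN gtr0_norm// ltr_pdivrMr// ltr_pMr// ltr1n.
have h2 : `|F nu x - F nu (x - d / 2)| <= e / 2.
  by apply: dF; rewrite /ball/= opprB addrC subrK gtr0_norm// ltr_pdivrMr// ltr_pMr// ltr1n.
have lt1 : x < x + d / 2 by rewrite ltrDl.
have lt2 : x - d / 2 < x by rewrite ltrBlDr ltrDl.
have k1 := cdf_compare lt1 e2; have k2 := cdf_compare lt2 e2.
near=> N.
have [a1 _] : F (mu N) x <= F nu (x + d / 2) + e / 2 /\
    F nu x <= F (mu N) (x + d / 2) + e / 2 by near: N.
have [_ a2] : F (mu N) (x - d / 2) <= F nu x + e / 2 /\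
    F nu (x - d / 2) <= F (mu N) x + e / 2 by near: N.
move: h1 h2; rewrite !ler_norml => /andP[b1 b2] /andP[b3 b4].
by apply/andP; split; lra.
Unshelve. all: by end_near. Qed.

End mgf_cdf.

(** * Irwin-Hall sums *)

Section uniform.
Context (R : realType).
Local Notation T := (measurableTypeR R).
Local Notation U := (uniform_prob (@ltr01 R)).

Lemma smooth_FTC (F : R -> R) : smooth F ->
  (\int[lebesgue_measure]_(x in `[0%R, 1%R]) (derive1 F x)%:E = (F 1)%:E - (F 0)%:E)%E.
Proof.
move=> sF; have cF := smooth_continuous sF.
apply: continuous_FTC2 => //.
- by apply: continuous_subspaceT; exact/smooth_continuous/smooth_derive1.
- split.
  + by move=> x _; case: (smooth_is_derive sF x).
  + exact/cvg_at_right_filter/cF.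
  + exact/cvg_at_left_filter/cF.
Qed.

Lemma integral_uniform_smooth (F : R -> R) : smooth F -> (forall x, 0 <= derive1 F x) ->
  (\int[U]_x (derive1 F x)%:E = (F 1 - F 0)%:E)%E.
Proof.
move=> sF F0.
have mF : measurable_fun [set: T] (fun x : T => (derive1 F x)%:E).
  apply/measurable_EFinP; apply: continuous_measurable_fun.
  exact/smooth_continuous/smooth_derive1.
by rewrite (integral_uniform _ mF) ?smooth_FTC// ?subr0 ?invr1 ?mul1e.
Qed.

Lemma integral_uniform_expR (t : R) :
  (\int[U]_x (expR (t * x))%:E = (expR (t / 2) * sinhc (t / 2))%:E)%E.
Proof.
have [->|t0] := eqVneq t 0.
  under eq_integral do rewrite mul0r expR0.
  by rewrite integral_cst//= probability_setT mul0r expR0 /sinhc eqxx mul1r mule1.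
pose F (x : R) := t^-1 * expR (t * x).
have sF : smooth F by apply: smoothM; [exact: smooth_cst|exact: smooth_expR].
have dF : derive1 F = (fun x => expR (t * x)).
  rewrite /F -derive1n1 derive1n_smoothZ; last exact: smooth_expR.
  by apply/funext => x; rewrite derive1n_expR expr1 mulrA mulVf// mul1r.
have := integral_uniform_smooth sF; rewrite dF => ->; last by move=> x; exact: expR_ge0.
rewrite /F /sinhc mulf_eq0 invr_eq0 pnatr_eq0 (negbTE t0)/= mulr0 mulr1 expR0; congr (_%:E).
have e : expR t = expR (t / 2) * expR (t / 2) by rewrite -expRD -splitr.
rewrite e expRN; field.
by rewrite t0 gt_eqF ?expR_gt0.
Qed.

(** In the induction of [irwin_hall_sqr], c is the variance already collected from the other
    coordinates. [F] is a primitive of the integrand. *)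
Lemma integral_uniform_sqr (a c : R) : 0 <= c ->
  (\int[U]_x (c + (a - x) ^+ 2)%:E = (c + 12^-1 + (a - 2^-1) ^+ 2)%:E)%E.
Proof.
move=> c0.
pose F (x : R) := (c + a ^+ 2) * x + (- a) * (x * x) + 3^-1 * (x * (x * x)).
have sid := @smooth_id R.
have s2 : smooth (fun x : R => x * x) by exact: smoothM.
have s3 : smooth (fun x : R => x * (x * x)) by exact: smoothM.
have sF : smooth F.
  by do ?apply: smoothD; apply: smoothM => //; exact: smooth_cst.
have did : derive1 (@id R) = fun=> 1 by apply/funext => x; rewrite derive1_id.
have dZ (k : R) f : smooth f -> derive1 (fun x => k * f x) = (fun x => k * derive1 f x).
  by move=> sf; rewrite -derive1n1 derive1n_smoothZ.
have d2 : derive1 (fun x : R => x * x) = (fun x => x + x).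
  by rewrite (derive1_smoothM sid sid) did; apply/funext => x; rewrite mul1r mulr1.
have d3 : derive1 (fun x : R => x * (x * x)) = (fun x => x * x + x * (x + x)).
  by rewrite (derive1_smoothM sid s2) did d2; apply/funext => x; rewrite mul1r.
have dF : derive1 F = (fun x => c + (a - x) ^+ 2).
  rewrite /F derive1_smoothD; last 2 first.
  - by do ?apply: smoothD; apply: smoothM => //; exact: smooth_cst.
  - by apply: smoothM => //; exact: smooth_cst.
  rewrite derive1_smoothD; last 2 first.
  - by apply: smoothM => //; exact: smooth_cst.
  - by apply: smoothM => //; exact: smooth_cst.
  rewrite (dZ _ id)// (dZ _ (fun x => x * x))// (dZ _ (fun x => x * (x * x)))// did d2 d3.
  by apply/funext => x; field.
have := integral_uniform_smooth sF; rewrite dF => ->; last by move=> x; rewrite addr_ge0// sqr_ge0.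
by rewrite /F; congr (_%:E); field.
Qed.

End uniform.

Section irwin_hall_moments.
Context (R : realType).
Local Notation T := (measurableTypeR R).
Local Notation U := (uniform_prob (@ltr01 R)).
Local Open Scope ereal_scope.

Lemma ge0_integral_uniform_tuple n (f : n.+1.-tuple T -> \bar R) :
  measurable_fun setT f -> (forall t, 0 <= f t) ->
  \int[uniform_tuple R n.+1]_t f t =
  \int[U]_x \int[uniform_tuple R n]_t f (Defs.cons_tuple (x, t)).
Proof.
move=> mf f0; rewrite [LHS]ge0_integral_distribution//.
have mg : measurable_fun setT (f \o @Defs.cons_tuple R n).
  by apply: measurableT_comp => //; exact: measurable_cons.
rewrite fubini_tonelli1 => [||[x t]]; [exact: erefl|exact: mg|exact: f0].
Qed.

Lemma irwin_hall_cons n (x : T) (t : n.-tuple T) :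
  irwin_hall_sum (Defs.cons_tuple (x, t)) = (x + irwin_hall_sum t)%R :> R.
Proof.
rewrite /irwin_hall_sum big_ord_recl; congr (_ + _)%R.
by apply: eq_bigr => i _; rewrite !(tnth_nth 0%R).
Qed.

Lemma integral_uniform_tuple0 (f : 0.-tuple T -> \bar R) : measurable_fun setT f ->
  \int[uniform_tuple R 0]_t f t = f [tuple].
Proof. by move=> mf; rewrite integral_dirac// diracE in_setT mul1e. Qed.

Lemma measurable_irwin_hall n : measurable_fun [set: n.-tuple T] (@irwin_hall_sum R n).
Proof. exact: measurable_funPT. Qed.

Lemma irwin_hall_mgf n (t : R) :
  \int[uniform_tuple R n]_s (expR (t * irwin_hall_sum s))%:E =
  ((expR (t / 2) * sinhc (t / 2)) ^+ n)%:E.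
Proof.
have mS k : measurable_fun [set: k.-tuple T] (fun s => (expR (t * irwin_hall_sum s))%:E).
  by apply/measurable_EFinP; apply: measurableT_comp => //; apply: measurable_funM.
elim: n => [|n IH].
  by rewrite integral_uniform_tuple0// /irwin_hall_sum big_ord0 mulr0 expR0 expr0.
rewrite ge0_integral_uniform_tuple//.
have inner (x : T) :
    \int[uniform_tuple R n]_s (expR (t * irwin_hall_sum (Defs.cons_tuple (x, s))))%:E =
    (expR (t * x))%:E * ((expR (t / 2) * sinhc (t / 2)) ^+ n)%:E.
  under eq_integral do rewrite irwin_hall_cons mulrDr expRD EFinM.
  by rewrite ge0_integralZl ?IH//; exact: mS.
under eq_integral do rewrite inner.
have c0 : (0 <= (expR (t / 2) * sinhc (t / 2)) ^+ n)%R.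
  by rewrite exprn_ge0// mulr_ge0 ?expR_ge0// ltW// sinhc_gt0.
rewrite ge0_integralZr ?lee_fin//.
  by rewrite integral_uniform_expR -EFinM exprS.
by apply/measurable_EFinP; apply: measurableT_comp => //; exact: measurable_funM.
Qed.

(* The cases [c = 0] and [c = 1] together determine the expectation. *)
Lemma irwin_hall_sqr n (c : R) :
  \int[uniform_tuple R n]_s ((irwin_hall_sum s - c) ^+ 2)%:E =
  (n%:R / 12 + (c - n%:R / 2) ^+ 2)%:E.
Proof.
have mS k d : measurable_fun [set: k.-tuple T] (fun s => ((irwin_hall_sum s - d) ^+ 2)%:E).
  by apply/measurable_EFinP; apply: measurable_funX; apply: measurable_funB.
elim: n c => [|n IH] c.
  rewrite integral_uniform_tuple0// /irwin_hall_sum big_ord0; congr (_%:E).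
  by rewrite !mul0r subr0 sub0r sqrrN add0r.
rewrite ge0_integral_uniform_tuple//; last by move=> s; rewrite lee_fin sqr_ge0.
transitivity (\int[U]_x (n%:R / 12 + ((c - n%:R / 2) - x) ^+ 2)%:E).
  apply: eq_integral => x _; rewrite -[(c - _ - x)%R]addrAC -IH.
  by apply: eq_integral => s _; rewrite irwin_hall_cons; congr (_ ^+ 2)%:E; ring.
rewrite integral_uniform_sqr ?divr_ge0//; congr (_%:E).
by rewrite -natr1; field.
Qed.

Lemma integrable_irwin_hall n :
  (uniform_tuple R n).-integrable [set: n.-tuple T] (EFin \o @irwin_hall_sum R n) /\
  (uniform_tuple R n).-integrable [set: n.-tuple T]
    (EFin \o (fun s => (irwin_hall_sum s - 0) ^+ 2)%R).
Proof.
have mS := @measurable_irwin_hall n.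
have I2 (c : R) : (uniform_tuple R n).-integrable [set: n.-tuple T]
    (EFin \o (fun s => (irwin_hall_sum s - c) ^+ 2)%R).
  apply/integrableP; split.
    by apply/measurable_EFinP; apply: measurable_funX; exact: measurable_funB.
  under eq_integral do rewrite /= ger0_norm ?sqr_ge0//.
  by rewrite irwin_hall_sqr ltry.
split => //.
have I1 : (uniform_tuple R n).-integrable [set: n.-tuple T]
    (EFin \o (fun s => (irwin_hall_sum s - 0) ^+ 2 + 1)%R).
  have Ic : (uniform_tuple R n).-integrable [set: n.-tuple T] (EFin \o (fun=> 1%R)).
    exact: finite_measure_integrable_cst.
  exact: (@eq_integrable _ _ _ _ setT measurableT _ _ _ (integrableD measurableT (I2 0%R) Ic)).
apply: (le_integrable measurableT _ _ I1); first exact/measurable_EFinP.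
move=> s _ /=; rewrite lee_fin subr0 [leRHS]ger0_norm ?addr_ge0 ?sqr_ge0//.
(* (|x| - 1)^2 >= 0 gives |x| <= x^2 + 1, so integrability of the square implies that of the sum. *)
have := sqr_ge0 (`|irwin_hall_sum s| - 1)%R.
have := real_normK (num_real (irwin_hall_sum s)).
move: (irwin_hall_sum s) => x; move: `|x|%R => y; nra.
Qed.

Lemma irwin_hall_expectation n : 'E_(uniform_tuple R n)[irwin_hall R n] = (n%:R / 2)%:E.
Proof.
have [I1 I2] := integrable_irwin_hall n.
have P1 : (fine (uniform_tuple R n setT) = 1)%R by rewrite probability_setT.
have I3 : (uniform_tuple R n).-integrable [set: n.-tuple T]
    (EFin \o (fun s => (-2) * irwin_hall_sum s)%R).
  exact: (@eq_integrable _ _ _ _ setT measurableT _ _ _ (integrableZl measurableT (-2)%R I1)).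
have I0 : (uniform_tuple R n).-integrable [set: n.-tuple T] (EFin \o (fun=> 1%R)).
  exact: finite_measure_integrable_cst.
have I4 : (uniform_tuple R n).-integrable [set: n.-tuple T]
    (EFin \o (fun s => (-2) * irwin_hall_sum s + 1)%R).
  exact: (@eq_integrable _ _ _ _ setT measurableT _ _ _ (integrableD measurableT I3 I0)).
have e : (\int[uniform_tuple R n]_s ((irwin_hall_sum s - 1) ^+ 2) =
    \int[uniform_tuple R n]_s ((irwin_hall_sum s - 0) ^+ 2)
    + ((- 2) * \int[uniform_tuple R n]_s (irwin_hall_sum s) + 1))%R.
  have Ic : (\int[uniform_tuple R n]_(s in [set: n.-tuple T]) 1%R = 1)%R.
    by rewrite Rintegral_cst//= mul1r.
  rewrite -RintegralZl// -[X in (_ + (_ + X))%R]Ic.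
  rewrite -RintegralD// -RintegralD//.
  by apply: eq_Rintegral => s _; ring.
have v (c : R) : (\int[uniform_tuple R n]_s ((irwin_hall_sum s - c) ^+ 2) =
    n%:R / 12 + (c - n%:R / 2) ^+ 2)%R.
  by rewrite /Rintegral irwin_hall_sqr.
have E1 : (\int[uniform_tuple R n]_s (irwin_hall_sum s) = n%:R / 2)%R.
  by move: e; rewrite !v; lra.
rewrite unlock -E1 /Rintegral fineK//.
exact: (integrable_fin_num measurableT I1).
Qed.

Lemma irwin_hall_variance n : 'V_(uniform_tuple R n)[irwin_hall R n] = (n%:R / 12)%:E.
Proof.
rewrite /variance covariance.unlock irwin_hall_expectation {1}unlock.
have := irwin_hall_sqr n (n%:R / 2); rewrite subrr expr0n addr0 => <-.
by [].
Qed.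

End irwin_hall_moments.

(** * The Gaussian moment generating function *)

Section density.
Import HBNNSimple.
Context d (T : measurableType d) (R : realType).
Variables (mu nu : {measure set T -> \bar R}) (g : T -> R).
Hypotheses (mg : measurable_fun [set: T] g) (g0 : forall x, 0 <= g x).
Hypothesis nuE : forall A, measurable A -> (nu A = \int[mu]_(x in A) (g x)%:E)%E.
Local Open Scope ereal_scope.

Let integral_density_nnsfun (h : {nnsfun T >-> R}) :
  \int[nu]_x (h x)%:E = \int[mu]_x (h x * g x)%:E.
Proof.
rewrite integralT_nnsfun sintegralE.
have E x : (h x * g x)%:E = \sum_(y \in range h) (y * \1_(h @^-1` [set y]) x * g x)%:E.
  rewrite fsumEFin// {1}fimfunE mulrC fsbig_distrr//=; congr (_%:E).
  by apply: eq_fsbigr => y _; rewrite mulrC.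
under [RHS]eq_integral do rewrite E.
have mI y : measurable (h @^-1` [set y]).
  by rewrite -[X in measurable X]setTI; exact: measurable_funP.
rewrite ge0_integral_fsum//; last 2 first.
- move=> y; apply/measurable_EFinP; apply: measurable_funM => //.
  by apply: measurable_funM.
- move=> y x _; rewrite EFinM mule_ge0 ?lee_fin//.
  by have := nnfun_muleindic_ge0 h y x; rewrite -EFinM lee_fin.
apply: eq_fsbigr => y; rewrite inE => -[z _ zy].
have y0 : (0 <= y)%R by rewrite -zy.
rewrite nuE//.
under [RHS]eq_integral do rewrite -mulrA EFinM.
rewrite ge0_integralZl//; last 2 first.
- by apply/measurable_EFinP; apply: measurable_funM.
- by move=> x _; rewrite lee_fin mulr_ge0.
congr (_ * _); rewrite [LHS]integral_mkcond; apply: eq_integral => x _.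
by rewrite patchE indicE; case: (_ \in _); rewrite ?mul1r ?mul0r.
Qed.

(** Simple functions are handled by linearity, the general case by monotone convergence along an
    increasing simple approximation of f. *)
Lemma ge0_integral_density (f : T -> R) : measurable_fun [set: T] f -> (forall x, 0 <= f x)%R ->
  \int[nu]_x (f x)%:E = \int[mu]_x (f x * g x)%:E.
Proof.
move=> mf f0.
have mf' : measurable_fun [set: T] (EFin \o f) by exact/measurable_EFinP.
pose f_ := nnsfun_approx measurableT mf'.
have f0' x : [set: T] x -> 0 <= (EFin \o f) x by rewrite /= lee_fin.
transitivity (limn (fun n => \int[nu]_x (f_ n x)%:E)).
  rewrite -monotone_convergence//=.
  - apply: eq_integral => x _; apply/esym/cvg_lim => //=.
    exact: cvg_nnsfun_approx.
  - by move=> n; exact/measurable_EFinP/measurable_funTS.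
  - by move=> n x _; rewrite lee_fin.
  - by move=> x _ a b ab; rewrite lee_fin; exact/lefP/nd_nnsfun_approx.
under eq_fun do rewrite integral_density_nnsfun.
rewrite -monotone_convergence//=.
- apply: eq_integral => x _; apply/cvg_lim => //=.
  under eq_fun do rewrite EFinM.
  by rewrite EFinM; apply: cvgeZr => //; exact: cvg_nnsfun_approx.
- by move=> n; apply/measurable_EFinP; apply: measurable_funM.
- by move=> n x _; rewrite lee_fin mulr_ge0.
- by move=> x _ a b ab; rewrite lee_fin ler_wpM2r//; exact/lefP/nd_nnsfun_approx.
Qed.

End density.

Lemma standard_normal_mgf (R : realType) (t : R) :
  (\int[standard_normal R]_x (expR (t * x))%:E = (expR (t ^+ 2 / 2))%:E)%E.
Proof.
rewrite [LHS]ge0_integral_distribution//; last exact: measurable_expR_scale.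
rewrite (@ge0_integral_density _ _ _ lebesgue_measure (normal_prob 0 1) (normal_pdf 0 1))//=.
(* Completing the square: e^(tx) times the standard density is e^(t^2/2) times the density with mean
   t. *)
- transitivity (\int[lebesgue_measure]_x ((expR (t ^+ 2 / 2))%:E * (normal_pdf t 1 x)%:E))%E.
    apply: eq_integral => x _; rewrite -EFinM !normal_pdfE// /normal_fun mulrCA [in RHS]mulrCA.
    by congr (_ * _)%:E; rewrite -!expRD; rewrite /real_id/=; congr expR; field.
  have mpdf : measurable_fun [set: measurableTypeR R] (fun x => (normal_pdf t 1 x)%:E).
    by apply/measurable_EFinP; exact: measurable_normal_pdf.
  have e0 : (0 <= (expR (t ^+ 2 / 2))%:E)%E by rewrite lee_fin expR_ge0.
  have pdf0 : forall y, [set: measurableTypeR R] y -> (0 <= (normal_pdf t 1 y)%:E)%E.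
    by move=> y _; rewrite lee_fin normal_pdf_ge0.
  have h := @ge0_integralZl _ _ R lebesgue_measure setT measurableT _ mpdf _ pdf0 e0.
  rewrite h.
  by rewrite integral_normal_pdf mule1.
- exact: measurable_normal_pdf.
- by move=> x; exact: normal_pdf_ge0.
- by apply: measurableT_comp => //; exact: measurable_funM.
Qed.

(** * Standardized moment generating functions *)

Section mgf_formulas.
Context (R : realType).

Lemma has_mgf_integral (P : probability R R) (M : R -> R) :
  (forall t, (\int[P]_x (expR (t * x))%:E = (M t)%:E)%E) ->
  has_mgf P /\ forall t, \int[P]_x expR (t * x) = M t.
Proof.
move=> PM; split => t; last by rewrite /Rintegral PM.
apply/integrableP; split; first exact: measurable_expR_scale.
under eq_integral do rewrite gee0_abs ?lee_fin ?expR_ge0//.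
by rewrite PM ltry.
Qed.

Lemma cvg_in_distribution_mgfE (mu : nat -> probability R R) (nu : probability R R)
    (Mn : nat -> R -> R) (M : R -> R) :
  (forall N t, (\int[mu N]_x (expR (t * x))%:E = (Mn N t)%:E)%E) ->
  (forall t, (\int[nu]_x (expR (t * x))%:E = (M t)%:E)%E) ->
  (forall t, Mn N t @[N --> \oo] --> M t) -> cvg_in_distribution mu nu.
Proof.
move=> muM nuM cM.
have [hnu nuE] := has_mgf_integral nuM.
apply: cvg_in_distribution_mgf => // [N|t].
  by have [] := has_mgf_integral (muM N).
rewrite nuE; under eq_fun => N do rewrite (proj2 (has_mgf_integral (muM N)) t).
exact: cM.
Qed.

Lemma sinhc_neq0 (y : R) : sinhc y != 0.
Proof. by rewrite gt_eqF// sinhc_gt0. Qed.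

(** Centering cancels the factor e^(tau/2) of each uniform variable. For M = 0 the variance
    vanishes, the division by 0 makes [tau] zero, and both sides are 1. *)
Lemma law_irwin_hall_mgf M (t : R) :
  (\int[law (standardize (irwin_hall R M))]_x (expR (t * x))%:E =
   (sinhc (t / Num.sqrt (M%:R / 12) / 2) ^+ M)%:E)%E.
Proof.
rewrite ge0_integral_distribution//=; last exact: measurable_expR_scale.
rewrite /standardize_fun irwin_hall_expectation irwin_hall_variance /=.
set tau := t / Num.sqrt (M%:R / 12).
transitivity (\int[uniform_tuple R M]_s ((expR (- (M%:R / 2 * tau)))%:E *
    (expR (tau * irwin_hall_sum s))%:E))%E.
  apply: eq_integral => s _; rewrite -EFinM -expRD; congr (expR _)%:E.
  by rewrite /tau; ring.
rewrite ge0_integralZl//.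
- rewrite irwin_hall_mgf -EFinM exprMn -expRM_natl; congr (_%:E); rewrite [LHS]mulrA -expRD.
  by rewrite (_ : _ + _ = 0) ?expR0 ?mul1r//; field.
- apply/measurable_EFinP; apply: measurableT_comp => //; apply: measurable_funM => //.
Qed.

Lemma sinhc_le_scale (x y tau : R) : 0 <= x -> x <= y ->
  sinhc (x * tau / 2) <= sinhc (y * tau / 2).
Proof.
move=> x0 xy; apply: sinhc_le; rewrite -!mulrA ![(_ * (tau / 2)) ^+ 2]exprMn.
by rewrite ler_wpM2r ?sqr_ge0// lerXn2r// nnegrE (le_trans x0).
Qed.

End mgf_formulas.

(** * Bounds from the sizes of contents and hooks *)

Section bounds.
Context (R : realType) (lam : seq nat) (m : nat).
Hypothesis lamP : is_partition lam.
Hypothesis sz : (size lam <= m)%N.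
Local Notation a := (contents lam m).
Local Notation h := (hooks lam m).
Local Notation X := (rank_ssyt R lam m).
Local Notation n := (sumn lam).

Definition std_mgf (tau : R) : R :=
  \prod_(x <- a) sinhc (x%:R * tau / 2) / \prod_(x <- h) sinhc (x%:R * tau / 2).

Lemma law_rank_mgf (t : R) :
  (\int[law (standardize X)]_x (expR (t * x))%:E =
   (std_mgf (t / Num.sqrt (cumulant X 2)))%:E)%E.
Proof.
rewrite mgf_standardize// -variance_cumulant//; set s := Num.sqrt _; set e := fine _.
congr (_%:E); rewrite /std_mgf -(centered_mgf lamP sz) mulfK; last first.
  by rewrite prodf_seq_neq0; apply/allP => x _; exact: sinhc_neq0.
rewrite /ssyt_mgf [RHS]mulrAC [in RHS]mulr_suml;  congr (_ / _); apply: eq_bigr => x _.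
by rewrite -expRD -/e; congr expR; ring.
Qed.

Lemma variance_sum :
  cumulant X 2 = (\sum_(x <- a) x%:R ^+ 2 - \sum_(x <- h) x%:R ^+ 2) / 12 :> R.
Proof. by rewrite cumulant_rank// bernR2; field. Qed.

Lemma prod_seq_ge (s : seq nat) (f : nat -> R) (c : R) : 0 <= c ->
  (forall x, x \in s -> c <= f x) -> c ^+ size s <= \prod_(x <- s) f x.
Proof.
move=> c0; elim: s => [|x s IH] cf; first by rewrite big_nil expr0.
rewrite big_cons exprS ler_pM ?exprn_ge0//; first by rewrite cf ?mem_head.
by apply: IH => y ys; rewrite cf// inE ys orbT.
Qed.

Lemma prod_seq_le (s : seq nat) (f : nat -> R) (c : R) :
  (forall x, x \in s -> 0 <= f x <= c) -> \prod_(x <- s) f x <= c ^+ size s.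
Proof.
elim: s => [|x s IH] cf; first by rewrite big_nil expr0.
rewrite big_cons exprS; have /andP[f0 fc] := cf x (mem_head _ _).
rewrite ler_pM//.
  rewrite big_seq; apply: prodr_ge0 => y ys.
  by have := cf y; rewrite inE ys orbT => /(_ isT)/andP[].
by apply: IH => y ys; rewrite cf// inE ys orbT.
Qed.

Lemma sum_seq_le (s : seq nat) (f : nat -> R) (c : R) :
  (forall x, x \in s -> f x <= c) -> \sum_(x <- s) f x <= (size s)%:R * c.
Proof.
move=> fc; rewrite -sum1_size natr_sum mulr_suml big_seq [leRHS]big_seq.
by apply: ler_sum => x /fc; rewrite mul1r.
Qed.

Lemma sum_seq_ge (s : seq nat) (f : nat -> R) (c : R) :
  (forall x, x \in s -> c <= f x) -> (size s)%:R * c <= \sum_(x <- s) f x.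
Proof.
move=> fc; rewrite -sum1_size natr_sum mulr_suml big_seq [leRHS]big_seq.
by apply: ler_sum => x /fc; rewrite mul1r.
Qed.

Lemma contents_le x : x \in a -> x%:R <= m%:R + n%:R :> R.
Proof. by move=> /(contents_bounds lamP sz)[_ _]; rewrite -natrD ler_nat. Qed.

Lemma contents_ge x : x \in a -> m%:R - n%:R <= x%:R :> R.
Proof. by move=> /(contents_bounds lamP sz)[_ h1 _]; rewrite lerBlDr -natrD ler_nat. Qed.

Lemma hooks_le x : x \in h -> x%:R <= n%:R :> R.
Proof. by move=> /(hooks_bounds lamP sz)/andP[_]; rewrite ler_nat. Qed.

Hypothesis nm : n%:R <= m%:R :> R.

Lemma std_mgf_le tau : std_mgf tau <= sinhc ((m%:R + n%:R) * tau / 2) ^+ n.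
Proof.
apply: (@le_trans _ _ (\prod_(x <- a) sinhc (x%:R * tau / 2))).
  apply: ler_piMr; first by apply: prodr_ge0 => x _; exact/ltW/sinhc_gt0.
  have h0 : 0 < \prod_(x <- h) sinhc (x%:R * tau / 2) by apply: prodr_gt0 => x _; exact: sinhc_gt0.
  rewrite invf_le1//.
  have := @prod_seq_ge h (fun x => sinhc (x%:R * tau / 2)) 1 ler01 (fun x _ => sinhc_ge1 _).
  by rewrite expr1n.
rewrite -[X in _ <= _ ^+ X](size_contents sz); apply: prod_seq_le => x xa.
by rewrite (ltW (sinhc_gt0 _))/=; apply: sinhc_le_scale => //; exact: contents_le.
Qed.

Lemma std_mgf_ge tau :
  (sinhc ((m%:R - n%:R) * tau / 2) / sinhc (n%:R * tau / 2)) ^+ n <= std_mgf tau.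
Proof.
rewrite expr_div_n; apply: ler_pM.
- by rewrite exprn_ge0// ltW// sinhc_gt0.
- by rewrite invr_ge0 exprn_ge0// ltW// sinhc_gt0.
- rewrite -[X in _ ^+ X <= _](size_contents sz); apply: prod_seq_ge; first exact/ltW/sinhc_gt0.
  by move=> x xa; apply: sinhc_le_scale; [rewrite subr_ge0|exact: contents_ge].
- rewrite lef_pV2 ?posrE ?exprn_gt0 ?sinhc_gt0//; last first.
    by apply: prodr_gt0 => x _; exact: sinhc_gt0.
  rewrite -[X in _ <= _ ^+ X](size_hooks lamP sz); apply: prod_seq_le => x xh.
  by rewrite (ltW (sinhc_gt0 _))/=; apply: sinhc_le_scale => //; exact: hooks_le.
Qed.

Lemma variance_le : cumulant X 2 <= n%:R * (m%:R + n%:R) ^+ 2 / 12 :> R.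
Proof.
rewrite variance_sum ler_pM2r ?invr_gt0//.
rewrite lerBlDr (@le_trans _ _ (n%:R * (m%:R + n%:R) ^+ 2))//; last first.
  by rewrite lerDl sumr_ge0// => x _; rewrite sqr_ge0.
rewrite -[X in X%:R * _](size_contents sz); apply: sum_seq_le => x xa.
rewrite lerXn2r ?nnegrE ?addr_ge0//; exact: contents_le.
Qed.

Lemma variance_ge : n%:R * ((m%:R - n%:R) ^+ 2 - n%:R ^+ 2) / 12 <= cumulant X 2 :> R.
Proof.
rewrite variance_sum ler_pM2r ?invr_gt0// mulrBr lerB//.
- rewrite -[X in X%:R * _](size_contents sz); apply: sum_seq_ge => x xa.
  rewrite lerXn2r ?nnegrE ?subr_ge0//; exact: contents_ge.
- rewrite -[X in X%:R * _](size_hooks lamP sz); apply: sum_seq_le => x xh.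
  rewrite lerXn2r ?nnegrE//; exact: hooks_le.
Qed.

Lemma exprB_le (x y B : R) d : 0 <= x <= B -> 0 <= y <= B ->
  `|x ^+ d - y ^+ d| <= d%:R * B ^+ d.-1 * `|x - y|.
Proof.
move=> /andP[x0 xB] /andP[y0 yB]; have B0 := le_trans x0 xB.
case: d => [|d]; first by rewrite !expr0 subrr normr0 !mul0r.
rewrite subrXX normrM mulrC ler_wpM2r//.
apply: le_trans (ler_norm_sum _ _ _) _.
apply: (@le_trans _ _ (\sum_(i < d.+1) B ^+ d)); last by rewrite sumr_const card_ord mulr_natl.
apply: ler_sum => i _; rewrite ger0_norm ?mulr_ge0 ?exprn_ge0//.
have -> : B ^+ d = B ^+ (d.+1.-1 - i) * B ^+ i by rewrite -exprD subnK// -ltnS.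
by rewrite ler_pM ?exprn_ge0// lerXn2r// nnegrE.
Qed.

(** Contents and m lie in [0, 2m] and differ by at most n, so each d-th power is off by at most d
    (2m)^(d-1) n. Each hook contributes at most n^d <= n m^(d-1), which accounts for the summand
    1. *)
Lemma power_sums_le d : (2 <= d)%N ->
  `|\sum_(x <- a) x%:R ^+ d - \sum_(x <- h) x%:R ^+ d - n%:R * m%:R ^+ d| <=
  n%:R * (n%:R * m%:R ^+ d.-1) * (d%:R * 2 ^+ d.-1 + 1) :> R.
Proof.
move=> d2.
have -> : n%:R * m%:R ^+ d = \sum_(x <- a) m%:R ^+ d :> R.
  by rewrite big_const_seq count_predT iter_addr addr0 (size_contents sz) mulr_natl.
rewrite addrAC -sumrB; apply: (le_trans (ler_normB _ _)).
rewrite mulrDr mulr1 lerD//.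
  apply: le_trans (ler_norm_sum _ _ _) _.
  rewrite -!mulrA -[X in X%:R * _](size_contents sz); apply: sum_seq_le => x xa.
  have nn : 0 <= n%:R :> R by []. have mm : 0 <= m%:R :> R by [].
  apply: le_trans (@exprB_le _ _ (2 * m%:R) d _ _) _.
  - by rewrite ler0n (le_trans (contents_le xa))// mulr_natl mulr2n lerD2l.
  - by rewrite ler0n/=; lra.
  have : `|x%:R - m%:R| <= n%:R :> R.
    by rewrite ler_norml lerBrDr addrC contents_ge//= lerBlDr addrC contents_le.
  have c0 : 0 <= d%:R * (2 * m%:R) ^+ d.-1 :> R by rewrite mulr_ge0// exprn_ge0// mulr_ge0.
  move=> /(ler_wpM2l c0) /le_trans; apply.
  by rewrite exprMn le_eqVlt; apply/orP; left; apply/eqP; ring.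
rewrite ger0_norm; last by apply: sumr_ge0 => x _; rewrite exprn_ge0.
rewrite -[X in X%:R * _](size_hooks lamP sz); apply: sum_seq_le => x xh.
apply: (@le_trans _ _ (n%:R ^+ d)); first by rewrite lerXn2r ?nnegrE//; exact: hooks_le.
rewrite -[in leLHS](prednK (ltnW d2)) exprS ler_wpM2l//.
by rewrite lerXn2r ?nnegrE.
Qed.

End bounds.

(** The inequality 1 - w <= e^(-w) at w = z/(1 + z). It turns the lower bound 1 + y^2/6 for sinh y /
    y into an exponential one, stable under n-th powers. *)
Lemma expR_le1D (R : realType) (z : R) : 0 <= z -> expR (z / (1 + z)) <= 1 + z.
Proof.
move=> z0; have p : 0 < 1 + z by lra.
have := expR_ge1Dx (- (z / (1 + z))).
have -> : 1 + - (z / (1 + z)) = (1 + z)^-1 by field; rewrite gt_eqF.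
by rewrite expRN lef_pV2 ?posrE ?expR_gt0.
Qed.

(** * Explicit bounds for the standardized moment generating function *)

Section uniform_bounds.
Context (R : realType) (lam : seq nat) (m : nat).
Hypothesis lamP : is_partition lam.
Hypothesis sz : (size lam <= m)%N.
Local Notation X := (rank_ssyt R lam m).
Local Notation k := (sumn lam).
Variables n mR : R.
Hypothesis nE : k%:R = n.
Hypothesis mE : m%:R = mR.
Hypothesis n_gt0 : 0 < n.
Hypothesis n_lt_m : 2 * n < mR.
(* The variance is close to [n m^2 / 12], so [m tau / 2] is close to [y]. *)
Variables (t y tau : R).
Hypothesis yE : y ^+ 2 = 3 * t ^+ 2 / n.
Hypothesis tauE : tau = t / Num.sqrt (cumulant X 2).

Let nm : n <= mR. Proof. by move: n_gt0 n_lt_m; lra. Qed.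

Let nm' : ((sumn lam)%:R : R) <= m%:R. Proof. by rewrite nE mE. Qed.

(** The factor (m - n)^2 - n^2 = m (m - 2n) of [variance_ge] is replaced by the smaller square (m -
    2n)^2, so that the bound on [tau] has a rational form. *)
Let V_ge : n * (mR - 2 * n) ^+ 2 / 12 <= cumulant X 2.
Proof.
have := variance_ge lamP sz nm'; rewrite nE mE; apply: le_trans.
rewrite ler_pM2r ?invr_gt0// ler_pM2l//.
have h : 0 <= (2 * n) * (mR - 2 * n) by rewrite mulr_ge0//; move: n_gt0 n_lt_m; lra.
by move: h; rewrite !expr2; move: n_gt0 n_lt_m; lra.
Qed.

Let V_gt0 : 0 < cumulant X 2.
Proof. by apply: lt_le_trans V_ge; rewrite divr_gt0// mulr_gt0// exprn_gt0// subr_gt0. Qed.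

Let tau2 : tau ^+ 2 = t ^+ 2 / cumulant X 2.
Proof. by rewrite tauE expr_div_n sqr_sqrtr// ltW. Qed.

(** Stated for squares because t and y may be negative, and because sinh y / y is monotone in
    y^2. *)
Lemma scaled_tau_le c : (c * tau / 2) ^+ 2 <= (y * (c / (mR - 2 * n))) ^+ 2.
Proof.
have d0 : 0 < mR - 2 * n by rewrite subr_gt0.
rewrite !exprMn tau2 yE.
have -> : c ^+ 2 * (t ^+ 2 / cumulant X 2) * 2^-1 ^+ 2 = (c ^+ 2 * t ^+ 2) * (4 * cumulant X 2)^-1.
  by field; rewrite gt_eqF.
have -> : 3 * t ^+ 2 / n * (c ^+ 2 * (mR - 2 * n)^-1 ^+ 2) =
    (c ^+ 2 * t ^+ 2) * (n * (mR - 2 * n) ^+ 2 / 3)^-1.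
  by field; rewrite !gt_eqF.
apply: ler_wpM2l; first by rewrite mulr_ge0 ?sqr_ge0.
rewrite lef_pV2 ?posrE; last 2 first.
- by rewrite mulr_gt0.
- by rewrite divr_gt0// mulr_gt0// exprn_gt0.
by have := V_ge; move: n_gt0 n_lt_m; lra.
Qed.

Lemma scaled_tau_ge c : (y * (c / (mR + n))) ^+ 2 <= (c * tau / 2) ^+ 2.
Proof.
have d0 : 0 < mR + n by move: n_gt0 n_lt_m; lra.
rewrite !exprMn tau2 yE.
have -> : c ^+ 2 * (t ^+ 2 / cumulant X 2) * 2^-1 ^+ 2 = (c ^+ 2 * t ^+ 2) * (4 * cumulant X 2)^-1.
  by field; rewrite gt_eqF.
have -> : 3 * t ^+ 2 / n * (c ^+ 2 * (mR + n)^-1 ^+ 2) =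
    (c ^+ 2 * t ^+ 2) * (n * (mR + n) ^+ 2 / 3)^-1.
  by field; rewrite !gt_eqF.
apply: ler_wpM2l; first by rewrite mulr_ge0 ?sqr_ge0.
rewrite lef_pV2 ?posrE; last 2 first.
- by rewrite divr_gt0// mulr_gt0// exprn_gt0.
- by rewrite mulr_gt0.
by have := variance_le R lamP sz; rewrite nE mE; move: n_gt0 n_lt_m; lra.
Qed.

Lemma std_mgf_upper :
  std_mgf lam m tau <= sinhc (y * ((mR + n) / (mR - 2 * n))) ^+ k.
Proof.
have := std_mgf_le lamP sz tau; rewrite nE mE => /le_trans; apply.
by rewrite lerXn2r ?nnegrE ?(ltW (sinhc_gt0 _))//; apply/sinhc_le/scaled_tau_le.
Qed.

Lemma std_mgf_lower :
  (sinhc (y * ((mR - n) / (mR + n))) / expR ((y * (n / (mR - 2 * n))) ^+ 2 / 6)) ^+ k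
  <= std_mgf lam m tau.
Proof.
have := std_mgf_ge lamP sz nm' tau; rewrite nE mE; apply: le_trans.
have s0 z : 0 <= sinhc z :> R by exact/ltW/sinhc_gt0.
rewrite lerXn2r ?nnegrE ?divr_ge0// ?expR_ge0//.
apply: ler_pM; rewrite ?invr_ge0 ?expR_ge0//; first exact/sinhc_le/scaled_tau_ge.
rewrite lef_pV2 ?posrE ?expR_gt0 ?sinhc_gt0//.
apply: le_trans (sinhc_le_expR _) _; rewrite ler_expR ler_wpM2r ?invr_ge0//.
exact: scaled_tau_le.
Qed.

Lemma std_mgf_upper_exp :
  std_mgf lam m tau <= expR (t ^+ 2 / 2 * ((mR + n) / (mR - 2 * n)) ^+ 2).
Proof.
apply: le_trans std_mgf_upper _.
apply: (@le_trans _ _ (expR ((y * ((mR + n) / (mR - 2 * n))) ^+ 2 / 6) ^+ k)).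
  rewrite lerXn2r ?nnegrE ?expR_ge0 ?(ltW (sinhc_gt0 _))//.
  exact: sinhc_le_expR.
rewrite -expRM_natl nE ler_expR exprMn yE le_eqVlt; apply/orP; left; apply/eqP.
by field; rewrite !gt_eqF// subr_gt0.
Qed.

(** L/n is the value of z^2/6 at the argument z of the numerator in [std_mgf_lower]; each of the n
    factors is at least 1 + L/n, to which [expR_le1D] applies. *)
Lemma std_mgf_lower_exp L : L = t ^+ 2 / 2 * ((mR - n) / (mR + n)) ^+ 2 ->
  expR (L / (1 + L / n) - t ^+ 2 / 2 * (n / (mR - 2 * n)) ^+ 2) <= std_mgf lam m tau.
Proof.
move=> LE; apply: le_trans std_mgf_lower.
have L0 : 0 <= L by rewrite LE mulr_ge0 ?divr_ge0 ?sqr_ge0.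
have Ln : 0 <= L / n by rewrite divr_ge0// ltW.
have s0 z : 0 <= sinhc z :> R by exact/ltW/sinhc_gt0.
have e : expR (L / n / (1 + L / n)) <= sinhc (y * ((mR - n) / (mR + n))).
  apply: le_trans (expR_le1D Ln) _; apply: le_trans (sinhc_ge _).
  rewrite lerD2l exprMn yE LE le_eqVlt; apply/orP; left; apply/eqP.
  by field; rewrite !gt_eqF//; move: n_gt0 n_lt_m; lra.
apply: (@le_trans _ _ ((expR (L / n / (1 + L / n)) /
    expR ((y * (n / (mR - 2 * n))) ^+ 2 / 6)) ^+ k)).
  rewrite -expRN -expRD -expRM_natl nE ler_expR [(y * _) ^+ 2]exprMn yE.
  rewrite le_eqVlt; apply/orP; left; apply/eqP.
  field; rewrite !gt_eqF ?subr_gt0//; move: n_gt0 n_lt_m; lra.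
rewrite lerXn2r ?nnegrE ?divr_ge0 ?expR_ge0//.
by rewrite ler_pM2r// invr_gt0 expR_gt0.
Qed.

End uniform_bounds.

Section cvg_compositions.
Context (R : realType) (u : nat -> R) (l : R).
Hypothesis ul : u N @[N --> \oo] --> l.

Lemma cvg_exprn k : u N ^+ k @[N --> \oo] --> l ^+ k.
Proof. exact: (cvg_comp _ (fun x : R => x ^+ k) ul (@exprn_continuous R k l)). Qed.

Lemma cvg_expR : expR (u N) @[N --> \oo] --> expR l.
Proof. exact: (cvg_comp _ expR ul (@continuous_expR R l)). Qed.

End cvg_compositions.
Arguments cvg_exprn {R u l} ul k.
Arguments cvg_expR {R u l} ul.

(** * Limits as n/m tends to 0 *)

Section asymptotics.
Context (R : realType) (lam : nat -> seq nat) (m : nat -> nat).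
Hypothesis lamP : forall N, is_partition (lam N).
Hypothesis m_gt0 : forall N, (0 < m N)%N.
Hypothesis sz : forall N, (size (lam N) <= m N)%N.
Local Notation n N := ((sumn (lam N))%:R : R).
Local Notation mR N := ((m N)%:R : R).
Hypothesis ratio0 : n N / mR N @[N --> \oo] --> (0 : R).

Let mR_gt0 N : 0 < mR N. Proof. by rewrite ltr0n. Qed.

Lemma near_ratio_le (e : R) : 0 < e -> \forall N \near \oo, n N <= e * mR N.
Proof.
move=> e0; have /cvgrPdist_le/(_ _ e0) := ratio0.
apply: filterS => N; rewrite sub0r normrN ger0_norm ?divr_ge0// ler_pdivrMr//.
Qed.

Lemma near_double_lt : \forall N \near \oo, 2 * n N < mR N.
Proof.
have := @near_ratio_le 3^-1 _; rewrite invr_gt0 => /(_ (ltr0Sn _ _)).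
apply: filterS => N; have := mR_gt0 N; lra.
Qed.

(** Numerator and denominator are divided by m. All ratios in the explicit bounds are of this
    form. *)
Lemma moebius_cvg (a b c : R) :
  (a * mR N + b * n N) / (mR N + c * n N) @[N --> \oo] --> a.
Proof.
suff : (a + b * (n N / mR N)) / (1 + c * (n N / mR N)) @[N --> \oo] --> (a + b * 0) / (1 + c * 0).
  rewrite !mulr0 !addr0 divr1; apply: cvg_trans; apply: near_eq_cvg; near=> N.
  have mN := lt0r_neq0 (mR_gt0 N).
  have -> : a * mR N + b * n N = (a + b * (n N / mR N)) * mR N by field.
  have -> : mR N + c * n N = (1 + c * (n N / mR N)) * mR N by field.
  by rewrite -mulf_div divff// mulr1.
apply: cvgM; first by apply: cvgD; [exact: cvg_cst|apply: cvgM => //; exact: cvg_cst].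
apply: cvgV; first by rewrite mulr0 addr0 oner_neq0.
by apply: cvgD; [exact: cvg_cst|apply: cvgM => //; exact: cvg_cst].
Unshelve. all: by end_near. Qed.

Let upper_cvg : (mR N + n N) / (mR N - 2 * n N) @[N --> \oo] --> (1 : R).
Proof.
by have := @moebius_cvg 1 1 (-2); under eq_fun do rewrite !mul1r mulNr.
Qed.

Let lower_cvg : (mR N - n N) / (mR N + n N) @[N --> \oo] --> (1 : R).
Proof.
by have := @moebius_cvg 1 (-1) 1; under eq_fun do rewrite !mul1r mulN1r.
Qed.

Let error_cvg : n N / (mR N - 2 * n N) @[N --> \oo] --> (0 : R).
Proof.
by have := @moebius_cvg 0 1 (-2); under eq_fun do rewrite mul1r mul0r add0r mulNr.
Qed.

(** The error in [power_sums_le] is n m^d times a constant multiple of n/m. The factor B_d/d is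
    common to both sides and is taken out of the norms, so odd d, for which it vanishes, are covered
    as well. *)
Lemma cumulant_rank_equiv d : (2 <= d)%N ->
  (fun N => cumulant (rank_ssyt R (lam N) (m N)) d : R) ~_\oo
  (fun N => ratr (bernoulli d) / d%:R * n N * mR N ^+ d : R).
Proof.
move=> d2; apply/eqaddoP => e e0; set K := d%:R * 2 ^+ d.-1 + 1 : R.
have K0 : 0 < K by rewrite ltr_wpDl// mulr_ge0// exprn_ge0.
have := near_ratio_le (divr_gt0 e0 K0); apply: filterS2 near_double_lt => N lt2 le.
rewrite /= !fctE cumulant_rank//.
have nm : n N <= mR N by have : 0 <= n N by []; move: lt2; lra.
rewrite -/(bernR R d); set b := bernR R d / d%:R.
rewrite -[b * _ * _]mulrA -mulrBr (normrM b) (normrM b (_ * _)) (mulrCA e) ler_wpM2l//.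
apply: le_trans (power_sums_le (lamP N) (sz N) nm d2) _.
rewrite ger0_norm ?mulr_ge0 ?exprn_ge0// -/K.
rewrite -(prednK (ltnW d2)) [_.+1.-1]/= [mR N ^+ _.+1]exprS.
have -> : n N * (n N * mR N ^+ d.-1) * K = n N * mR N ^+ d.-1 * (n N * K) by ring.
have -> : e * (n N * (mR N * mR N ^+ d.-1)) = n N * mR N ^+ d.-1 * (e * mR N) by ring.
rewrite ler_wpM2l ?mulr_ge0 ?exprn_ge0//.
by rewrite -ler_pdivlMr// mulrAC.
Qed.

Lemma std_mgf_cvg_normal (t : R) : (sumn (lam N) @[N --> \oo] --> \oo) ->
  std_mgf (lam N) (m N) (t / Num.sqrt (cumulant (rank_ssyt R (lam N) (m N)) 2))
    @[N --> \oo] --> expR (t ^+ 2 / 2).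
Proof.
move=> ny.
have scal (u : nat -> R) : u N @[N --> \oo] --> (1 : R) ->
    t ^+ 2 / 2 * u N ^+ 2 @[N --> \oo] --> t ^+ 2 / 2.
  move=> u1; have := cvg_exprn u1 2; rewrite expr1n => u2.
  by rewrite -[X in _ --> X]mulr1; apply: cvgM => //; exact: cvg_cst.
pose L N := t ^+ 2 / 2 * ((mR N - n N) / (mR N + n N)) ^+ 2.
have n_gt0 : \forall N \near \oo, 0 < n N.
  by have /cvgnyPgt/(_ 0%N) := ny; apply: filterS => N; rewrite ltr0n.
have V0 : (n N)^-1 @[N --> \oo] --> (0 : R) by apply/gtr0_cvgV0 => //; apply/cvgrnyP.
have Lc : L N @[N --> \oo] --> t ^+ 2 / 2 by exact: scal lower_cvg.
apply: (@squeeze_cvgr _ _ _ _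
  (fun N => expR (L N / (1 + L N / n N) - t ^+ 2 / 2 * (n N / (mR N - 2 * n N)) ^+ 2))
  (fun N => expR (t ^+ 2 / 2 * ((mR N + n N) / (mR N - 2 * n N)) ^+ 2))).
- near=> N.
  have n0 : 0 < n N by near: N.
  have lt2 : 2 * n N < mR N by near: N; exact: near_double_lt.
  (* The bounds used here involve y only through y^2, so the nonnegative root serves for either sign
     of t. *)
  have yE : Num.sqrt (3 * t ^+ 2 / n N) ^+ 2 = 3 * t ^+ 2 / n N.
    by rewrite sqr_sqrtr// divr_ge0// mulr_ge0// sqr_ge0.
  apply/andP; split.
    exact: (std_mgf_lower_exp (lamP N) (sz N) erefl erefl n0 lt2 yE erefl erefl).
  exact: (std_mgf_upper_exp (lamP N) (sz N) erefl erefl n0 lt2 yE erefl).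
- apply: cvg_expR.
  rewrite -[X in _ --> X]subr0; apply: cvgB; last first.
    rewrite -[X in _ --> X](mulr0 (t ^+ 2 / 2)); apply: cvgM; first exact: cvg_cst.
    by have := cvg_exprn error_cvg 2; rewrite expr0n.
  rewrite -[X in _ --> X]divr1; apply: cvgM => //.
  apply: cvgV; first exact: oner_neq0.
  rewrite -[X in _ --> X]addr0; apply: cvgD; first exact: cvg_cst.
  by rewrite -[X in _ --> X](mulr0 (t ^+ 2 / 2)); exact: cvgM.
- by apply: cvg_expR; exact: scal upper_cvg.
Unshelve. all: by end_near. Qed.

Lemma std_mgf_cvg_irwin_hall (t : R) M : (\forall N \near \oo, sumn (lam N) = M) ->
  std_mgf (lam N) (m N) (t / Num.sqrt (cumulant (rank_ssyt R (lam N) (m N)) 2))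
    @[N --> \oo] --> sinhc (t / Num.sqrt (M%:R / 12) / 2) ^+ M.
Proof.
(* For M = 0 the shape is eventually empty, and so are both products. *)
move=> nM; have [M0|M0] := posnP M.
  rewrite M0 expr0; apply: cvg_near_cst; apply: filterS nM => N; rewrite M0 => n0.
  have /size0nil c0 : size (contents (lam N) (m N)) = 0%N by rewrite size_contents.
  have /size0nil h0 : size (hooks (lam N) (m N)) = 0%N by rewrite size_hooks.
  by rewrite /std_mgf c0 h0 !big_nil divr1.
(* At t = 0 all factors are 1; for the other t the limit argument y is nonzero, where
   [sinhc_continuous] applies. *)
have [->|t0] := eqVneq t 0.
  rewrite !mul0r sinhc0 expr1n; apply: cvg_near_cst; apply: nearW => N.
  rewrite /std_mgf !mul0r !big1 ?divr1// => x _; rewrite mulr0 mul0r; exact: sinhc0.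
set y := t / Num.sqrt (M%:R / 12) / 2.
have y0 : y != 0.
  by rewrite /y !mulf_neq0 ?invr_neq0// gt_eqF// sqrtr_gt0 divr_gt0// ltr0n.
have cs (u : nat -> R) : u N @[N --> \oo] --> (1 : R) -> sinhc (y * u N) @[N --> \oo] --> sinhc y.
  move=> u1; have yu : y * u N @[N --> \oo] --> y.
    by rewrite -[X in _ --> X]mulr1; apply: cvgM => //; exact: cvg_cst.
  exact: (cvg_comp _ (@sinhc R) yu (@sinhc_continuous R y y0)).
apply: (@squeeze_cvgr _ _ _ _
  (fun N => (sinhc (y * ((mR N - n N) / (mR N + n N))) /
    expR ((y * (n N / (mR N - 2 * n N))) ^+ 2 / 6)) ^+ M)
  (fun N => sinhc (y * ((mR N + n N) / (mR N - 2 * n N))) ^+ M)).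
- near=> N.
  have kE : sumn (lam N) = M by near: N.
  have n0 : 0 < n N by rewrite kE ltr0n.
  have lt2 : 2 * n N < mR N by near: N; exact: near_double_lt.
  have yE : y ^+ 2 = 3 * t ^+ 2 / n N.
    rewrite kE /y !expr_div_n sqr_sqrtr ?divr_ge0//; field.
    by rewrite pnatr_eq0 gtn_eqF.
  apply/andP; split.
    by have := std_mgf_lower (lamP N) (sz N) erefl erefl n0 lt2 yE erefl; rewrite [X in _ ^+ X]kE.
  by have := std_mgf_upper (lamP N) (sz N) erefl erefl n0 lt2 yE erefl; rewrite [X in _ ^+ X]kE.
- apply: cvg_exprn.
  rewrite -[X in _ --> X]divr1; apply: cvgM; first exact: cs.
  apply: cvgV; first exact: oner_neq0.
  rewrite -[X in _ --> X]expR0; apply: cvg_expR.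
  rewrite -[X in _ --> X](mul0r 6^-1) -[X in X / 6](expr0n _ 2).
  apply: cvgM; last exact: cvg_cst.
  apply: cvg_exprn.
  by rewrite -[X in _ --> X](mulr0 y); apply: cvgM => //; exact: cvg_cst.
- by apply: cvg_exprn; exact: cs.
Unshelve. all: by end_near. Qed.

End asymptotics.

Theorem theorem4p1 (R : realType) (lam : nat -> seq nat) (m : nat -> nat)
    (hlam : forall N, is_partition (lam N))
    (hm : forall N, (0 < m N)%N)
    (hlen : forall N, (size (lam N) <= m N)%N)
    (hnm : ((sumn (lam N))%:R / (m N)%:R : R) @[N --> \oo] --> (0 : R)) :
  [/\ forall d : nat, (2 <= d)%N ->
        (fun N => cumulant (rank_ssyt R (lam N) (m N)) d : R) ~_\oo
        (fun N => ratr (bernoulli d) / d%:R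
                    * (sumn (lam N))%:R * (m N)%:R ^+ d : R),
      forall M : nat,
        ((sumn (lam N))%:R : R) @[N --> \oo] --> (M%:R : R) ->
        cvg_in_distribution
          (fun N => law (standardize (rank_ssyt R (lam N) (m N))))
          (law (standardize (irwin_hall R M))) &
      (sumn (lam N) @[N --> \oo] --> \oo) ->
        cvg_in_distribution
          (fun N => law (standardize (rank_ssyt R (lam N) (m N))))
          (standard_normal R)].
Proof.
have mgfE N t := law_rank_mgf (R := R) (hlam N) (hlen N) t.
split=> [d d2|M nM|ny].
- exact: cumulant_rank_equiv.
- apply: (cvg_in_distribution_mgfE mgfE (law_irwin_hall_mgf M)) => t.
  apply: std_mgf_cvg_irwin_hall => //.
  (* The sizes are integers, so once within distance 1 of M they equal M. *)
  move/cvgrPdist_lt : nM => /(_ 1 ltr01); apply: filterS => N.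
  rewrite ltr_norml => /andP[]; rewrite ltrBrDr addrC ltrBlDr natr1 ltr_nat => Mn.
  rewrite ltrBlDr addrC natr1 ltr_nat => nM; lia.
- apply: (cvg_in_distribution_mgfE mgfE (@standard_normal_mgf R)) => t.
  exact: std_mgf_cvg_normal.
Qed.
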